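(* A theory $U$ is polyglot iff $U$ locally tolerates the theory ${\sf Q}$ plus all true $\Pi^0_1$-sentences.
   Context: Theories are first-order theories in finite signature; interpretations may be multi-dimensional and piecewise; $W\rhd D$ means $W$ interprets $D$. ${\sf Q}$ is Robinson Arithmetic. For a $U$-sentence $B$, $B$ is a pro-interpreter of $A$ over $U$ if $(U+B)\rhd A$. $U$ is polyglot iff for every consistent finitely axiomatised $A$ there is a pro-interpreter $B$ of $A$ over $U$ with $U+B$ consistent. For a finitely axiomatised $A$, $E_A$ is the conjunction of the identity axioms for the signature of $A$ together with $\exists x\,x=x$. $U$ locally tolerates $V$ iff for every finite subtheory $A$ of $V$ there is a translation $\tau$ from the language of $A$ into that of $U$ with $U+(E_A\wedge A)^\tau$ consistent. *)

(* Defs.v *)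
From HB Require Import structures.
From mathcomp Require Import all_boot.
From Stdlib Require List.

Set Implicit Arguments.
Unset Strict Implicit.
Unset Printing Implicit Defensive.

(** * First-order logic with identity over a finite signature *)

Record signature := Signature {
  func : finType;
  pred_sym : finType;
  ar_func : func -> nat;
  ar_pred : pred_sym -> nat }.

(* Variables are de Bruijn indices. *)
Inductive term (S : signature) :=
| Var of nat
| App (f : func S) of ('I_(ar_func f) -> term S).

Inductive form (S : signature) :=
| Bot
| Eq of term S & term S
| Rel (R : pred_sym S) of ('I_(ar_pred R) -> term S)
| Imp of form S & form S
| All of form S.

Arguments Var {S} _.
Arguments App {S} f _.
Arguments Bot {S}.
Arguments Rel {S} R _.

Section Syntax.
Variable S : signature.
Implicit Types (t : term S) (phi psi : form S).

Definition Neg phi := Imp phi Bot.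
Definition Top : form S := Imp Bot Bot.
Definition And phi psi := Neg (Imp phi (Neg psi)).
Definition Or phi psi := Imp (Neg phi) psi.
Definition Ex phi := Neg (All (Neg phi)).

Definition Alls (n : nat) phi := iter n (@All S) phi.
Definition Exs (n : nat) phi := iter n Ex phi.

Fixpoint tsubst (s : nat -> term S) t : term S :=
  match t with
  | Var x => s x
  | App f ts => App f (fun i => tsubst s (ts i))
  end.

Definition tshift (n : nat) t := tsubst (fun x => Var (n + x)) t.

Definition up (s : nat -> term S) (x : nat) : term S :=
  if x is y.+1 then tshift 1 (s y) else Var 0.

Fixpoint fsubst (s : nat -> term S) phi : form S :=
  match phi with
  | Bot => Bot
  | Eq t u => Eq (tsubst s t) (tsubst s u)
  | Rel R ts => Rel R (fun i => tsubst s (ts i))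
  | Imp phi psi => Imp (fsubst s phi) (fsubst s psi)
  | All phi => All (fsubst (up s) phi)
  end.

Definition fshift (n : nat) phi := fsubst (fun x => Var (n + x)) phi.

(* [subst1 t phi] replaces variable 0 by [t] and lowers the other variables. *)
Definition subst1 t phi := fsubst (fun x => if x is y.+1 then Var y else t) phi.

(* All free variables are < n. *)
Fixpoint tbound (n : nat) t : bool :=
  match t with
  | Var x => x < n
  | App f ts => [forall i, tbound n (ts i)]
  end.

Fixpoint fbound (n : nat) phi : bool :=
  match phi with
  | Bot => true
  | Eq t u => tbound n t && tbound n u
  | Rel R ts => [forall i, tbound n (ts i)]
  | Imp phi psi => fbound n phi && fbound n psi
  | All phi => fbound n.+1 phi
  end.

Definition sentence phi : bool := fbound 0 phi.

(* Classical natural deduction. The side conditions of the quantifier rules are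
   expressed by shifting; since every variable denotes, [Ex (Eq (Var 0) (Var 0))]
   is derivable, i.e. domains are nonempty. *)
Inductive nd : seq (form S) -> form S -> Prop :=
| nd_hyp G phi : List.In phi G -> nd G phi
| nd_impI G phi psi : nd (phi :: G) psi -> nd G (Imp phi psi)
| nd_impE G phi psi : nd G (Imp phi psi) -> nd G phi -> nd G psi
| nd_contra G phi : nd (Neg phi :: G) Bot -> nd G phi
| nd_allI G phi : nd (map (fshift 1) G) phi -> nd G (All phi)
| nd_allE G phi t : nd G (All phi) -> nd G (subst1 t phi)
| nd_eqI G t : nd G (Eq t t)
| nd_eqE G phi t u : nd G (Eq t u) -> nd G (subst1 t phi) -> nd G (subst1 u phi).

End Syntax.

Arguments Top {S}.

(** * Theories *)

(* The set of axioms; [is_theory] says that they are sentences. No effectivity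
   is assumed. *)
Definition theory (S : signature) := form S -> Prop.

Section Theories.
Variable S : signature.
Implicit Types (U : theory S) (phi : form S) (A : seq (form S)).

Definition is_theory U := forall phi, U phi -> sentence phi.

Definition proves U phi :=
  exists2 G, (forall psi, List.In psi G -> U psi) & nd G phi.

Definition consistent U := ~ proves U Bot.

Definition add_axiom U phi : theory S := fun psi => U psi \/ psi = phi.

Definition union_theory U V : theory S := fun psi => U psi \/ V psi.

Definition fin_theory A : theory S := fun phi => List.In phi A.

Definition conj_axioms A : form S := \big[@And S/Top]_(phi <- A) phi.

End Theories.

(** * Unravelling of terms *)

(* Translations act on relational formulas; a function symbol [f] of arity n
   is first replaced by a predicate symbol [inl f] of arity n + 1 for its graph,
   the last argument being the value. *)
Definition graph_sig (S : signature) : signature :=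
  @Signature void (func S + pred_sym S)%type
    (fun f => match f with end)
    (fun R => match R with inl f => (ar_func f).+1 | inr R => ar_pred R end).

Section Unravel.
Variable S : signature.
Local Notation gform := (form (graph_sig S)).

Definition graph_atom (f : func S) (xs : 'I_(ar_func f) -> nat) (y : nat) : gform :=
  @Rel (graph_sig S) (inl f)
    (fun i : 'I_(ar_func f).+1 =>
       Var (if unlift ord_max i is Some j then xs j else y)).

Definition pred_atom (R : pred_sym S) (xs : 'I_(ar_pred R) -> nat) : gform :=
  @Rel (graph_sig S) (inr R) (fun i : 'I_(ar_pred R) => Var (xs i)).

(* [tgraph r t y] expresses that the value of [t], with its variables renamed by
   [r], is [y]. *)
Fixpoint tgraph (r : nat -> nat) (t : term S) (y : nat) : gform :=
  match t with
  | Var x => Eq (Var (r x)) (Var y)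
  | App f ts =>
      let n := ar_func f in
      Exs n (And (\big[@And _/Top]_(i < n) tgraph (fun x => n + r x) (ts i) i)
                 (@graph_atom f (fun i => i) (n + y)))
  end.

Fixpoint unravel (phi : form S) : gform :=
  match phi with
  | Bot => Bot
  | Eq t u => Ex (And (tgraph succn t 0) (tgraph succn u 0))
  | Rel R ts =>
      let n := ar_pred R in
      Exs n (And (\big[@And _/Top]_(i < n) tgraph (fun x => n + x) (ts i) i)
                 (@pred_atom R (fun i => i)))
  | Imp phi psi => Imp (unravel phi) (unravel psi)
  | All phi => All (unravel phi)
  end.

(* The identity axioms in [graph_sig S]. For a function symbol they comprise, next
   to congruence, that its graph is the graph of a total function. *)
Definition eq_refl_ax : gform := All (Eq (Var 0) (Var 0)).

Definition eq_sym_ax : gform :=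
  Alls 2 (Imp (Eq (Var 1) (Var 0)) (Eq (Var 0) (Var 1))).

Definition eq_trans_ax : gform :=
  Alls 3 (Imp (Eq (Var 2) (Var 1)) (Imp (Eq (Var 1) (Var 0)) (Eq (Var 2) (Var 0)))).

Definition eq_congr_ax (R : pred_sym (graph_sig S)) : gform :=
  let n := ar_pred R in
  Alls (n + n)
    (Imp (\big[@And _/Top]_(i < n) Eq (Var i) (Var (n + i)))
       (Imp (Rel R (fun i => Var i)) (Rel R (fun i => Var (n + i))))).

Definition total_ax (f : func S) : gform :=
  let n := ar_func f in
  Alls n (Ex (@graph_atom f (fun i => i.+1) 0)).

Definition functional_ax (f : func S) : gform :=
  let n := ar_func f in
  Alls n.+2 (Imp (@graph_atom f (fun i => i.+2) 0)
               (Imp (@graph_atom f (fun i => i.+2) 1)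
                  (Eq (Var 0) (Var 1)))).

(* The sentence E_A for [A] of signature [S]. *)
Definition identity_ax : gform :=
  And (conj_axioms [:: eq_refl_ax; eq_sym_ax; eq_trans_ax;
                       Ex (Eq (Var 0) (Var 0))])
  (And (\big[@And _/Top]_(R : pred_sym (graph_sig S)) eq_congr_ax R)
       (\big[@And _/Top]_(f : func S) And (total_ax f) (functional_ax f))).

End Unravel.

(** * Translations and interpretations *)

(* Multi-dimensional, piecewise, relative, parameter-free translations, which need
   not translate identity by identity; dimension 0 is allowed. An object of the source is given by a piece
   [p] and a block of [dim p] target objects. The formula [tr_pred R ps] speaks
   about the concatenation of the blocks of the arguments. A distinguished piece
   excludes the translation with no pieces, for which ∃x x=x becomes false. *)
Record translation (S T : signature) := Translation {
  piece : finType;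
  piece0 : piece;
  dim : piece -> nat;
  tr_dom : piece -> form T;
  tr_eq : piece -> piece -> form T;
  tr_pred : forall R : pred_sym (graph_sig S),
    {ffun 'I_(ar_pred R) -> piece} -> form T;
  tr_dom_bound : forall p, fbound (dim p) (tr_dom p);
  tr_eq_bound : forall p q, fbound (dim p + dim q) (tr_eq p q);
  tr_pred_bound : forall R (ps : {ffun 'I_(ar_pred R) -> piece}),
    fbound (\sum_(i < ar_pred R) dim (ps i)) (tr_pred ps) }.

Section Translate.
Variables (S T : signature) (tau : translation S T).

(* A source variable is represented by a piece and a block of target variables. *)
Let env := nat -> piece tau * seq nat.

Definition env0 : env := fun=> (piece0 tau, nseq (dim (piece0 tau)) 0).

Definition env_cons (p : piece tau) (rho : env) : env := fun x =>
  if x is y.+1 then ((rho y).1, [seq dim p + v | v <- (rho y).2])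
  else (p, iota 0 (dim p)).

Definition var_of (t : term (graph_sig S)) : nat :=
  match t with Var x => x | App f _ => match f with end end.

Definition inst (phi : form T) (vs : seq nat) : form T :=
  fsubst (fun k => Var (nth 0 vs k)) phi.

Fixpoint tr_rel (rho : env) (phi : form (graph_sig S)) : form T :=
  match phi with
  | Bot => Bot
  | Eq t u =>
      let a := rho (var_of t) in let b := rho (var_of u) in
      inst (tr_eq a.1 b.1) (a.2 ++ b.2)
  | Rel R ts =>
      inst (tr_pred [ffun i => (rho (var_of (ts i))).1])
           (flatten [seq (rho (var_of (ts i))).2 | i <- enum 'I_(ar_pred R)])
  | Imp phi psi => Imp (tr_rel rho phi) (tr_rel rho psi)
  | All phi =>
      \big[@And T/Top]_(p : piece tau)
        Alls (dim p) (Imp (tr_dom p) (tr_rel (env_cons p rho) phi))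
  end.

(* On sentences [env0] is irrelevant. *)
Definition translate (phi : form (graph_sig S)) : form T := tr_rel env0 phi.

End Translate.

(* [W] interprets [D]. The identity axioms are theorems of predicate logic, but
   [unravel] does not reproduce them literally. *)
Definition interprets (S T : signature) (W : theory T) (D : theory S) :=
  exists tau : translation S T,
    proves W (translate tau (identity_ax S)) /\
    forall phi, sentence phi -> proves D phi -> proves W (translate tau (unravel phi)).

(** * Polyglot theories and local tolerance *)

Definition pro_interpreter (S T : signature)
    (U : theory S) (A : theory T) (B : form S) :=
  sentence B /\ interprets (add_axiom U B) A.

Definition polyglot (S : signature) (U : theory S) :=
  forall (T : signature) (A : seq (form T)),
    is_theory (fin_theory A) -> consistent (fin_theory A) ->
    exists B : form S,
      pro_interpreter U (fin_theory A) B /\ consistent (add_axiom U B).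

Definition subtheory (S : signature) (U V : theory S) :=
  forall phi, U phi -> proves V phi.

Definition locally_tolerates (S T : signature) (U : theory S) (V : theory T) :=
  forall A : seq (form T),
    is_theory (fin_theory A) -> subtheory (fin_theory A) V ->
    exists tau : translation T S,
      consistent (add_axiom U
        (translate tau (And (identity_ax T) (unravel (conj_axioms A))))).

(** * Tarskian semantics *)

Record structure (S : signature) := Structure {
  carrier : Type;
  int_func : forall f : func S, ('I_(ar_func f) -> carrier) -> carrier;
  int_pred : forall R : pred_sym S, ('I_(ar_pred R) -> carrier) -> Prop }.

Section Semantics.
Variables (S : signature) (M : structure S).

Fixpoint teval (e : nat -> carrier M) (t : term S) : carrier M :=
  match t with
  | Var x => e x
  | App f ts => int_func (fun i => teval e (ts i))
  end.

Fixpoint sat (e : nat -> carrier M) (phi : form S) : Prop :=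
  match phi with
  | Bot => False
  | Eq t u => teval e t = teval e u
  | Rel R ts => int_pred (fun i => teval e (ts i))
  | Imp phi psi => sat e phi -> sat e psi
  | All phi => forall a, sat (fun x => if x is y.+1 then e y else a) phi
  end.

Definition holds (phi : form S) := forall e, sat e phi.

End Semantics.

(** * Arithmetic *)

Inductive arith_func := FZero | FSucc | FAdd | FMul.

Definition arith_func_code (f : arith_func) : bool * bool :=
  match f with
  | FZero => (false, false) | FSucc => (false, true)
  | FAdd => (true, false) | FMul => (true, true)
  end.

Definition arith_func_decode (c : bool * bool) : arith_func :=
  match c with
  | (false, false) => FZero | (false, true) => FSucc
  | (true, false) => FAdd | (true, true) => FMul
  end.

Lemma arith_func_codeK : cancel arith_func_code arith_func_decode.
Proof. by case. Qed.

HB.instance Definition _ := Finite.copy arith_func (can_type arith_func_codeK).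

Definition arith : signature :=
  @Signature arith_func void
    (fun f => match f with FZero => 0 | FSucc => 1 | FAdd | FMul => 2 end)
    (fun R => match R with end).

Definition tzero : term arith := @App arith FZero (tnth [tuple]).
Definition tsucc (t : term arith) : term arith := @App arith FSucc (tnth [tuple t]).
Definition tadd (t u : term arith) : term arith := @App arith FAdd (tnth [tuple t; u]).
Definition tmul (t u : term arith) : term arith := @App arith FMul (tnth [tuple t; u]).

(* t <= u abbreviates ∃z z + t = u. *)
Definition fle (t u : term arith) : form arith :=
  Ex (Eq (tadd (Var 0) (tshift 1 t)) (tshift 1 u)).

Definition Q_axioms : seq (form arith) :=
  [:: All (Neg (Eq (tsucc (Var 0)) tzero));
      Alls 2 (Imp (Eq (tsucc (Var 1)) (tsucc (Var 0))) (Eq (Var 1) (Var 0)));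
      All (Or (Eq (Var 0) tzero) (Ex (Eq (Var 1) (tsucc (Var 0)))));
      All (Eq (tadd (Var 0) tzero) (Var 0));
      Alls 2 (Eq (tadd (Var 1) (tsucc (Var 0))) (tsucc (tadd (Var 1) (Var 0))));
      All (Eq (tmul (Var 0) tzero) tzero);
      Alls 2 (Eq (tmul (Var 1) (tsucc (Var 0)))
                 (tadd (tmul (Var 1) (Var 0)) (Var 1)))].

Definition Robinson_Q : theory arith := fin_theory Q_axioms.

(* Conjunction, disjunction and negation are covered by [Bot] and [Imp]. The shift
   of [t] expresses that the bounded variable does not occur in the bound. *)
Inductive Delta0 : form arith -> Prop :=
| Delta0_bot : Delta0 Bot
| Delta0_eq t u : Delta0 (Eq t u)
| Delta0_imp phi psi : Delta0 phi -> Delta0 psi -> Delta0 (Imp phi psi)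
| Delta0_all t phi : Delta0 phi -> Delta0 (All (Imp (fle (Var 0) (tshift 1 t)) phi))
| Delta0_ex t phi : Delta0 phi -> Delta0 (Ex (And (fle (Var 0) (tshift 1 t)) phi)).

Definition Pi1_sentence (phi : form arith) :=
  sentence phi /\ exists n psi, Delta0 psi /\ phi = Alls n psi.

Definition std_nat : structure arith :=
  @Structure arith nat
    (fun f => match f return ('I_(ar_func (f : func arith)) -> nat) -> nat with
              | FZero => fun=> 0
              | FSucc => fun v => (v ord0).+1
              | FAdd => fun v => v ord0 + v ord_max
              | FMul => fun v => v ord0 * v ord_max
              end)
    (fun R => match R with end).

Definition true_Pi1 : theory arith := fun phi =>
  Pi1_sentence phi /\ holds std_nat phi.

Definition Q_plus_true_Pi1 : theory arith := union_theory Robinson_Q true_Pi1.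

(* Main.v *)
(* From left to right: a finite subtheory of Q plus the true Pi1-sentences holds in
   the standard model, hence is consistent, and an interpretation of it in U + B
   turns the consistency of U + B into tolerance.

   From right to left, let A be consistent. Fix a model K of A, send numbers to
   elements of K in such a way that the function symbols of A, and counterexamples to
   its universal subformulas, become polynomials, and let X record which subformulas
   hold at which tuples. That A holds is then a universal property of X. The true
   Pi1-sentences needed say that every finite stage of this property is satisfied by
   some coded finite set. Any model of them has a leftmost branch through the tree of
   such sets, which is total on a definable cut closed under the polynomials; no
   induction is available, nor needed, as all steps are inductive clauses of cuts.
   On that cut the branch yields a definable model of A. This replaces the arithmetised
   consistency statement for A, so syntax is never coded inside arithmetic.
   Composing with the translation given by local tolerance interprets A. That the
   composite is an interpretation is checked in models, by Gödel's completeness theorem. *)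
Require Import Defs.
From mathcomp Require Import all_boot.
From mathcomp Require Import boolp.
From Stdlib Require List.

Set Implicit Arguments.
Unset Strict Implicit.
Unset Printing Implicit Defensive.

(** * Substitution and soundness *)

Definition scons (X : Type) (a : X) (e : nat -> X) (x : nat) : X :=
  if x is y.+1 then e y else a.

Definition blockenv (X : Type) (v : seq X) (e : nat -> X) (x : nat) : X :=
  if x < size v then nth (e 0) v x else e (x - size v).

Lemma blockenv0 (X : Type) (e : nat -> X) : blockenv [::] e = e.
Proof. by apply: funext => x; rewrite /blockenv /= subn0. Qed.

Lemma blockenv_rcons (X : Type) (v : seq X) a e :
  blockenv (rcons v a) e = blockenv v (scons a e).
Proof.
apply: funext => x; rewrite /blockenv size_rcons nth_rcons ltnS.
case: ltngtP => [lt_x|gt_x|->]; last by rewrite subnn.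
  exact: set_nth_default.
by rewrite subnS; move: gt_x; rewrite -subn_gt0; case: (x - size v).
Qed.

Lemma blockenv_lt (X : Type) d (v : seq X) e x :
  x < size v -> blockenv v e x = nth d v x.
Proof. by move=> lt_x; rewrite /blockenv lt_x; exact: set_nth_default. Qed.

Lemma blockenv_add (X : Type) (v : seq X) e x : blockenv v e (size v + x) = e x.
Proof. by rewrite /blockenv ltnNge leq_addr /= addKn. Qed.

Section SyntaxLemmas.
Variable S : signature.
Implicit Types (t : term S) (phi psi : form S) (s r : nat -> term S).

Lemma tbound_leq m n t : m <= n -> tbound m t -> tbound n t.
Proof.
move=> le_mn; elim: t => [x|f ts IH] /=; first by move/leq_trans; apply.
by move/forallP=> H; apply/forallP => i; apply: IH.
Qed.

Lemma fbound_leq m n phi : m <= n -> fbound m phi -> fbound n phi.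
Proof.
elim: phi m n => [|t u|R ts|phi IH1 psi IH2|phi IH] m n le_mn //=.
- by case/andP=> /(tbound_leq le_mn) -> /(tbound_leq le_mn) ->.
- by move/forallP=> H; apply/forallP => i; apply: tbound_leq (H i).
- by case/andP=> /(IH1 _ _ le_mn) -> /(IH2 _ _ le_mn) ->.
- by apply: IH; rewrite ltnS.
Qed.

Lemma tsubst_ext n t s r :
  tbound n t -> (forall x, x < n -> s x = r x) -> tsubst s t = tsubst r t.
Proof.
move=> + H; elim: t => [x|f ts IH] /=; first exact: H.
by move/forallP=> Hb; congr App; apply: funext => i; apply: IH.
Qed.

Lemma fsubst_ext n phi s r :
  fbound n phi -> (forall x, x < n -> s x = r x) -> fsubst s phi = fsubst r phi.
Proof.
elim: phi n s r => [|t u|R ts|phi IH1 psi IH2|phi IH] n s r //=.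
- by case/andP=> Ht Hu H; rewrite (tsubst_ext Ht H) (tsubst_ext Hu H).
- move=> /forallP Hb H; congr Rel; apply: funext => i.
  exact: tsubst_ext (Hb i) H.
- by case/andP=> Ht Hu H; rewrite (IH1 _ _ _ Ht H) (IH2 _ _ _ Hu H).
- move=> Hb H; congr All; apply: IH Hb _ => -[|x] //=.
  by rewrite ltnS => /H ->.
Qed.

Lemma tsubst_comp s r t :
  tsubst s (tsubst r t) = tsubst (fun x => tsubst s (r x)) t.
Proof.
by elim: t => [x|f ts IH] //=; congr App; apply: funext => i; apply: IH.
Qed.

Lemma up_comp s r :
  (fun x => tsubst (up s) (up r x)) = up (fun x => tsubst s (r x)).
Proof. by apply: funext => -[|x] //=; rewrite /tshift !tsubst_comp. Qed.

Lemma fsubst_comp s r phi :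
  fsubst s (fsubst r phi) = fsubst (fun x => tsubst s (r x)) phi.
Proof.
elim: phi s r => [|t u|R ts|phi IH1 psi IH2|phi IH] s r //=.
- by rewrite !tsubst_comp.
- by congr Rel; apply: funext => i; rewrite tsubst_comp.
- by rewrite IH1 IH2.
- by rewrite IH up_comp.
Qed.

Lemma tsubst_id t : tsubst Var t = t.
Proof. by elim: t => [x|f ts IH] //=; congr App; apply: funext. Qed.

Lemma up_id : up (@Var S) = Var.
Proof. by apply: funext => -[]. Qed.

Lemma fsubst_id phi : fsubst Var phi = phi.
Proof.
elim: phi => [|t u|R ts|phi IH1 psi IH2|phi IH] //=.
- by rewrite !tsubst_id.
- by congr Rel; apply: funext => i; rewrite tsubst_id.
- by rewrite IH1 IH2.
- by rewrite up_id IH.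
Qed.

Lemma fsubst_bound n phi s : fbound n phi -> (forall x, x < n -> s x = Var x) ->
  fsubst s phi = phi.
Proof. by move=> Ht H; rewrite (fsubst_ext Ht H) fsubst_id. Qed.

Lemma tbound_tsubst n m t s :
  tbound n t -> (forall x, x < n -> tbound m (s x)) -> tbound m (tsubst s t).
Proof.
move=> + H; elim: t => [x|f ts IH] /=; first exact: H.
by move/forallP=> Hb; apply/forallP => i; apply: IH.
Qed.

Lemma fbound_fsubst n m phi s :
  fbound n phi -> (forall x, x < n -> tbound m (s x)) -> fbound m (fsubst s phi).
Proof.
elim: phi n m s => [|t u|R ts|phi IH1 psi IH2|phi IH] n m s //=.
- by case/andP=> Ht Hu H; rewrite (tbound_tsubst Ht H) (tbound_tsubst Hu H).
- move=> /forallP Hb H; apply/forallP => i; exact: tbound_tsubst (Hb i) H.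
- by case/andP=> Ht Hu H; rewrite (IH1 _ _ _ Ht H) (IH2 _ _ _ Hu H).
- move=> Hb H; apply: IH Hb _ => -[|x] //=; rewrite ltnS => /H Hx.
  by apply: tbound_tsubst Hx _ => y /=; rewrite add1n ltnS.
Qed.

Fixpoint tbnd t : nat :=
  match t with Var x => x.+1 | App f ts => \max_(i < ar_func f) tbnd (ts i) end.

Fixpoint fbnd phi : nat :=
  match phi with
  | Bot => 0
  | Eq t u => maxn (tbnd t) (tbnd u)
  | Rel R ts => \max_(i < ar_pred R) tbnd (ts i)
  | Imp phi psi => maxn (fbnd phi) (fbnd psi)
  | All phi => fbnd phi
  end.

Lemma tbound_tbnd t : tbound (tbnd t) t.
Proof.
elim: t => [x|f ts IH] //=; apply/forallP => i.
by apply: tbound_leq (IH i); apply: leq_bigmax.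
Qed.

Lemma fbound_fbnd phi : fbound (fbnd phi) phi.
Proof.
elim: phi => [|t u|R ts|phi IH1 psi IH2|phi IH] //=.
- by rewrite !(tbound_leq _ (tbound_tbnd _)) ?leq_maxl ?leq_maxr.
- by apply/forallP => i; apply: tbound_leq (tbound_tbnd _); apply: leq_bigmax.
- by rewrite (fbound_leq _ IH1) ?(fbound_leq _ IH2) ?leq_maxl ?leq_maxr.
- exact: fbound_leq IH.
Qed.

Lemma fbound_Alls n k phi : fbound k (Alls n phi) = fbound (n + k) phi.
Proof. by elim: n k => //= n IH k; rewrite IH addnS. Qed.

Lemma fbound_Exs n k phi : fbound k (Exs n phi) = fbound (n + k) phi.
Proof. by elim: n k => //= n IH k; rewrite IH addnS !andbT. Qed.

Lemma fbound_And k phi psi : fbound k (And phi psi) = fbound k phi && fbound k psi.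
Proof. by rewrite /= !andbT. Qed.

Lemma fbound_bigAnd (I : Type) k (l : seq I) (F : I -> form S) :
  (forall i, List.In i l -> fbound k (F i)) -> fbound k (\big[@And S/Top]_(i <- l) F i).
Proof.
elim: l => [|i l IH] H; first by rewrite big_nil.
rewrite big_cons fbound_And H /=; last by left.
by apply: IH => j jl; apply: H; right.
Qed.

End SyntaxLemmas.

Section SemanticsLemmas.
Variables (S : signature) (M : structure S).
Implicit Types (t : term S) (phi psi : form S) (e : nat -> carrier M).

Lemma sat_All e phi : sat e (All phi) <-> forall a, sat (scons a e) phi.
Proof. by []. Qed.

Lemma teval_ext n t e e' :
  tbound n t -> (forall x, x < n -> e x = e' x) -> teval e t = teval e' t.
Proof.
move=> + H; elim: t => [x|f ts IH] /=; first exact: H.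
by move/forallP=> Hb; congr int_func; apply: funext => i; apply: IH.
Qed.

Lemma sat_ext n phi e e' :
  fbound n phi -> (forall x, x < n -> e x = e' x) -> sat e phi <-> sat e' phi.
Proof.
elim: phi n e e' => [|t u|R ts|phi IH1 psi IH2|phi IH] n e e' //=.
- by case/andP=> Ht Hu H; rewrite (teval_ext Ht H) (teval_ext Hu H).
- move=> /forallP Hb H; suff -> : (fun i => teval e (ts i)) = (fun i => teval e' (ts i)) by [].
  by apply: funext => i; exact: teval_ext (Hb i) H.
- by case/andP=> Ht Hu H; rewrite (IH1 _ _ _ Ht H) (IH2 _ _ _ Hu H).
- move=> Hb H; suff E a : sat (scons a e) phi <-> sat (scons a e') phi.
    by split=> H' a; apply/E; apply: H'.
  by apply: IH Hb _ => -[|x] //; rewrite ltnS => /H.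
Qed.

Lemma teval_subst e s t : teval e (tsubst s t) = teval (fun x => teval e (s x)) t.
Proof.
by elim: t => [x|f ts IH] //=; congr int_func; apply: funext => i; apply: IH.
Qed.

Lemma teval_tshift a e t : teval (scons a e) (tshift 1 t) = teval e t.
Proof. by rewrite teval_subst. Qed.

Lemma teval_up a e s :
  (fun x => teval (scons a e) (up s x)) = scons a (fun x => teval e (s x)).
Proof. by apply: funext => -[|x] //=; rewrite teval_tshift. Qed.

Lemma sat_subst e s phi : sat e (fsubst s phi) <-> sat (fun x => teval e (s x)) phi.
Proof.
elim: phi e s => [|t u|R ts|phi IH1 psi IH2|phi IH] e s //.
- by rewrite /= !teval_subst.
- rewrite /=; suff -> : (fun i => teval e (tsubst s (ts i))) =
    (fun i => teval (fun x => teval e (s x)) (ts i)) by [].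
  by apply: funext => i; rewrite teval_subst.
- by rewrite /= IH1 IH2.
- by rewrite [fsubst _ _]/= !sat_All; split=> H a; move: (H a); rewrite IH teval_up.
Qed.

Lemma sat_subst1 e t phi : sat e (subst1 t phi) <-> sat (scons (teval e t) e) phi.
Proof.
rewrite /subst1 sat_subst.
suff -> : (fun x => teval e (if x is y.+1 then Var y else t)) =
          scons (teval e t) e by [].
by apply: funext => -[].
Qed.

Lemma sat_Neg e phi : sat e (Neg phi) <-> ~ sat e phi.
Proof. by []. Qed.

Lemma sat_And e phi psi : sat e (And phi psi) <-> sat e phi /\ sat e psi.
Proof.
split=> /= [H|[H1 H2] H]; last exact: (H H1 H2).
by split; apply: contrapT => H'; apply: H.
Qed.

Lemma sat_Or e phi psi : sat e (Or phi psi) <-> sat e phi \/ sat e psi.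
Proof.
split=> /= [H|[H|H] H']; [|by case: (H' H)|by []].
by have [Hp|/H Hq] := EM (sat e phi); [left|right].
Qed.

Lemma sat_Ex e phi : sat e (Ex phi) <-> exists a, sat (scons a e) phi.
Proof.
rewrite /Ex sat_Neg sat_All; split=> [H|[a Ha] /(_ a)]; last by rewrite sat_Neg.
by apply: contrapT => H'; apply: H => a; rewrite sat_Neg => Ha; apply: H'; exists a.
Qed.

Lemma sat_bigAnd (I : Type) (l : seq I) (F : I -> form S) e :
  sat e (\big[@And S/Top]_(i <- l) F i) <-> forall i, List.In i l -> sat e (F i).
Proof.
elim: l => [|i l IH]; first by rewrite big_nil; split=> [_ ? []|_ []].
rewrite big_cons sat_And IH; split=> [[H1 H2] j [<-|] //|H]; first exact: H2.
by split=> [|j jl]; apply: H; [left|right].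
Qed.

Lemma sat_Alls n e phi :
  sat e (Alls n phi) <-> forall v, size v = n -> sat (blockenv v e) phi.
Proof.
elim: n e => [|n IH] e.
  by split=> [H [] // _|/(_ [::] erefl)]; rewrite blockenv0.
rewrite -[Alls n.+1 phi]/(All (Alls n phi)) sat_All; split=> [H v|H a].
  case/lastP: v => // v a; rewrite size_rcons blockenv_rcons => -[Hv].
  exact: (IH _).1 (H a) v Hv.
by apply/IH => v Hv; rewrite -blockenv_rcons; apply: H; rewrite size_rcons Hv.
Qed.

Theorem soundness G phi e : nd G phi -> (forall psi, List.In psi G -> sat e psi) -> sat e phi.
Proof.
move=> H; elim: {G phi} H e => /=.
- by move=> G phi HG e; apply.
- move=> G phi psi _ IH e HG Hphi; apply: IH => chi [<- //|]; exact: HG.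
- by move=> G phi psi _ IH1 _ IH2 e HG; apply: IH1 (IH2 _ HG).
- move=> G phi _ IH e HG; apply: contrapT => H; apply: (IH e) => chi [<- //|]; exact: HG.
- move=> G phi _ IH e HG a; apply: (IH (scons a e)) => chi.
  move/List.in_map_iff => [psi [<- /HG]]; rewrite /fshift sat_subst; exact.
- by move=> G phi t _ IH e /IH H; apply/sat_subst1; apply: H.
- by [].
- by move=> G phi t u _ IH1 _ IH2 e HG; move: (IH2 _ HG); rewrite !sat_subst1 (IH1 _ HG).
Qed.

Lemma proves_holds (U : theory S) phi :
  (forall psi, U psi -> holds M psi) -> proves U phi -> holds M phi.
Proof. by move=> HU [G HG /soundness H] e; apply: H => psi /HG /HU; apply. Qed.

Lemma sentence_sat phi e e' : sentence phi -> sat e phi -> sat e' phi.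
Proof. by move=> Hs; apply: (sat_ext Hs _).1. Qed.

End SemanticsLemmas.

(** * Completeness *)

Lemma quotient_structure (S : signature) (X : Type) (D : X -> Prop)
    (E : X -> X -> Prop) (F : forall f : func S, ('I_(ar_func f) -> X) -> X)
    (P : forall R : pred_sym S, ('I_(ar_pred R) -> X) -> Prop) :
  (exists x, D x) ->
  (forall x, D x -> E x x) ->
  (forall x y, D x -> D y -> E x y -> E y x) ->
  (forall x y z, D x -> D y -> D z -> E x y -> E y z -> E x z) ->
  (forall f xs, (forall i, D (xs i)) -> D (F f xs)) ->
  (forall f xs ys, (forall i, D (xs i)) -> (forall i, D (ys i)) ->
     (forall i, E (xs i) (ys i)) -> E (F f xs) (F f ys)) ->
  (forall R xs ys, (forall i, D (xs i)) -> (forall i, D (ys i)) ->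
     (forall i, E (xs i) (ys i)) -> P R xs -> P R ys) ->
  exists (K : structure S) (c : X -> carrier K),
    [/\ forall k, exists2 x, D x & c x = k,
        forall x y, D x -> D y -> (c x = c y <-> E x y),
        forall f xs, (forall i, D (xs i)) -> c (F f xs) = int_func (fun i => c (xs i))
      & forall R xs, (forall i, D (xs i)) -> (int_pred (fun i => c (xs i)) <-> P R xs)].
Proof.
move=> [x0 Dx0] Erefl Esym Etrans FD FE PE.
pose C := {p : X -> Prop | exists2 x, D x & p = (fun y => D y /\ E x y)}.
have mkP x : D x -> exists2 x', D x' & (fun y => D y /\ E x y) = (fun y => D y /\ E x' y).
  by move=> Dx; exists x.
pose c x : C := if pselect (D x) is left Dx then exist _ _ (mkP x Dx) else exist _ _ (mkP x0 Dx0).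
have cE x y : D x -> D y -> (c x = c y <-> E x y).
  move=> Dx Dy; rewrite /c; case: pselect => // Dx'; case: pselect => // Dy'; split.
    move/(congr1 (@sval _ _)) => /= /(congr1 (fun p => p y)) Exy.
    have: D y /\ E y y by split; last exact: Erefl.
    by rewrite -Exy => -[].
  move=> Exy; apply: eq_exist; apply: funext => z; apply: propext.
  split=> -[Dz Ez]; split=> //; last exact: Etrans Exy Ez.
  exact: Etrans (Esym _ _ _ _ Exy) Ez.
have csurj (k : C) : exists2 x, D x & c x = k.
  case: k => p pP; have [x Dx px] := pP; exists x => //.
  rewrite /c; case: pselect => // Dx'; exact: eq_exist.
have [r rP] : {r : C -> X & forall k, D (r k) /\ c (r k) = k}.
  apply: (@choice _ _ (fun k x => D x /\ c x = k)) => k.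
  by have [x] := csurj k; exists x.
have rD k : D (r k) by have [] := rP k.
have rE x : D x -> E (r (c x)) x.
  by move=> Dx; apply/cE => //; have [] := rP (c x).
exists (@Structure S C (fun f ks => c (F f (fun i => r (ks i))))
         (fun R ks => P R (fun i => r (ks i)))), c; split=> //=.
- move=> f xs Dxs; apply/esym/cE; [exact: FD|exact: FD|].
  by apply: FE => // i; apply: rE.
- move=> R xs Dxs; split; apply: PE => // i; first exact: rE.
  by apply: Esym => //; apply: rE.
Qed.

Section TermEncoding.
Variable S : signature.

Fixpoint term_tree (t : term S) : GenTree.tree nat :=
  match t with
  | Var x => GenTree.Leaf x
  | App f ts => GenTree.Node (pickle f) [seq term_tree (ts i) | i <- enum 'I_(ar_func f)]
  end.

Lemma map_enum_inj (n : nat) (A B : Type) (g : A -> B) (ts us : 'I_n -> A) :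
  [seq g (ts i) | i <- enum 'I_n] = [seq g (us i) | i <- enum 'I_n] ->
  forall i, g (ts i) = g (us i).
Proof.
by move/eq_in_map=> H i; apply: H; rewrite mem_enum.
Qed.

Lemma term_tree_inj : injective term_tree.
Proof.
elim=> [x|f ts IH] [y|g us] //=; first by case=> ->.
case=> /(pcan_inj pickleK) Efg; case: _ / Efg us => us /map_enum_inj H.
by congr App; apply: funext => i; apply: IH.
Qed.

Fixpoint form_tree (phi : form S) : GenTree.tree nat :=
  match phi with
  | Bot => GenTree.Node 0 [::]
  | Eq t u => GenTree.Node 1 [:: term_tree t; term_tree u]
  | Rel R ts => GenTree.Node 2
      (GenTree.Leaf (pickle R) :: [seq term_tree (ts i) | i <- enum 'I_(ar_pred R)])
  | Imp phi psi => GenTree.Node 3 [:: form_tree phi; form_tree psi]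
  | All phi => GenTree.Node 4 [:: form_tree phi]
  end.

Lemma form_tree_inj : injective form_tree.
Proof.
elim=> [|t u|R ts|phi IH1 psi IH2|phi IH] [|t' u'|R' ts'|phi' psi'|phi'] //=.
- by case=> /term_tree_inj -> /term_tree_inj ->.
- case=> /(pcan_inj pickleK) Efg; case: _ / Efg ts' => ts' /map_enum_inj H.
  by congr Rel; apply: funext => i; apply: term_tree_inj.
- by case=> /IH1 -> /IH2 ->.
- by case=> /IH ->.
Qed.

(* Opaque, lest conversion compute the codes of concrete formulas. *)
Fact form_code_sig : {c : form S -> nat | injective c}.
Proof.
exists (fun phi => pickle (form_tree phi)) => phi psi.
by move=> /(pcan_inj pickleK) /form_tree_inj.
Qed.

Definition form_code : form S -> nat := sval form_code_sig.

Lemma form_code_inj : injective form_code.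
Proof. exact: svalP form_code_sig. Qed.

Definition form_enum (n : nat) : form S :=
  if pselect (exists phi, form_code phi = n) is left H then sval (cid H) else Bot.

Lemma form_enumK phi : form_enum (form_code phi) = phi.
Proof.
rewrite /form_enum; case: pselect => [H|[]]; last by exists phi.
by apply: form_code_inj; case: cid.
Qed.

End TermEncoding.

Section Deduction.
Variable S : signature.
Implicit Types (t u : term S) (phi psi : form S) (G : seq (form S)) (T : theory S).

Lemma nd_weak G G' phi : nd G phi -> List.incl G G' -> nd G' phi.
Proof.
move=> H; elim: {G phi} H G' => [G phi H|G phi psi _ IH|G phi psi _ IH1 _ IH2|G phi _ IH
  |G phi _ IH|G phi t _ IH|G t|G phi t u _ IH1 _ IH2] G' HG.
- by apply: nd_hyp; apply: HG.
- by apply: nd_impI; apply: IH => chi [->|/HG]; [left|right].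
- by apply: nd_impE (IH1 _ HG) (IH2 _ HG).
- by apply: nd_contra; apply: IH => chi [->|/HG]; [left|right].
- apply: nd_allI; apply: IH => chi /List.in_map_iff [psi [<- /HG ?]].
  by apply/List.in_map_iff; exists psi.
- exact: nd_allE (IH _ HG).
- exact: nd_eqI.
- exact: nd_eqE (IH1 _ HG) (IH2 _ HG).
Qed.

Lemma fsubst_subst1 s t phi :
  fsubst s (subst1 t phi) = subst1 (tsubst s t) (fsubst (up s) phi).
Proof.
rewrite /subst1 !fsubst_comp; congr fsubst; apply: funext => -[|x] //=.
by rewrite /tshift tsubst_comp tsubst_id.
Qed.

Lemma tsubst1_tshift u t : tsubst (fun x => if x is y.+1 then Var y else u) (tshift 1 t) = t.
Proof. by rewrite /tshift tsubst_comp tsubst_id. Qed.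

Lemma nd_subst G phi s : nd G phi -> nd (List.map (fsubst s) G) (fsubst s phi).
Proof.
move=> H; elim: {G phi} H s => [G phi H|G phi psi _ IH|G phi psi _ IH1 _ IH2|G phi _ IH
  |G phi _ IH|G phi t _ IH|G t|G phi t u _ IH1 _ IH2] s.
- by apply: nd_hyp; apply: List.in_map.
- exact: nd_impI (IH s).
- exact: nd_impE (IH1 s) (IH2 s).
- exact: nd_contra (IH s).
- apply: nd_allI; apply: nd_weak (IH (up s)) _ => chi.
  move/List.in_map_iff => [_ [<- /List.in_map_iff [psi [<- Hpsi]]]].
  apply/List.in_map_iff; exists (fsubst s psi); split; last exact: List.in_map.
  by rewrite /fshift !fsubst_comp.
- by rewrite fsubst_subst1; apply: nd_allE; apply: IH.
- exact: nd_eqI.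
- rewrite fsubst_subst1; apply: nd_eqE (IH1 s) _.
  by rewrite -fsubst_subst1.
Qed.

Lemma nd_gen G phi v :
  (forall psi, List.In psi G -> fbound v psi) -> fbound v phi ->
  nd G (subst1 (Var v) phi) -> nd G (All phi).
Proof.
move=> HG Hphi H; apply: nd_allI.
pose s x : term S := if x == v then Var 0 else Var x.+1.
have := nd_subst s H; rewrite /subst1 fsubst_comp (@fsubst_bound _ v).
- move/nd_weak; apply=> chi /List.in_map_iff [psi [<- Hpsi]].
  apply/List.in_map_iff; exists psi; split=> //; rewrite /fshift.
  by apply: (fsubst_ext (HG _ Hpsi)) => x lt_x; rewrite /s ltn_eqF.
- exact: Hphi.
- move=> [|x] //= lt_x; rewrite /s ?eqxx //.
  by rewrite ltn_eqF // ltnW.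
Qed.

Lemma nd_eq_sym G t u : nd G (Eq t u) -> nd G (Eq u t).
Proof.
move=> H; have := @nd_eqE _ G (Eq (Var 0) (tshift 1 t)) _ _ H.
by rewrite /subst1 /= !tsubst1_tshift; apply; exact: nd_eqI.
Qed.

Lemma nd_eq_trans G t u w : nd G (Eq t u) -> nd G (Eq u w) -> nd G (Eq t w).
Proof.
move=> H1 H2; have := @nd_eqE _ G (Eq (tshift 1 t) (Var 0)) _ _ H2.
by rewrite /subst1 /= !tsubst1_tshift; apply.
Qed.

Lemma nd_congr n G (C : ('I_n -> term S) -> form S) ts us :
  (forall k ts', exists phi, forall t,
     subst1 t phi = C (fun i => if i == k then t else ts' i)) ->
  (forall i, nd G (Eq (ts i) (us i))) -> nd G (C ts) -> nd G (C us).
Proof.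
move=> HC Heq H.
suff: forall m, m <= n -> nd G (C (fun i : 'I_n => if i < m then us i else ts i)).
  move/(_ n (leqnn n)); congr (nd G (C _)); apply: funext => i.
  by rewrite ltn_ord.
elim=> [_|m IH lt_m]; first by congr (nd G (C _)): H.
pose k := Ordinal lt_m; pose mix (i : 'I_n) := if i < m then us i else ts i.
have [phi Hphi] := HC k mix.
have -> : (fun i : 'I_n => if i < m.+1 then us i else ts i) =
          (fun i => if i == k then us k else mix i).
  apply: funext => i; rewrite /mix; have [->|ne] := eqVneq i k; first by rewrite /= ltnSn.
  by rewrite ltnS leq_eqVlt [_ == m](negbTE ne).
rewrite -Hphi; apply: nd_eqE (Heq k) _; rewrite Hphi.
congr (nd G (C _)): (IH (ltnW lt_m)); apply: funext => i.
by rewrite /mix; have [->|//] := eqVneq i k; rewrite ltnn.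
Qed.

Lemma nd_congr_App G f (ts us : 'I_(ar_func f) -> term S) :
  (forall i, nd G (Eq (ts i) (us i))) -> nd G (Eq (App f ts) (App f us)).
Proof.
move=> Heq; apply: (@nd_congr _ G (fun us => Eq (App f ts) (App f us)) ts us) => //;
  last exact: nd_eqI.
move=> k ts'.
exists (Eq (App f (fun i => tshift 1 (ts i)))
  (App f (fun i => if i == k then Var 0 else tshift 1 (ts' i)))) => t.
congr (Eq (App f _) (App f _)); apply: funext => i; first exact: tsubst1_tshift.
by case: (i == k) => //; exact: tsubst1_tshift.
Qed.

Lemma nd_congr_Rel G R (ts us : 'I_(ar_pred R) -> term S) :
  (forall i, nd G (Eq (ts i) (us i))) -> nd G (Rel R ts) -> nd G (Rel R us).
Proof.
move=> Heq; apply: (@nd_congr _ G (Rel R) ts us) => // k ts'.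
exists (Rel R (fun i => if i == k then Var 0 else tshift 1 (ts' i))) => t.
congr Rel; apply: funext => i.
by case: (i == k) => //; exact: tsubst1_tshift.
Qed.

Lemma nd_exfalso G phi : nd G Bot -> nd G phi.
Proof. by move=> H; apply: nd_contra; apply: nd_weak H _ => chi; right. Qed.

Lemma nd_negImp G phi psi : nd G (Neg (Imp phi psi)) -> nd G phi /\ nd G (Neg psi).
Proof.
move=> H; split.
  apply: nd_contra; apply: nd_impE (nd_weak H _) _ => [chi|]; first by right.
  apply: nd_impI; apply: nd_exfalso; apply: nd_impE (nd_hyp _) (nd_hyp _).
    by right; left.
  by left.
apply: nd_impI; apply: nd_impE (nd_weak H _) _ => [chi|]; first by right.
by apply: nd_impI; apply: nd_hyp; right; left.
Qed.

Lemma nd_AndI G phi psi : nd G phi -> nd G psi -> nd G (And phi psi).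
Proof.
move=> H1 H2; apply: nd_impI; apply: nd_impE (nd_weak H2 _); last by move=> chi; right.
apply: nd_impE (nd_weak H1 _); last by move=> chi; right.
by apply: nd_hyp; left.
Qed.

Lemma proves_ax T phi : T phi -> proves T phi.
Proof. by move=> H; exists [:: phi] => [psi [<-|]|] //; apply: nd_hyp; left. Qed.

Lemma proves_mono T T' phi : (forall psi, T psi -> T' psi) -> proves T phi -> proves T' phi.
Proof. by move=> HT [G HG H]; exists G => // psi /HG /HT. Qed.

Lemma proves2 T phi psi chi :
  (forall G, nd G phi -> nd G psi -> nd G chi) -> proves T phi -> proves T psi -> proves T chi.
Proof.
move=> H [G1 HG1 H1] [G2 HG2 H2]; exists (G1 ++ G2).
  by move=> x /List.in_app_iff [/HG1|/HG2].
by apply: H; [apply: nd_weak H1 _|apply: nd_weak H2 _] => x Hx; apply/List.in_app_iff; [left|right].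
Qed.

Lemma proves_impE T phi psi : proves T (Imp phi psi) -> proves T phi -> proves T psi.
Proof. by apply: proves2 => G; apply: nd_impE. Qed.

Lemma proves_impI T phi psi : proves (add_axiom T phi) psi -> proves T (Imp phi psi).
Proof.
move=> [G HG H].
have [G' HG' sub] : exists2 G', (forall x, List.In x G' -> T x) & List.incl G (phi :: G').
  elim: G HG {H} => [|x G IH] HG; first by exists [::] => // x [].
  have [|G' HG' sub] := IH; first by move=> y Hy; apply: HG; right.
  have [Tx|->] : T x \/ x = phi by apply: HG; left.
    exists (x :: G') => [y [<-|/HG']|y] // [->|/sub [->|]]; first by right; left.
      by left.
    by right; right.
  by exists G' => // y [->|/sub] //; left.
by exists G' => //; apply: nd_impI; apply: nd_weak H sub.
Qed.

Lemma proves_contra T phi : ~ consistent (add_axiom T (Neg phi)) -> proves T phi.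
Proof.
move/contrapT/proves_impI => [G HG H]; exists G => //; apply: nd_contra.
apply: nd_impE (nd_weak H _) (nd_hyp _); last by left.
by move=> chi; right.
Qed.

Lemma proves_bigAnd T (l : seq (form S)) :
  (forall phi, List.In phi l -> proves T phi) -> proves T (conj_axioms l).
Proof.
rewrite /conj_axioms; elim: l => [|phi l IH] H.
  by rewrite big_nil; exists [::] => //; apply: nd_impI; apply: nd_hyp; left.
rewrite big_cons; apply: proves2 (fun G => @nd_AndI G _ _) _ _; first by apply: H; left.
by apply: IH => psi Hpsi; apply: H; right.
Qed.

Lemma consistent_chain (L : nat -> theory S) :
  (forall n phi, L n phi -> L n.+1 phi) -> (forall n, consistent (L n)) ->
  consistent (fun phi => exists n, L n phi).
Proof.
move=> Lmono Lcon [G HG H].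
have Lm m n phi : m <= n -> L m phi -> L n phi.
  by move/subnK <-; elim: (n - m) => //= k IH /IH /Lmono.
have [n Hn] : exists n, forall phi, List.In phi G -> L n phi.
  elim: G HG {H} => [|x G IH] HG; first by exists 0.
  have [|n Hn] := IH; first by move=> y Hy; apply: HG; right.
  have [|m Hm] := HG x; first by left.
  exists (maxn m n) => y [<-|/Hn Hy]; [exact: Lm (leq_maxl _ _) Hm|exact: Lm (leq_maxr _ _) Hy].
exact: (Lcon n (ex_intro2 _ _ G Hn H)).
Qed.

End Deduction.

Section Completeness.
Variables (S : signature) (U : theory S).
Hypothesis U_sentences : is_theory U.
Hypothesis U_con : consistent U.

(* Free variables play the role of the Henkin constants: at stage [n] the
   variable chosen as a witness does not occur in any axiom added so far. *)
Fixpoint henkin_axioms (n : nat) : seq (form S) :=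
  if n is m.+1 then
    let phi := form_enum S m in
    let v := \max_(psi <- phi :: henkin_axioms m) fbnd psi in
    Imp (subst1 (Var v) phi) (All phi) :: henkin_axioms m
  else [::].

Lemma fbound_max (l : seq (form S)) psi :
  List.In psi l -> fbound (\max_(chi <- l) fbnd chi) psi.
Proof.
elim: l => //= chi l IH; rewrite big_cons => -[->|/IH].
  exact: fbound_leq (leq_maxl _ _) (fbound_fbnd _).
exact: fbound_leq (leq_maxr _ _).
Qed.

Lemma consistent_henkin (T : theory S) v phi :
  (forall psi, T psi -> fbound v psi) -> fbound v phi -> consistent T ->
  consistent (add_axiom T (Imp (subst1 (Var v) phi) (All phi))).
Proof.
move=> HT Hphi Tcon /proves_impI [G HG /nd_negImp [H1 H2]]; apply: Tcon.
exists G => //; apply: nd_impE H2 _; apply: nd_gen H1 => // psi /HG; exact: HT.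
Qed.

Definition henkin_theory : theory S :=
  fun phi => exists n, U phi \/ List.In phi (henkin_axioms n).

Lemma henkin_theory_consistent : consistent henkin_theory.
Proof.
apply: consistent_chain => [n phi [|H]|n]; [by left|by right; right|].
elim: n => [|n IH]; first by move=> /(proves_mono (T' := U)) H; apply/U_con/H => psi [].
set v := \max_(psi <- form_enum S n :: henkin_axioms n) fbnd psi.
suff H: consistent (add_axiom (fun phi => U phi \/ List.In phi (henkin_axioms n))
             (Imp (subst1 (Var v) (form_enum S n)) (All (form_enum S n)))).
  move=> H'; apply: H; apply: proves_mono H' => psi [Hpsi|[<-|Hpsi]].
  - by left; left.
  - by right.
  - by left; right.
apply: consistent_henkin => // [psi [/U_sentences|H]|].
- exact: fbound_leq.
- by apply: fbound_max; right.
- by apply: fbound_max; left.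
Qed.

Fixpoint lindenbaum_stage (n : nat) : theory S :=
  if n is m.+1 then
    fun phi => lindenbaum_stage m phi \/
      (phi = form_enum S m /\ consistent (add_axiom (lindenbaum_stage m) phi))
  else henkin_theory.

Definition lindenbaum : theory S := fun phi => exists n, lindenbaum_stage n phi.

Lemma lindenbaum_consistent : consistent lindenbaum.
Proof.
apply: consistent_chain => [n phi|n]; first by left.
elim: n => [|n IH]; first exact: henkin_theory_consistent.
have [H|H] := EM (consistent (add_axiom (lindenbaum_stage n) (form_enum S n))).
  move/(proves_mono (T' := _)) => H'; apply/H/H' => psi /= [|[-> _]]; [by left|by right].
move/(proves_mono (T' := _)) => H'; apply/IH/H' => psi /= [|[-> /H]] //.
Qed.

Lemma lindenbaum_max phi : consistent (add_axiom lindenbaum phi) -> lindenbaum phi.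
Proof.
move=> H; exists (form_code phi).+1; right; split; first by rewrite form_enumK.
move/(proves_mono (T' := _)) => H'; apply/H/H' => psi [Hpsi|->]; last by right.
by left; exists (form_code phi).
Qed.

Lemma lindenbaum_closed phi : proves lindenbaum phi -> lindenbaum phi.
Proof.
move=> H; apply: lindenbaum_max => /proves_impI H'.
exact: lindenbaum_consistent (proves_impE H' H).
Qed.

Lemma lindenbaum_nd1 phi psi :
  (forall G, nd G phi -> nd G psi) -> lindenbaum phi -> lindenbaum psi.
Proof.
move=> H Hphi; apply: lindenbaum_closed; apply: proves2 (proves_ax Hphi) (proves_ax Hphi).
by move=> G /H.
Qed.

Lemma lindenbaum_nd (n : nat) (phi : 'I_n -> form S) psi :
  (forall G, (forall i, nd G (phi i)) -> nd G psi) -> (forall i, lindenbaum (phi i)) ->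
  lindenbaum psi.
Proof.
move=> H Hphi; apply: lindenbaum_closed; exists (List.map phi (enum 'I_n)).
  by move=> _ /List.in_map_iff [i [<- _]].
apply: H => i; apply: nd_hyp; apply: List.in_map.
elim: (enum 'I_n) (mem_enum 'I_n i) => //= j l IH; rewrite inE => /orP [/eqP ->|Hl]; first by left.
by right; apply: IH; rewrite Hl.
Qed.

Lemma lindenbaum_Imp phi psi :
  lindenbaum (Imp phi psi) <-> (lindenbaum phi -> lindenbaum psi).
Proof.
split=> [H1 H2|H].
  exact: lindenbaum_closed (proves_impE (proves_ax H1) (proves_ax H2)).
have [/H|H'] := EM (lindenbaum phi).
  apply: lindenbaum_nd1 => G HG; apply: nd_impI; apply: nd_weak HG _ => chi; by right.
apply: lindenbaum_closed; apply: proves_impI.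
have : ~ consistent (add_axiom lindenbaum phi) by move/lindenbaum_max.
move/contrapT => [G HG HB]; exists G => //; exact: nd_exfalso.
Qed.

Lemma lindenbaum_All phi :
  lindenbaum (All phi) <-> (forall t, lindenbaum (subst1 t phi)).
Proof.
split=> [H t|H]; first by apply: lindenbaum_nd1 H => G; apply: nd_allE.
suff: exists v, lindenbaum (Imp (subst1 (Var v) phi) (All phi)).
  by move=> [v /lindenbaum_Imp]; apply.
exists (\max_(psi <- phi :: henkin_axioms (form_code phi)) fbnd psi).
exists 0, (form_code phi).+1; right; left; by rewrite form_enumK.
Qed.

Theorem model_existence : exists M : structure S,
  (exists a : carrier M, True) /\ forall phi, U phi -> holds M phi.
Proof.
have := @quotient_structure S (term S) (fun=> True) (fun t u => lindenbaum (Eq t u))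
  (@App S) (fun R ts => lindenbaum (Rel R ts)).
case=> //.
- by exists (Var 0).
- by move=> t _; apply: lindenbaum_closed; exists [::] => //; apply: nd_eqI.
- by move=> t u _ _; apply: lindenbaum_nd1 => G; apply: nd_eq_sym.
- move=> t u w _ _ _ H1 H2; apply: lindenbaum_closed.
  by apply: proves2 (proves_ax H1) (proves_ax H2) => G; apply: nd_eq_trans.
- move=> f ts us _ _; apply: (@lindenbaum_nd _ (fun i => Eq (ts i) (us i))) => G.
  exact: nd_congr_App.
- move=> R ts us _ _ Heq H; apply: (lindenbaum_Imp _ _).1 H.
  apply: lindenbaum_nd Heq => G Heq; apply: nd_impI; apply: nd_congr_Rel (nd_hyp _); last by left.
  by move=> i; apply: nd_weak (Heq i) _ => chi; right.
move=> M [c [csurj cE cF cP]]; exists M; split; first by exists (c (Var 0)).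
have cT t s : c (tsubst s t) = teval (fun x => c (s x)) t.
  elim: t => [x|f ts IH] //=; rewrite cF //; congr int_func; exact: funext.
have truth phi s : sat (fun x => c (s x)) phi <-> lindenbaum (fsubst s phi).
  elim: phi s => [|t u|R ts|phi IH1 psi IH2|phi IH] s.
  - by split=> // H; apply: lindenbaum_consistent; apply: proves_ax.
  - by rewrite /= -!cT; apply: cE.
  - rewrite /= -cP //.
    suff -> : (fun i => teval (fun x => c (s x)) (ts i)) = (fun i => c (tsubst s (ts i))) by [].
    by apply: funext => i; rewrite cT.
  - by rewrite /= lindenbaum_Imp IH1 IH2.
  - rewrite sat_All [fsubst _ _]/= lindenbaum_All.
    have E t : sat (scons (c t) (fun x => c (s x))) phi <-> lindenbaum (subst1 t (fsubst (up s) phi)).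
      have -> : scons (c t) (fun x => c (s x)) = fun x => c (scons t s x).
        by apply: funext => -[].
      rewrite IH /subst1 fsubst_comp.
      suff -> : scons t s = (fun x => tsubst (fun x0 => if x0 is y.+1 then Var y else t) (up s x)) by [].
      by apply: funext => -[|x] //=; rewrite tsubst1_tshift.
    split=> H t; first by apply/E; apply: H.
    by have [u _ <-] := csurj t; apply/E; apply: H.
move=> phi Hphi e.
apply: (@sentence_sat _ _ phi (fun x => c (Var x))); first exact: U_sentences.
apply/truth; rewrite fsubst_id; exists 0, 0; by left.
Qed.

End Completeness.

Theorem completeness (S : signature) (U : theory S) (phi : form S) :
  is_theory U -> sentence phi ->
  (forall M : structure S, (forall psi, U psi -> holds M psi) -> holds M phi) ->
  proves U phi.
Proof.
move=> HU Hphi H; apply: proves_contra => Hcon.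
have [psi|M [[a _] HM]] := @model_existence S (add_axiom U (Neg phi)) _ Hcon.
  by move=> [/HU|->] //; rewrite /sentence /= andbT.
have: sat (fun=> a) (Neg phi) by apply: HM; right.
by apply; apply: H => psi Hpsi; apply: HM; left.
Qed.

(** * Relational structures and unravelling *)

Lemma List_In_mem (I : eqType) (i : I) (l : seq I) : List.In i l <-> i \in l.
Proof.
elim: l => //= j l IH; rewrite inE; split=> [[->|/IH ->]|/orP [/eqP ->|/IH]];
  rewrite ?eqxx ?orbT //; [by left|by right].
Qed.

Lemma sat_bigAnd_fin (S : signature) (M : structure S) (I : finType) (F : I -> form S)
    (e : nat -> carrier M) :
  sat e (\big[@And S/Top]_i F i) <-> forall i, sat e (F i).
Proof.
rewrite sat_bigAnd; split=> H i; last by move=> _.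
by apply: H; apply/List_In_mem; rewrite mem_index_enum.
Qed.

Section RelationalStructures.
Variable T : signature.

(* The interpretations of the source symbols found inside a target structure:
   identity is only a relation, and quantifiers are relativised to [rdom]. *)
Record relstr := RelStr {
  rcar : Type;
  rdom : rcar -> Prop;
  req : rcar -> rcar -> Prop;
  rrel : forall R : pred_sym (graph_sig T), ('I_(ar_pred R) -> rcar) -> Prop }.

Definition prefix_env (X : Type) n (w : nat -> X) (er : nat -> X) (x : nat) : X :=
  if x < n then w x else er (x - n).

Lemma prefix_env0 (X : Type) w er : @prefix_env X 0 w er = er.
Proof. by apply: funext => x; rewrite /prefix_env subn0. Qed.

Lemma prefix_envS (X : Type) n (w : nat -> X) er :
  prefix_env n.+1 w er = prefix_env n w (scons (w n) er).
Proof.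
apply: funext => x; rewrite /prefix_env ltnS.
case: ltngtP => [//|gt_x|->]; last by rewrite subnn.
by rewrite subnS; move: gt_x; rewrite -subn_gt0; case: (x - n).
Qed.

Lemma eq_prefix_env (X : Type) n (w w' : nat -> X) er :
  (forall x, x < n -> w x = w' x) -> prefix_env n w er = prefix_env n w' er.
Proof. by move=> H; apply: funext => x; rewrite /prefix_env; case: ltnP => // /H. Qed.

Lemma prefix_env_lt (X : Type) n (w er : nat -> X) x : x < n -> prefix_env n w er x = w x.
Proof. by rewrite /prefix_env => ->. Qed.

Lemma prefix_env_add (X : Type) n (w er : nat -> X) x : prefix_env n w er (n + x) = er x.
Proof. by rewrite /prefix_env ltnNge leq_addr /= addKn. Qed.

Variable N : relstr.
Implicit Types (phi psi : form (graph_sig T)) (er : nat -> rcar N).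

Fixpoint rsat er phi : Prop :=
  match phi with
  | Bot => False
  | Eq t u => req (er (var_of t)) (er (var_of u))
  | Rel R ts => rrel (fun i => er (var_of (ts i)))
  | Imp phi psi => rsat er phi -> rsat er psi
  | All phi => forall a, rdom a -> rsat (scons a er) phi
  end.

Lemma rsat_All er phi : rsat er (All phi) <-> forall a, rdom a -> rsat (scons a er) phi.
Proof. by []. Qed.

Lemma rsat_Imp er phi psi : rsat er (Imp phi psi) <-> (rsat er phi -> rsat er psi).
Proof. by []. Qed.

Lemma rsat_And er phi psi : rsat er (And phi psi) <-> rsat er phi /\ rsat er psi.
Proof.
split=> /= [H|[H1 H2] H]; last exact: (H H1 H2).
by split; apply: contrapT => H'; apply: H.
Qed.

Lemma rsat_Ex er phi : rsat er (Ex phi) <-> exists2 a, rdom a & rsat (scons a er) phi.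
Proof.
split=> [H|[a Da Ha] /(_ a Da)]; last by apply.
by apply: contrapT => H'; apply: H => a Da Ha; apply: H'; exists a.
Qed.

Lemma rsat_bigAnd (I : Type) (l : seq I) (F : I -> form (graph_sig T)) er :
  rsat er (\big[@And _/Top]_(i <- l) F i) <-> forall i, List.In i l -> rsat er (F i).
Proof.
elim: l => [|i l IH]; first by rewrite big_nil; split=> [_ ? []|_ []].
rewrite big_cons rsat_And IH; split=> [[H1 H2] j [<-|] //|H]; first exact: H2.
by split=> [|j jl]; apply: H; [left|right].
Qed.

Lemma rsat_bigAnd_fin (I : finType) (F : I -> form (graph_sig T)) er :
  rsat er (\big[@And _/Top]_i F i) <-> forall i, rsat er (F i).
Proof.
rewrite rsat_bigAnd; split=> H i; last by move=> _.
by apply: H; apply/List_In_mem; rewrite mem_index_enum.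
Qed.

Lemma rsat_Alls n er phi :
  rsat er (Alls n phi) <->
  forall w, (forall i, i < n -> rdom (w i)) -> rsat (prefix_env n w er) phi.
Proof.
elim: n er => [|n IH] er.
  by split=> [H w _|/(_ er)]; rewrite prefix_env0 //; apply.
rewrite -[Alls n.+1 phi]/(All (Alls n phi)) rsat_All; split=> [H w Hw|H a Da].
  rewrite prefix_envS; move/(IH _).1: (H (w n) (Hw n (ltnSn n))); apply=> i Hi.
  by apply: Hw; apply: ltnW.
apply: (IH _).2 => w Hw; pose w' x := if x == n then a else w x.
have := H w'; rewrite prefix_envS {3}/w' eqxx (@eq_prefix_env _ n w' w).
  apply=> i; rewrite ltnS leq_eqVlt /w'; by case: eqP => // _ /Hw.
by move=> x Hx; rewrite /w' ltn_eqF.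
Qed.

Lemma rsat_Exs n er phi :
  rsat er (Exs n phi) <->
  exists2 w, (forall i, i < n -> rdom (w i)) & rsat (prefix_env n w er) phi.
Proof.
elim: n er => [|n IH] er.
  by split=> [H|[w _]]; [exists er|]; rewrite ?prefix_env0.
rewrite -[Exs n.+1 phi]/(Ex (Exs n phi)) rsat_Ex; split=> [[a Da]|[w Hw]].
  move/(IH _).1 => [w Hw H]; pose w' x := if x == n then a else w x.
  exists w'; first by move=> i; rewrite ltnS leq_eqVlt /w'; case: eqP => // _ /Hw.
  rewrite prefix_envS {2}/w' eqxx (@eq_prefix_env _ n w' w) // => x Hx.
  by rewrite /w' ltn_eqF.
rewrite prefix_envS => H; exists (w n); first exact: Hw.
by apply: (IH _).2; exists w => // i Hi; apply: Hw; apply: ltnW.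
Qed.

Lemma var_of_lt n (t : term (graph_sig T)) : tbound n t -> var_of t < n.
Proof. by case: t => [//|[]]. Qed.

Lemma rsat_ext n phi er er' :
  fbound n phi -> (forall x, x < n -> er x = er' x) -> rsat er phi <-> rsat er' phi.
Proof.
elim: phi n er er' => [|t u|R ts|phi IH1 psi IH2|phi IH] n e e' //=.
- by case/andP=> /var_of_lt Ht /var_of_lt Hu H; rewrite !H.
- move=> /forallP Hb H; suff -> : (fun i => e (var_of (ts i))) = (fun i => e' (var_of (ts i))) by [].
  by apply: funext => i; apply: H; apply: var_of_lt.
- by case/andP=> Ht Hu H; rewrite (IH1 _ _ _ Ht H) (IH2 _ _ _ Hu H).
- move=> Hb H; suff E a : rsat (scons a e) phi <-> rsat (scons a e') phi.
    by split=> H' a Da; apply/E; apply: H'.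
  by apply: IH Hb _ => -[|x] //; rewrite ltnS => /H.
Qed.

Definition gargs (f : func T) (xs : 'I_(ar_func f) -> rcar N) (y : rcar N)
    (i : 'I_(ar_func f).+1) : rcar N :=
  if unlift ord_max i is Some j then xs j else y.

Lemma rsat_graph_atom er f (xs : 'I_(ar_func f) -> nat) y :
  rsat er (graph_atom xs y) = @rrel N (inl f) (gargs (fun i => er (xs i)) (er y)).
Proof.
rewrite /=; congr rrel; apply: funext => i.
by rewrite /gargs /=; case: unlift.
Qed.

Record identity_laws : Prop := IdentityLaws {
  il_nonempty : exists a : rcar N, rdom a;
  il_refl : forall a : rcar N, rdom a -> req a a;
  il_sym : forall a b : rcar N, rdom a -> rdom b -> req a b -> req b a;
  il_trans : forall a b c : rcar N, rdom a -> rdom b -> rdom c ->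
    req a b -> req b c -> req a c;
  il_congr : forall (R : pred_sym (graph_sig T)) (xs ys : 'I_(ar_pred R) -> rcar N),
    (forall i, rdom (xs i)) -> (forall i, rdom (ys i)) ->
    (forall i, req (xs i) (ys i)) -> rrel xs -> rrel ys;
  il_total : forall f (xs : 'I_(ar_func f) -> rcar N), (forall i, rdom (xs i)) ->
    exists2 y, rdom y & @rrel N (inl f) (gargs xs y);
  il_functional : forall f (xs : 'I_(ar_func f) -> rcar N) y z,
    (forall i, rdom (xs i)) -> rdom y -> rdom z ->
    @rrel N (inl f) (gargs xs y) -> @rrel N (inl f) (gargs xs z) -> req y z }.

Definition ordfun (X : Type) n (xs : 'I_n -> X) (d : X) (x : nat) : X :=
  if insub x is Some i then xs i else d.

Lemma ordfun_ord (X : Type) n (xs : 'I_n -> X) d (i : 'I_n) : ordfun xs d i = xs i.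
Proof. by rewrite /ordfun valK. Qed.

Lemma ordfun_dom n (xs : 'I_n -> rcar N) d x :
  (forall i, rdom (xs i)) -> x < n -> rdom (ordfun xs d x).
Proof. by move=> H lt_x; rewrite -[x]/(val (Ordinal lt_x)) ordfun_ord. Qed.

Lemma rsat_identity er : rsat er (identity_ax T) <-> identity_laws.
Proof.
rewrite /identity_ax !rsat_And !rsat_bigAnd_fin /conj_axioms.
rewrite !big_cons big_nil !rsat_And; split.
  case=> -[H1 [H2 [H3 [/rsat_Ex [a0 Da0 _] _]]]] [HR Hf]; split.
  - by exists a0.
  - by move=> a Da; apply: H1.
  - by move=> a b Da Db; apply: H2.
  - by move=> a b c Da Db Dc; apply: H3.
  - move=> R xs ys Dxs Dys Heq Hxs; have := HR R; rewrite /eq_congr_ax rsat_Alls.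
    set n := ar_pred R; pose w := prefix_env n (ordfun xs a0) (ordfun ys a0).
    have wl (i : 'I_n) : w i = xs i by rewrite /w prefix_env_lt // ordfun_ord.
    have wr (i : 'I_n) : w (n + i) = ys i by rewrite /w prefix_env_add ordfun_ord.
    have env_l (i : 'I_n) : prefix_env (n + n) w er i = xs i.
      by rewrite prefix_env_lt ?wl // (leq_trans (ltn_ord i)) ?leq_addr.
    have env_r (i : 'I_n) : prefix_env (n + n) w er (n + i) = ys i.
      by rewrite prefix_env_lt ?wr // ltn_add2l.
    have Dw i : i < n + n -> rdom (w i).
      move=> lt_i; rewrite /w /prefix_env; case: ltnP => Hi; first exact: ordfun_dom.
      by apply: ordfun_dom => //; rewrite ltn_subLR.
    move=> /(_ w Dw) H.
    have HA : rsat (prefix_env (n + n) w er) (\big[@And _/Top]_(i < n) Eq (Var i) (Var (n + i))).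
      by apply/rsat_bigAnd_fin => i /=; rewrite env_l env_r.
    have HB : rsat (prefix_env (n + n) w er) (@Rel (graph_sig T) R (fun i => Var i)).
      by rewrite /=; congr rrel: Hxs; apply: funext.
    by have := H HA HB; rewrite /=; congr rrel; apply: funext.
  - move=> f xs Dxs; have [+ _] := (rsat_And _ _ _).1 (Hf f).
    rewrite /total_ax rsat_Alls => H.
    have /H /rsat_Ex [y Dy] : forall i, i < ar_func f -> rdom (ordfun xs a0 i).
      by move=> i; apply: ordfun_dom.
    move=> {H}; rewrite rsat_graph_atom => H; exists y => //.
    congr rrel: H; congr gargs; apply: funext => j /=.
    by rewrite prefix_env_lt // ordfun_ord.
  - move=> f xs y z Dxs Dy Dz Hy Hz; have [_] := (rsat_And _ _ _).1 (Hf f).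
    rewrite /functional_ax rsat_Alls => /(_ (scons y (scons z (ordfun xs a0)))) H.
    have {}H := H _; rewrite !rsat_Imp !rsat_graph_atom in H.
    have Ex : (fun i : 'I_(ar_func f) => prefix_env (ar_func f).+2
                 (scons y (scons z (ordfun xs a0))) er i.+2) = xs.
      by apply: funext => j; rewrite prefix_env_lt ?ltnS //= ordfun_ord.
    rewrite Ex !prefix_env_lt //= in H.
    by apply: H => // -[|[|i]] //= lt_i; apply: ordfun_dom.
case=> [[a0 Da0] H1 H2 H3 HR Htot Hfun]; split; [|split].
- split; first exact: H1.
  split; first by rewrite /eq_sym_ax /= => a Da b Db; apply: H2.
  split; first by rewrite /eq_trans_ax /= => a Da b Db d Dd; apply: H3.
  split; last by move=> [].
  by apply/rsat_Ex; exists a0 => //; apply: H1.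
- move=> R; rewrite /eq_congr_ax rsat_Alls => w Dw HA HB.
  set n := ar_pred R in w Dw HA HB *.
  have env_l (i : 'I_n) : prefix_env (n + n) w er i = w i.
    by rewrite prefix_env_lt // (leq_trans (ltn_ord i)) ?leq_addr.
  have env_r (i : 'I_n) : prefix_env (n + n) w er (n + i) = w (n + i).
    by rewrite prefix_env_lt // ltn_add2l.
  apply: HR HB => i /=; rewrite ?env_l ?env_r.
  + by apply: Dw; rewrite (leq_trans (ltn_ord i)) ?leq_addr.
  + by apply: Dw; rewrite ltn_add2l.
  + by have /rsat_bigAnd_fin /(_ i) := HA; rewrite /= env_l env_r.
- move=> f; apply/rsat_And; split.
    rewrite /total_ax rsat_Alls => w Dw; apply/rsat_Ex.
    have [i|y Dy Hy] := Htot f (fun i => w i); first exact: Dw.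
    exists y => //; rewrite rsat_graph_atom; congr rrel: Hy; congr gargs.
    by apply: funext => i /=; rewrite prefix_env_lt.
  rewrite /functional_ax rsat_Alls => w Dw.
  rewrite !rsat_Imp !rsat_graph_atom /=; apply: Hfun => [i||].
  + by rewrite prefix_env_lt; [apply: Dw|]; rewrite !ltnS.
  + by rewrite prefix_env_lt //; apply: Dw.
  + by rewrite prefix_env_lt //; apply: Dw.
Qed.

Record realizes (K : structure T) (c : rcar N -> carrier K) : Prop := Realizes {
  rz_surj : forall k, exists2 a, rdom a & c a = k;
  rz_eq : forall a b, rdom a -> rdom b -> (req a b <-> c a = c b);
  rz_func : forall f (xs : 'I_(ar_func f) -> rcar N) y, (forall i, rdom (xs i)) -> rdom y ->
    (@rrel N (inl f) (gargs xs y) <-> int_func (fun i => c (xs i)) = c y);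
  rz_pred : forall R (xs : 'I_(ar_pred R) -> rcar N), (forall i, rdom (xs i)) ->
    (@rrel N (inr R) xs <-> int_pred (fun i => c (xs i))) }.

Lemma identity_laws_realizes : identity_laws ->
  exists (K : structure T) (c : rcar N -> carrier K), realizes c.
Proof.
case=> [[a0 Da0] H1 H2 H3 HR Htot Hfun].
have [F HF] : {F : forall f, ('I_(ar_func f) -> rcar N) -> rcar N & forall f xs,
    (forall i, rdom (xs i)) -> rdom (F f xs) /\ @rrel N (inl f) (gargs xs (F f xs))}.
  have H f (xs : 'I_(ar_func f) -> rcar N) : exists y, (forall i, rdom (xs i)) ->
      rdom y /\ @rrel N (inl f) (gargs xs y).
    have [D|nD] := EM (forall i, rdom (xs i)); last by exists a0.
    by have [y Dy Hy] := Htot f xs D; exists y.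
  by exists (fun f xs => sval (cid (H f xs))) => f xs; case: (cid (H f xs)).
have Dgargs f (xs : 'I_(ar_func f) -> rcar N) y i :
    (forall i, rdom (xs i)) -> rdom y -> rdom (gargs xs y i).
  by move=> Dxs Dy; rewrite /gargs; case: unlift.
have := @quotient_structure T _ _ _ F (fun R => @rrel N (inr R)) _ H1 H2 H3.
case=> [|f xs Dxs|f xs ys Dxs Dys Hxy|R xs ys Dxs Dys|K [c [csurj cE cF cP]]].
- by exists a0.
- by have [] := HF f xs Dxs.
- have [DF HFx] := HF f xs Dxs; have [DG HFy] := HF f ys Dys.
  apply: (Hfun f ys) => //; apply: HR HFx => i; try exact: Dgargs.
  by rewrite /gargs; case: unlift => //; apply: H1.
- exact: (HR (inr R)).
exists K, c; split=> //.
- by move=> a b Da Db; rewrite cE.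
- move=> f xs y Dxs Dy; have [DF HFx] := HF f xs Dxs.
  rewrite -cF // cE //; split=> H; first exact: (Hfun f xs).
  apply: (HR (inl f)) HFx => i; try exact: Dgargs.
  by rewrite /gargs; case: unlift => // j; apply: H1.
- by move=> R xs Dxs; rewrite cP.
Qed.

Section Realized.
Variables (K : structure T) (c : rcar N -> carrier K).
Hypothesis cK : realizes c.

Lemma realizes_repr : exists r : carrier K -> rcar N, forall k, rdom (r k) /\ c (r k) = k.
Proof.
have [|r Hr] := @choice _ _ (fun k a => rdom a /\ c a = k); last by exists r.
by move=> k; have [a] := rz_surj cK k; exists a.
Qed.

Lemma realizes_identity er : (exists k : carrier K, True) -> rsat er (identity_ax T).
Proof.
move=> [k _]; have [r Hr] := realizes_repr; apply/rsat_identity; split.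
- by exists (r k); case: (Hr k).
- by move=> a Da; apply/(rz_eq cK).
- by move=> a b Da Db /(rz_eq cK Da Db) H; apply/(rz_eq cK).
- move=> a b d Da Db Dd /(rz_eq cK Da Db) H1 /(rz_eq cK Db Dd) H2.
  by apply/(rz_eq cK); rewrite // H1.
- move=> R xs ys Dxs Dys Heq.
  have Ec i : c (xs i) = c (ys i) by apply/(rz_eq cK).
  case: R xs ys Dxs Dys {Heq} Ec => [f|R] xs ys Dxs Dys Ec.
    have E (zs : 'I_(ar_func f).+1 -> rcar N) :
        zs = gargs (fun i => zs (lift ord_max i)) (zs ord_max).
      by apply: funext => i; rewrite /gargs; case: unliftP => [j ->|->].
    rewrite (E xs) (E ys) !(rz_func cK) // Ec => <-; congr int_func.
    exact: funext.
  rewrite !(rz_pred cK) //; congr int_pred; exact: funext.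
- move=> f xs Dxs; have [Dy Ey] := Hr (int_func (fun i => c (xs i))).
  by eexists; [exact: Dy|apply/(rz_func cK); rewrite ?Ey].
- move=> f xs y z Dxs Dy Dz; rewrite !(rz_func cK) // => Hy Hz.
  by apply/(rz_eq cK); rewrite // -Hy.
Qed.

Lemma rsat_tgraph r t y er : (forall x, rdom (er x)) ->
  rsat er (tgraph r t y) <-> teval (fun x => c (er (r x))) t = c (er y).
Proof.
elim: t r y er => [x|f ts IH] r y er Der; first exact: (rz_eq cK).
rewrite /tgraph -/tgraph [X in _ <-> X]/= rsat_Exs.
set n := ar_func f; set body := And _ _.
have E w : (forall i, i < n -> rdom (w i)) -> rsat (prefix_env n w er) body <->
    (forall i : 'I_n, teval (fun x => c (er (r x))) (ts i) = c (w i)) /\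
    int_func (fun i : 'I_n => c (w i)) = c (er y).
  move=> Dw; have Dp x : rdom (prefix_env n w er x).
    by rewrite /prefix_env; case: ltnP => // /Dw.
  rewrite /body rsat_And rsat_bigAnd_fin rsat_graph_atom.
  rewrite (rz_func cK) // prefix_env_add.
  have -> : (fun i : 'I_n => c (prefix_env n w er i)) = (fun i : 'I_n => c (w i)).
    by apply: funext => i; rewrite prefix_env_lt.
  suff E i : rsat (prefix_env n w er) (tgraph (fun x => n + r x) (ts i) i) <->
             teval (fun x => c (er (r x))) (ts i) = c (w i).
    by split=> -[H1 H2]; split=> // i; apply/E.
  rewrite IH // prefix_env_lt //.
  have -> // : (fun x => c (prefix_env n w er (n + r x))) = (fun x => c (er (r x))).
  by apply: funext => x; rewrite prefix_env_add.
split=> [[w Dw /(E w Dw) [H1 <-]]|H].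
  by congr int_func; apply: funext => i; rewrite H1.
have [rep Hrep] := realizes_repr.
pose w := ordfun (fun i : 'I_n => rep (teval (fun x => c (er (r x))) (ts i))) (er 0).
have Dw i : i < n -> rdom (w i).
  by apply: ordfun_dom => j; case: (Hrep (teval (fun x => c (er (r x))) (ts j))).
exists w => //; apply/(E w Dw).
have Ew (i : 'I_n) : c (w i) = teval (fun x => c (er (r x))) (ts i).
  by rewrite /w ordfun_ord; case: (Hrep (teval (fun x => c (er (r x))) (ts i))).
split=> [i|]; first by rewrite Ew.
by rewrite -H; congr int_func; apply: funext.
Qed.

Lemma rsat_unravel (phi : form T) er : (forall x, rdom (er x)) ->
  rsat er (unravel phi) <-> sat (fun x => c (er x)) phi.
Proof.
elim: phi er => [|t u|R ts|phi IH1 psi IH2|phi IH] er Der //.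
- rewrite /unravel rsat_Ex [X in _ <-> X]/=.
  have E a : rdom a -> rsat (scons a er) (And (tgraph succn t 0) (tgraph succn u 0)) <->
      teval (fun x => c (er x)) t = c a /\ teval (fun x => c (er x)) u = c a.
    by move=> Da; rewrite rsat_And !rsat_tgraph // => -[].
  split=> [[a Da /(E a Da) [-> ->]] //|H].
  have [a Da Ha] := rz_surj cK (teval (fun x => c (er x)) t).
  by exists a => //; apply/(E a Da); rewrite Ha -H.
- rewrite /unravel rsat_Exs [X in _ <-> X]/=.
  set n := ar_pred R; set body := And _ _.
  have E w : (forall i, i < n -> rdom (w i)) -> rsat (prefix_env n w er) body <->
    (forall i : 'I_n, teval (fun x => c (er x)) (ts i) = c (w i)) /\
    int_pred (fun i : 'I_n => c (w i)).
    move=> Dw; have Dp x : rdom (prefix_env n w er x).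
      by rewrite /prefix_env; case: ltnP => // /Dw.
    rewrite /body rsat_And rsat_bigAnd_fin.
    have -> : rsat (prefix_env n w er) (pred_atom (fun i : 'I_(ar_pred R) => i)) <->
              int_pred (fun i : 'I_n => c (w i)).
      rewrite /= (rz_pred cK) //.
      suff -> : (fun i : 'I_n => c (prefix_env n w er i)) = (fun i : 'I_n => c (w i)) by [].
      by apply: funext => i; rewrite prefix_env_lt.
    suff E i : rsat (prefix_env n w er) (tgraph (fun x => n + x) (ts i) i) <->
             teval (fun x => c (er x)) (ts i) = c (w i).
      by split=> -[H1 H2]; split=> // i; apply/E.
    rewrite rsat_tgraph // prefix_env_lt //.
    have -> // : (fun x => c (prefix_env n w er (n + x))) = (fun x => c (er x)).
    by apply: funext => x; rewrite prefix_env_add.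
  split=> [[w Dw /(E w Dw) [H1 H2]]|H].
    by congr int_pred: H2; apply: funext => i; rewrite H1.
  have [rep Hrep] := realizes_repr.
  pose w := ordfun (fun i : 'I_n => rep (teval (fun x => c (er x)) (ts i))) (er 0).
  have Dw i : i < n -> rdom (w i) by apply: ordfun_dom => j; case: (Hrep (teval (fun x => c (er x)) (ts j))).
  exists w => //; apply/(E w Dw).
  have Ew (i : 'I_n) : c (w i) = teval (fun x => c (er x)) (ts i).
    by rewrite /w ordfun_ord; case: (Hrep (teval (fun x => c (er x)) (ts i))).
  split=> [i|]; first by rewrite Ew.
  by congr int_pred: H; apply: funext.
- by rewrite /= IH1 // IH2.
- rewrite sat_All [unravel _]/= rsat_All.
  have E a : rdom a -> rsat (scons a er) (unravel phi) <-> sat (scons (c a) (fun x => c (er x))) phi.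
    move=> Da; rewrite IH; last by case.
    by have -> : (fun x => c (scons a er x)) = scons (c a) (fun x => c (er x)) by apply: funext => -[].
  split=> [H k|H a Da]; last by apply/E.
  by have [a Da <-] := rz_surj cK k; apply/(E a Da); apply: H.
Qed.

End Realized.
End RelationalStructures.

(** * Semantics of translations *)

Lemma fbound_bigAnd_fin (S : signature) (I : finType) k (F : I -> form S) :
  (forall i, fbound k (F i)) -> fbound k (\big[@And S/Top]_i F i).
Proof. by move=> H; apply: fbound_bigAnd => i _. Qed.

Section UnravelBound.
Variable T : signature.

Lemma fbound_graph_atom f (xs : 'I_(ar_func f) -> nat) y n :
  (forall i, xs i < n) -> y < n -> fbound n (@graph_atom T f xs y).
Proof. by move=> Hx Hy; apply/forallP => i /=; case: unlift. Qed.

Lemma fbound_tgraph m n r (t : term T) y :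
  tbound m t -> (forall x, x < m -> r x < n) -> y < n -> fbound n (tgraph r t y).
Proof.
elim: t m n r y => [x|f ts IH] m n r y; first by rewrite /= => /[swap] /[apply] -> ->.
move=> /forallP Hts Hr Hy; rewrite /tgraph -/tgraph fbound_Exs fbound_And.
rewrite fbound_bigAnd_fin; last first.
  move=> i; apply: IH (Hts i) _ _ => [x /Hr|]; first by rewrite ltn_add2l.
  by rewrite (leq_trans (ltn_ord i)) ?leq_addr.
apply: fbound_graph_atom => [i|]; last by rewrite ltn_add2l.
by rewrite (leq_trans (ltn_ord i)) ?leq_addr.
Qed.

Lemma fbound_unravel n (phi : form T) : fbound n phi -> fbound n (unravel phi).
Proof.
elim: phi n => [|t u|R ts|phi IH1 psi IH2|phi IH] n //.
- move=> /andP [Ht Hu]; rewrite /= !andbT.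
  by rewrite (fbound_tgraph Ht) ?(fbound_tgraph Hu).
- move=> /forallP Hts; rewrite /unravel fbound_Exs fbound_And.
  rewrite fbound_bigAnd_fin; last first.
    move=> i; apply: fbound_tgraph (Hts i) _ _ => [x Hx|]; first by rewrite ltn_add2l.
    by rewrite (leq_trans (ltn_ord i)) ?leq_addr.
  by apply/forallP => i /=; rewrite (leq_trans (ltn_ord i)) ?leq_addr.
- by move=> /andP [/IH1 H1 /IH2 H2]; rewrite /= H1 H2.
- exact: IH.
Qed.

Lemma fbound_identity_ax : fbound 0 (identity_ax T).
Proof.
rewrite /identity_ax !fbound_And; apply/and3P; split.
- by rewrite /conj_axioms !big_cons big_nil !fbound_And.
- apply: fbound_bigAnd_fin => R; rewrite /eq_congr_ax fbound_Alls addn0 /=.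
  set n := ar_pred R.
  have lt_l (i : 'I_n) : i < n + n by rewrite (leq_trans (ltn_ord i)) ?leq_addr.
  have lt_r (i : 'I_n) : n + i < n + n by rewrite ltn_add2l.
  rewrite fbound_bigAnd_fin => [|i]; last by rewrite /= lt_l lt_r.
  by rewrite andTb; apply/andP; split=> /=; apply/forallP => i.
- apply: fbound_bigAnd_fin => f; rewrite fbound_And; apply/andP; split.
    rewrite /total_ax fbound_Alls addn0 [fbound _ _]/= !andbT.
    by apply: fbound_graph_atom => // i; rewrite ltnS.
  rewrite /functional_ax fbound_Alls addn0.
  by apply/and3P; split=> //; apply: fbound_graph_atom => // i; rewrite !ltnS.
Qed.

End UnravelBound.

Section TranslateSemantics.
Variables (S T : signature) (tau : translation S T) (M : structure T) (e0 : nat -> carrier M).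
Implicit Types (rho : nat -> piece tau * seq nat) (e : nat -> carrier M).

Definition inner : relstr S :=
  @RelStr S (piece tau * seq (carrier M))
    (fun a => size a.2 = dim a.1 /\ sat (blockenv a.2 e0) (tr_dom a.1))
    (fun a b => sat (blockenv (a.2 ++ b.2) e0) (tr_eq a.1 b.1))
    (fun R xs => sat (blockenv (flatten [seq (xs i).2 | i <- enum 'I_(ar_pred R)]) e0)
       (tr_pred [ffun i => (xs i).1])).

Definition eval_env e rho (x : nat) : rcar inner := ((rho x).1, [seq e v | v <- (rho x).2]).

Definition sized rho := forall x, size (rho x).2 = dim (rho x).1.

Lemma sized_env_cons p rho : sized rho -> sized (env_cons p rho).
Proof. by move=> H [|x] /=; rewrite ?size_iota ?size_map. Qed.

Lemma sized_env0 : sized (env0 tau).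
Proof. by move=> x; rewrite /= size_nseq. Qed.

Lemma sat_inst e phi vs : fbound (size vs) phi ->
  sat e (inst phi vs) <-> sat (blockenv [seq e v | v <- vs] e0) phi.
Proof.
move=> Hb; rewrite /inst sat_subst; apply: sat_ext Hb _ => x lt_x.
by rewrite /= (@blockenv_lt _ (e 0)) ?size_map // (nth_map 0).
Qed.

Lemma size_flatten_blocks n rho (v : 'I_n -> nat) (ps : {ffun 'I_n -> piece tau}) :
  sized rho -> (forall i, ps i = (rho (v i)).1) ->
  size (flatten [seq (rho (v i)).2 | i <- enum 'I_n]) = \sum_(i < n) dim (ps i).
Proof.
move=> Hrho Hps; rewrite size_flatten /shape -map_comp sumnE big_map.
rewrite big_enum; apply: eq_bigr => i _; by rewrite /= Hrho Hps.
Qed.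

Lemma sat_tr_rel phi e rho : sized rho ->
  sat e (tr_rel rho phi) <-> rsat (eval_env e rho) phi.
Proof.
elim: phi e rho => [|t u|R ts|phi IH1 psi IH2|phi IH] e rho Hrho //.
- rewrite /tr_rel sat_inst ?size_cat ?Hrho ?tr_eq_bound //.
  by rewrite map_cat.
- rewrite /tr_rel; set ps := [ffun i => _].
  rewrite sat_inst; last first.
    by rewrite (size_flatten_blocks (ps := ps)) ?tr_pred_bound // => i; rewrite ffunE.
  by rewrite map_flatten -map_comp.
- by rewrite /= IH1 // IH2.
- rewrite /tr_rel -/(tr_rel) sat_bigAnd_fin rsat_All.
  have E p v : size v = dim p -> sat (blockenv v e) (Imp (tr_dom p) (tr_rel (env_cons p rho) phi))
      <-> (rdom ((p, v) : rcar inner) -> rsat (scons ((p, v) : rcar inner) (eval_env e rho)) phi).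
    move=> sz_v; rewrite -[X in X <-> _]/(sat _ _ -> sat _ _).
    rewrite IH; last exact: sized_env_cons.
    have -> : eval_env (blockenv v e) (env_cons p rho) =
              scons ((p, v) : rcar inner) (eval_env e rho).
      apply: funext => -[|x]; rewrite /eval_env /=.
        congr (_, _); apply: (@eq_from_nth _ (e 0)); first by rewrite size_map size_iota.
        move=> i; rewrite size_map size_iota => lt_i; rewrite (nth_map 0) ?size_iota //.
        by rewrite nth_iota // (@blockenv_lt _ (e 0)) ?sz_v.
      by rewrite -map_comp; congr (_, _); apply: eq_map => y; rewrite /= -sz_v blockenv_add.
    suff -> : sat (blockenv v e) (tr_dom p) <-> sat (blockenv v e0) (tr_dom p).
      by split=> H; [case=> _ /H|move=> Hd; apply: H].
    apply: sat_ext (tr_dom_bound p) _ => x lt_x.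
    by rewrite !(@blockenv_lt _ (e 0)) ?sz_v.
  split=> [H [p v] [/= sz_v Hd]|H p].
    by have /sat_Alls /(_ v sz_v) /(E _ _ sz_v) := H p; apply.
  by apply/sat_Alls => v sz_v; apply/(E _ _ sz_v); apply: H.
Qed.

Lemma sat_translate e phi : sat e (translate tau phi) <-> rsat (eval_env e (env0 tau)) phi.
Proof. exact/sat_tr_rel/sized_env0. Qed.

End TranslateSemantics.

Section TranslateBound.
Variables (S T : signature) (tau : translation S T).
Implicit Types (rho : nat -> piece tau * seq nat).

Lemma fbound_inst n (phi : form T) vs :
  fbound (size vs) phi -> all (fun v => v < n) vs -> fbound n (inst phi vs).
Proof.
move=> Hphi Hvs; apply: fbound_fsubst Hphi _ => x lt_x /=.
exact: (all_nthP 0 Hvs).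
Qed.

Lemma fbound_tr_rel phi k n rho : sized rho -> fbound k phi ->
  (forall x, x < k -> all (fun v => v < n) (rho x).2) -> fbound n (tr_rel rho phi).
Proof.
elim: phi k n rho => [|t u|R ts|phi IH1 psi IH2|phi IH] k n rho Hrho //.
- move=> /andP [/var_of_lt Ht /var_of_lt Hu] H; rewrite /tr_rel fbound_inst //.
    by rewrite size_cat !Hrho tr_eq_bound.
  by rewrite all_cat !H.
- move=> /forallP Hts H; rewrite /tr_rel; set ps := [ffun i => _]; apply: fbound_inst.
    by rewrite (size_flatten_blocks (ps := ps)) ?tr_pred_bound // => i; rewrite ffunE.
  apply/allP => v /flattenP [vs /mapP [i _ ->]]; move: v; apply/allP.
  exact/H/var_of_lt.
- by move=> /andP [H1 H2] H; rewrite /= (IH1 k) // (IH2 k).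
- move=> Hphi H; apply: fbound_bigAnd_fin => p.
  rewrite fbound_Alls [fbound _ _]/=; apply/andP; split.
    by apply: fbound_leq (tr_dom_bound p); rewrite leq_addr.
  apply: IH Hphi _ => [|[|x] Hx /=]; first exact: sized_env_cons.
    by apply/allP => v; rewrite mem_iota /= => /leq_trans; apply; rewrite leq_addr.
  rewrite all_map; apply/allP => v Hv /=; rewrite ltn_add2l.
  exact: (allP (H x Hx)).
Qed.

Lemma sentence_translate phi : fbound 0 phi -> sentence (translate tau phi).
Proof. by move=> H; apply: (fbound_tr_rel (@sized_env0 _ _ tau) H). Qed.

End TranslateBound.

(** * Definability and elementary arithmetic *)

Section ArithmeticOperations.
Variable M : structure arith.
Local Notation D := (carrier M).

Definition zr : D := @int_func _ M FZero (tnth [tuple]).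
Definition su (x : D) : D := @int_func _ M FSucc (tnth [tuple x]).
Definition ad (x y : D) : D := @int_func _ M FAdd (tnth [tuple x; y]).
Definition mu (x y : D) : D := @int_func _ M FMul (tnth [tuple x; y]).
Definition le (x y : D) : Prop := exists z, ad z x = y.

Lemma teval_zero e : teval e tzero = zr.
Proof. by rewrite /=; congr int_func; apply: funext => -[]. Qed.

Lemma teval_succ e t : teval e (tsucc t) = su (teval e t).
Proof. by rewrite /=; congr int_func; apply: funext => -[[|]]. Qed.

Lemma teval_add e t u : teval e (tadd t u) = ad (teval e t) (teval e u).
Proof. by rewrite /=; congr int_func; apply: funext => -[[|[|]]]. Qed.

Lemma teval_mul e t u : teval e (tmul t u) = mu (teval e t) (teval e u).
Proof. by rewrite /=; congr int_func; apply: funext => -[[|[|]]]. Qed.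

Lemma sat_fle e t u : sat e (fle t u) <-> le (teval e t) (teval e u).
Proof.
rewrite /fle sat_Ex; suff E a : sat (scons a e) (Eq (tadd (Var 0) (tshift 1 t)) (tshift 1 u)) <->
    ad a (teval e t) = teval e u.
  by split=> -[a Ha]; exists a; apply/E.
change (teval (scons a e) (tadd (Var 0) (tshift 1 t)) = teval (scons a e) (tshift 1 u) <->
  ad a (teval e t) = teval e u).
by rewrite teval_add !teval_tshift.
Qed.

End ArithmeticOperations.

Arguments zr {M}.

Definition tdf (f : forall M : structure arith, (nat -> carrier M) -> carrier M) :=
  exists t, forall M (e : nat -> carrier M), teval e t = f M e.

Definition dfn (P : forall M : structure arith, (nat -> carrier M) -> Prop) :=
  exists phi, forall M (e : nat -> carrier M), sat e phi <-> P M e.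

Definition dfn0 (P : forall M : structure arith, (nat -> carrier M) -> Prop) :=
  exists2 phi, Delta0 phi & forall M (e : nat -> carrier M), sat e phi <-> P M e.

Lemma tdf_var n : tdf (fun M e => e n).
Proof. by exists (Var n). Qed.

Lemma tdf_zr : tdf (fun M e => zr).
Proof. by exists tzero => M e; rewrite teval_zero. Qed.

Lemma tdf_su f : tdf f -> tdf (fun M e => su (f M e)).
Proof. by move=> [t Ht]; exists (tsucc t) => M e; rewrite teval_succ Ht. Qed.

Lemma tdf_ad f g : tdf f -> tdf g -> tdf (fun M e => ad (f M e) (g M e)).
Proof. by move=> [t Ht] [u Hu]; exists (tadd t u) => M e; rewrite teval_add Ht Hu. Qed.

Lemma tdf_mu f g : tdf f -> tdf g -> tdf (fun M e => mu (f M e) (g M e)).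
Proof. by move=> [t Ht] [u Hu]; exists (tmul t u) => M e; rewrite teval_mul Ht Hu. Qed.

Lemma tdf_shift f : tdf f -> tdf (fun M e => f M (fun x => e x.+1)).
Proof. by move=> [t Ht]; exists (tshift 1 t) => M e; rewrite teval_subst -Ht. Qed.

Lemma tdf_teval t : tdf (fun M e => teval e t).
Proof. by exists t. Qed.

Lemma dfn0_dfn P : dfn0 P -> dfn P.
Proof. by move=> [phi _ H]; exists phi. Qed.

Lemma dfn_all (P : forall M : structure arith, carrier M -> (nat -> carrier M) -> Prop) :
  dfn (fun M e => P M (e 0) (fun x => e x.+1)) -> dfn (fun M e => forall x, P M x e).
Proof.
move=> [phi H]; exists (All phi) => M e; rewrite sat_All.
by split=> Hx x; have := H M (scons x e); rewrite /= => E; apply/E.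
Qed.

Lemma dfn_ex (P : forall M : structure arith, carrier M -> (nat -> carrier M) -> Prop) :
  dfn (fun M e => P M (e 0) (fun x => e x.+1)) -> dfn (fun M e => exists x, P M x e).
Proof.
move=> [phi H]; exists (Ex phi) => M e; rewrite sat_Ex.
by split=> -[x Hx]; exists x; have := H M (scons x e); rewrite /= => E; apply/E.
Qed.

Lemma dfn_imp P Q : dfn P -> dfn Q -> dfn (fun M e => P M e -> Q M e).
Proof. by move=> [phi H] [psi H']; exists (Imp phi psi) => M e; rewrite /= H H'. Qed.

Lemma dfn_bot : dfn (fun M e => False).
Proof. by exists Bot. Qed.

Lemma dfn_and P Q : dfn P -> dfn Q -> dfn (fun M e => P M e /\ Q M e).
Proof. by move=> [phi H] [psi H']; exists (And phi psi) => M e; rewrite sat_And H H'. Qed.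

Lemma dfn_iff P Q : dfn P -> dfn Q -> dfn (fun M e => P M e <-> Q M e).
Proof. by move=> HP HQ; apply: dfn_and; apply: dfn_imp. Qed.

Lemma dfn_not P : dfn P -> dfn (fun M e => ~ P M e).
Proof. by move=> HP; apply: dfn_imp HP dfn_bot. Qed.

Lemma dfn_subst1 (P : forall M : structure arith, carrier M -> Prop) f :
  dfn (fun M e => P M (e 0)) -> tdf f -> dfn (fun M e => P M (f M e)).
Proof.
move=> [phi H] [t Ht]; exists (fsubst (fun=> t) phi) => M e.
by rewrite sat_subst H Ht.
Qed.

Lemma dfn_subst2 (P : forall M : structure arith, carrier M -> carrier M -> Prop) f g :
  dfn (fun M e => P M (e 0) (e 1)) -> tdf f -> tdf g -> dfn (fun M e => P M (f M e) (g M e)).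
Proof.
move=> [phi H] [t Ht] [u Hu]; exists (fsubst (scons t (fun=> u)) phi) => M e.
by rewrite sat_subst H /= Ht Hu.
Qed.

Lemma dfn_subst3 (P : forall M : structure arith, carrier M -> carrier M -> carrier M -> Prop)
    f g h :
  dfn (fun M e => P M (e 0) (e 1) (e 2)) -> tdf f -> tdf g -> tdf h ->
  dfn (fun M e => P M (f M e) (g M e) (h M e)).
Proof.
move=> [phi H] [t Ht] [u Hu] [w Hw].
exists (fsubst (scons t (scons u (fun=> w))) phi) => M e.
by rewrite sat_subst H /= Ht Hu Hw.
Qed.

Lemma dfn0_ext P Q : (forall M e, P M e <-> Q M e) -> dfn0 P -> dfn0 Q.
Proof. by move=> HPQ [phi D H]; exists phi => // M e; rewrite H HPQ. Qed.

Lemma dfn0_bot : dfn0 (fun M e => False).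
Proof. by exists Bot => //; constructor. Qed.

Lemma dfn0_eq f g : tdf f -> tdf g -> dfn0 (fun M e => f M e = g M e).
Proof.
move=> [t Ht] [u Hu]; exists (Eq t u); first by constructor.
by move=> M e; rewrite /= Ht Hu.
Qed.

Lemma dfn0_imp P Q : dfn0 P -> dfn0 Q -> dfn0 (fun M e => P M e -> Q M e).
Proof.
move=> [phi D H] [psi D' H']; exists (Imp phi psi); first by constructor.
by move=> M e; rewrite /= H H'.
Qed.

Lemma dfn0_not P : dfn0 P -> dfn0 (fun M e => ~ P M e).
Proof. by move=> HP; apply: dfn0_imp HP dfn0_bot. Qed.

Lemma dfn0_and P Q : dfn0 P -> dfn0 Q -> dfn0 (fun M e => P M e /\ Q M e).
Proof.
move=> [phi D H] [psi D' H']; exists (And phi psi); first by repeat constructor.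
by move=> M e; rewrite sat_And H H'.
Qed.

Lemma dfn0_or P Q : dfn0 P -> dfn0 Q -> dfn0 (fun M e => P M e \/ Q M e).
Proof.
move=> [phi D H] [psi D' H']; exists (Or phi psi); first by repeat constructor.
by move=> M e; rewrite sat_Or H H'.
Qed.

Lemma dfn0_ball f (P : forall M : structure arith, carrier M -> (nat -> carrier M) -> Prop) :
  tdf f -> dfn0 (fun M e => P M (e 0) (fun x => e x.+1)) ->
  dfn0 (fun M e => forall x, le x (f M e) -> P M x e).
Proof.
move=> [t Ht] [phi D H]; exists (All (Imp (fle (Var 0) (tshift 1 t)) phi)).
  by constructor.
move=> M e; rewrite sat_All; split=> Hx x.
  move=> Hle; have Hx' : sat (scons x e) (fle (Var 0) (tshift 1 t)).
    by rewrite sat_fle teval_tshift Ht.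
  exact: (H M (scons x e)).1 (Hx x Hx').
move=> /sat_fle; rewrite teval_tshift Ht => Hle.
by have [_ +] := H M (scons x e); apply; apply: Hx.
Qed.

Lemma dfn0_bex f (P : forall M : structure arith, carrier M -> (nat -> carrier M) -> Prop) :
  tdf f -> dfn0 (fun M e => P M (e 0) (fun x => e x.+1)) ->
  dfn0 (fun M e => exists2 x, le x (f M e) & P M x e).
Proof.
move=> [t Ht] [phi D H]; exists (Ex (And (fle (Var 0) (tshift 1 t)) phi)).
  by constructor.
move=> M e; rewrite sat_Ex; split=> [[x /sat_And [/sat_fle]]|[x Hle Hx]].
  by rewrite teval_tshift Ht => Hle /H Hx; exists x.
exists x; apply/sat_And; split; first by rewrite sat_fle teval_tshift Ht.
by apply/H.
Qed.

(* [t <= u] is bounded only after being rewritten as [exists y <= u, y = t]. *)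
Lemma dfn0_le f g : tdf f -> tdf g -> dfn0 (fun M e => le (f M e) (g M e)).
Proof.
move=> Hf Hg; have [phi D H] := dfn0_bex (P := fun M x e => x = f M e) Hg
  (dfn0_eq (tdf_var 0) (tdf_shift Hf)).
by exists phi => // M e; rewrite H; split=> [[x + <-]|]; last by exists (f M e).
Qed.

Lemma dfn0_list (I : Type) (l : seq I) (P : I -> forall M : structure arith, (nat -> carrier M) -> Prop) :
  (forall i, dfn0 (P i)) -> dfn0 (fun M e => forall i, List.In i l -> P i M e).
Proof.
move=> HP; elim: l => [|i l [phi D H]].
  by exists Top => [|M e]; [exact: Delta0_imp Delta0_bot Delta0_bot|by split=> [_ i []|_ []]].
have [psi D' H'] := HP i; exists (And psi phi); first by repeat constructor.
move=> M e; rewrite sat_And H H'; split=> [[H1 H2] j [<-|] //|Hj]; first exact: H2.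
by split=> [|j jl]; apply: Hj; [left|right].
Qed.

Lemma dfn0_balls k f P : tdf f -> dfn0 P ->
  dfn0 (fun M e => forall w, (forall i, i < k -> le (w i) (f M e)) -> P M (prefix_env k w e)).
Proof.
move=> + HP; elim: k f => [|k IH] f Hf.
  have [phi D H] := HP.
  by exists phi => // M e; rewrite H; split=> [He w _|/(_ e)]; rewrite prefix_env0 //; apply.
apply: (@dfn0_ext (fun M e => forall x, le x (f M e) -> forall w,
  (forall i, i < k -> le (w i) (f M e)) -> P M (prefix_env k w (scons x e)))).
  move=> M e; split=> [H w Hw|H x Hx w Hw].
    by rewrite prefix_envS; apply: H => [|i Hi]; apply: Hw => //; apply: ltnW.
  pose w' i := if i == k then x else w i.
  have := H w'; rewrite prefix_envS {3}/w' eqxx (@eq_prefix_env _ k w' w).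
    by apply=> i; rewrite ltnS leq_eqVlt /w'; case: eqP => // _ /Hw.
  by move=> i Hi; rewrite /w' ltn_eqF.
apply: (dfn0_ball (P := fun M x e => forall w, (forall i, i < k -> le (w i) (f M e)) ->
    P M (prefix_env k w (scons x e))) Hf).
apply: dfn0_ext (IH _ (tdf_shift Hf)) => M e.
by have -> : scons (e 0) (fun x => e x.+1) = e by apply: funext => -[].
Qed.

Definition pi1_entails (P : structure arith -> Prop) :=
  exists2 F, (forall phi, List.In phi F -> true_Pi1 phi) &
    forall M, (forall phi, List.In phi F -> holds M phi) -> P M.

Lemma pi1_and P Q : pi1_entails P -> pi1_entails Q -> pi1_entails (fun M => P M /\ Q M).
Proof.
move=> [F HF HP] [G HG HQ]; exists (F ++ G) => [phi /List.in_app_iff [/HF|/HG] //|M HM].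
by split; [apply: HP|apply: HQ] => phi H; apply: HM; apply/List.in_app_iff; [left|right].
Qed.

Lemma pi1_weaken P Q : (forall M, P M -> Q M) -> pi1_entails P -> pi1_entails Q.
Proof. by move=> HPQ [F HF HP]; exists F => // M /HP /HPQ. Qed.

Lemma holds_closure (S : signature) (M : structure S) phi :
  holds M (Alls (fbnd phi) phi) <-> forall e : nat -> carrier M, sat e phi.
Proof.
split=> H e; last by apply/sat_Alls.
have /sat_Alls /(_ [seq e i | i <- iota 0 (fbnd phi)]) := H e.
rewrite size_map size_iota => /(_ erefl); apply: (sat_ext (fbound_fbnd phi) _).1 => x lt_x.
rewrite (@blockenv_lt _ (e 0)) ?size_map ?size_iota //.
by rewrite (nth_map 0) ?size_iota // nth_iota.
Qed.

Lemma pi1_dfn0 P : dfn0 P -> (forall e, P std_nat e) ->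
  pi1_entails (fun M => forall e, P M e).
Proof.
move=> [phi D H] HN; exists [:: Alls (fbnd phi) phi] => [_ [<-|[]]|M HM e].
  split; last by apply/holds_closure => e; apply/H.
  split; last by exists (fbnd phi), phi.
  by rewrite /sentence fbound_Alls addn0 fbound_fbnd.
by apply/H; apply: (holds_closure M phi).1; apply: HM; left.
Qed.

Record arith_laws (M : structure arith) : Prop := ArithLaws {
  al_addA : forall x y z : carrier M, ad x (ad y z) = ad (ad x y) z;
  al_addC : forall x y : carrier M, ad x y = ad y x;
  al_add0 : forall x : carrier M, ad x zr = x;
  al_addS : forall x y : carrier M, ad x (su y) = su (ad x y);
  al_mul0 : forall x : carrier M, mu x zr = zr;
  al_mulS : forall x y : carrier M, mu x (su y) = ad (mu x y) x;
  al_mulA : forall x y z : carrier M, mu x (mu y z) = mu (mu x y) z;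
  al_mulC : forall x y : carrier M, mu x y = mu y x;
  al_mulDr : forall x y z : carrier M, mu x (ad y z) = ad (mu x y) (mu x z);
  al_S0 : forall x : carrier M, su x <> zr;
  al_Sinj : forall x y : carrier M, su x = su y -> x = y;
  al_pred : forall x : carrier M, x = zr \/ exists y, x = su y;
  al_total : forall x y : carrier M, le x y \/ le y x }.

Lemma std_su x : @su std_nat x = x.+1. Proof. by []. Qed.
Lemma std_ad x y : @ad std_nat x y = x + y. Proof. by []. Qed.
Lemma std_mu x y : @mu std_nat x y = x * y. Proof. by []. Qed.
Lemma std_zr : @zr std_nat = 0. Proof. by []. Qed.

Lemma std_le (x y : nat) : @le std_nat x y <-> x <= y.
Proof.
split=> [[z]|Hxy]; first by rewrite std_ad => <-; apply: leq_addl.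
by exists (y - x); rewrite std_ad subnK.
Qed.

Definition std_simpl := (std_su, std_ad, std_mu, std_zr).

Ltac tdf := repeat first [apply: tdf_var | apply: tdf_zr | apply: tdf_su | apply: tdf_ad
  | apply: tdf_mu | apply: tdf_teval].

Ltac dfn0 := cbv beta; repeat first [apply: dfn0_bot | apply: dfn0_eq | apply: dfn0_le
  | apply: dfn0_ball | apply: dfn0_bex
  | apply: dfn0_and | apply: dfn0_or | apply: dfn0_not | apply: dfn0_imp ]; tdf.

Definition env3 (X : Type) (x y z : X) : nat -> X := scons x (scons y (fun=> z)).

Lemma pi1_arith_laws : pi1_entails arith_laws.
Proof.
apply: pi1_weaken (@pi1_dfn0 (fun M e =>
  ad (e 0) (ad (e 1) (e 2)) = ad (ad (e 0) (e 1)) (e 2) /\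
  ad (e 0) (e 1) = ad (e 1) (e 0) /\
  ad (e 0) zr = e 0 /\
  ad (e 0) (su (e 1)) = su (ad (e 0) (e 1)) /\
  mu (e 0) zr = zr /\
  mu (e 0) (su (e 1)) = ad (mu (e 0) (e 1)) (e 0) /\
  mu (e 0) (mu (e 1) (e 2)) = mu (mu (e 0) (e 1)) (e 2) /\
  mu (e 0) (e 1) = mu (e 1) (e 0) /\
  mu (e 0) (ad (e 1) (e 2)) = ad (mu (e 0) (e 1)) (mu (e 0) (e 2)) /\
  su (e 0) <> zr /\
  (su (e 0) = su (e 1) -> e 0 = e 1) /\
  (e 0 = zr \/ exists2 y, le y (e 0) & e 0 = su y) /\
  (le (e 0) (e 1) \/ le (e 1) (e 0))) _ _).
- move=> M H; split.
  + by move=> x y z; have := H (env3 x y z); intuition.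
  + by move=> x y; have := H (env3 x y x); intuition.
  + by move=> x; have := H (env3 x x x); intuition.
  + by move=> x y; have := H (env3 x y x); intuition.
  + by move=> x; have := H (env3 x x x); intuition.
  + by move=> x y; have := H (env3 x y x); intuition.
  + by move=> x y z; have := H (env3 x y z); intuition.
  + by move=> x y; have := H (env3 x y x); intuition.
  + by move=> x y z; have := H (env3 x y z); intuition.
  + by move=> x; have := H (env3 x x x); intuition.
  + by move=> x y; have := H (env3 x y x); intuition.
  + move=> x; have [_ [_ [_ [_ [_ [_ [_ [_ [_ [_ [_ [+ _]]]]]]]]]]]] := H (env3 x x x).
    by case=> [|[y _]]; [left|right; exists y].
  + by move=> x y; have := H (env3 x y x); intuition.
- by dfn0.
- move=> e; rewrite !std_simpl !std_le; do !split=> //.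
  + by rewrite addnA.
  + by rewrite addnC.
  + by rewrite addn0.
  + by rewrite addnS.
  + by rewrite muln0.
  + by rewrite mulnS addnC.
  + by rewrite mulnA.
  + by rewrite mulnC.
  + by rewrite mulnDr.
  + by case.
  + case: (e 0) => [|n]; [by left|right; exists n => //].
    by apply/std_le.
  + by apply/orP; apply: leq_total.
Qed.

Section ArithmeticModel.
Variable M : structure arith.
Hypothesis laws : arith_laws M.
Local Notation D := (carrier M).
Implicit Types x y z : D.

Lemma add0l x : ad zr x = x.
Proof. by rewrite (al_addC laws) (al_add0 laws). Qed.

Lemma addSl x y : ad (su x) y = su (ad x y).
Proof. by rewrite (al_addC laws) (al_addS laws) (al_addC laws). Qed.

Lemma mul1l x : mu (su zr) x = x.
Proof. by rewrite (al_mulC laws) (al_mulS laws) (al_mul0 laws) add0l. Qed.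

Lemma arith_le_refl x : le x x.
Proof. by exists zr; rewrite add0l. Qed.

Lemma arith_le_trans y x z : le x y -> le y z -> le x z.
Proof. by move=> [u <-] [v <-]; exists (ad v u); rewrite (al_addA laws). Qed.

Lemma arith_leS x : le x (su x).
Proof. by exists (su zr); rewrite addSl add0l. Qed.

Lemma arith_le_add2l z x y : le x y -> le (ad z x) (ad z y).
Proof.
move=> [u <-]; exists u.
by rewrite (al_addA laws) (al_addC laws u) -(al_addA laws).
Qed.

Lemma arith_le_mul2l z x y : le x y -> le (mu z x) (mu z y).
Proof. by move=> [u <-]; exists (mu z u); rewrite (al_mulDr laws). Qed.

Lemma arith_le0 x : le x zr -> x = zr.
Proof.
move=> [z]; have [->|[y ->]] := al_pred laws x => //.
by rewrite (al_addS laws) => /(al_S0 laws).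
Qed.

Lemma arith_le_succ x y : le x (su y) -> le x y \/ x = su y.
Proof.
move=> [z]; have [->|[u ->]] := al_pred laws z; first by rewrite add0l; right.
by rewrite addSl => /(al_Sinj laws) <-; left; exists u.
Qed.

Lemma arith_leSS x y : le (su x) (su y) <-> le x y.
Proof.
split=> -[z]; rewrite ?(al_addS laws); first by move/(al_Sinj laws); exists z.
by move=> <-; exists z; rewrite (al_addS laws).
Qed.

Lemma arith_lt_succ x y : le (su x) (su y) -> le (su x) y \/ x = y.
Proof.
move=> /arith_leSS [z]; have [->|[u ->]] := al_pred laws z.
  by rewrite add0l; right.
by rewrite addSl => <-; left; exists u; rewrite (al_addS laws).
Qed.

Lemma arith_nlt0 x : ~ le (su x) zr.
Proof. by move/arith_le0/(al_S0 laws). Qed.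

Lemma arith_mul_neq0 x y : x <> zr -> y <> zr -> mu x y <> zr.
Proof.
have [->//|[u -> _]] := al_pred laws x; have [->//|[v -> _]] := al_pred laws y.
by rewrite (al_mulS laws) (al_addS laws) => /(al_S0 laws).
Qed.

(* Solovay's method of shortening cuts. *)
Lemma shorten_cut (H : D -> Prop) :
  H zr -> (forall x, H x -> H (su x)) -> (forall x y, le x y -> H y -> H x) ->
  let H1 x := forall y, H y -> H (ad y x) in
  let H2 x := forall y, H1 y -> H1 (mu y x) in
  [/\ H2 zr, (forall x, H2 x -> H2 (su x)), (forall x y, H2 x -> H2 y -> H2 (ad x y)),
      (forall x y, H2 x -> H2 y -> H2 (mu x y)) & 
      (forall x y, le x y -> H2 y -> H2 x) /\ (forall x, H2 x -> H x)].
Proof.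
move=> H0 HS Hle H1 H2.
have H10 : H1 zr by move=> y; rewrite (al_add0 laws).
have H1S x : H1 x -> H1 (su x) by move=> Hx y /Hx; rewrite (al_addS laws); apply: HS.
have H1D x x' : H1 x -> H1 x' -> H1 (ad x x').
  by move=> Hx Hx' y /Hx /Hx'; rewrite (al_addA laws).
have H1le x y : le x y -> H1 y -> H1 x.
  by move=> Hxy Hy z /Hy; apply: Hle; apply: arith_le_add2l.
have H1H x : H1 x -> H x by move=> /(_ zr H0); rewrite add0l.
split.
- by move=> y _; rewrite (al_mul0 laws).
- by move=> x Hx y Hy; rewrite (al_mulS laws); apply: H1D => //; apply: Hx.
- by move=> x x' Hx Hx' y Hy; rewrite (al_mulDr laws); apply: H1D; [apply: Hx|apply: Hx'].
- by move=> x x' Hx Hx' y Hy; rewrite (al_mulA laws); apply: Hx'; apply: Hx.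
split=> [x y Hxy Hy z Hz|x /(_ (su zr))]; last by rewrite mul1l => Hx; apply/H1H/Hx/H1S.
by apply: H1le (Hy z Hz); apply: arith_le_mul2l.
Qed.

End ArithmeticModel.

Inductive qform := QBot | QAtom of term arith | QImp of qform & qform.

Fixpoint qsat (M : structure arith) (B : carrier M -> Prop) (e : nat -> carrier M) (th : qform) :=
  match th with
  | QBot => False
  | QAtom t => B (teval e t)
  | QImp th1 th2 => qsat B e th1 -> qsat B e th2
  end.

Fixpoint qatoms (th : qform) : seq (term arith) :=
  match th with
  | QBot => [::]
  | QAtom t => [:: t]
  | QImp th1 th2 => qatoms th1 ++ qatoms th2
  end.

Lemma qsat_ext (M : structure arith) (B B' : carrier M -> Prop) e th :
  (forall t, List.In t (qatoms th) -> (B (teval e t) <-> B' (teval e t))) ->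
  qsat B e th <-> qsat B' e th.
Proof.
elim: th => [|t|th1 IH1 th2 IH2] //= H; first by apply: H; left.
rewrite IH1 ?IH2 // => t Ht; apply: H; apply/List.in_app_iff; by [right|left].
Qed.

(* A finite set is coded by a pair (a, c) as in Gödel's β-function: its elements
   are the i such that 1 + (i + 1) c divides a. *)
Section CodedSets.
Variable M : structure arith.
Local Notation D := (carrier M).
Implicit Types a b c m n x y q : D.

Definition dv y x := exists2 q, le q x & mu q y = x.
Definition modulus c i := su (mu (su i) c).
Definition bit a c i := dv (modulus c i) a.
Definition common_multiple m c := c <> zr /\ forall k, le k m -> k <> zr -> dv k c.
Definition moduli_multiple m c b := b <> zr /\ forall i, le i m -> dv (modulus c i) b.
Definition codable m := (exists c, common_multiple m c) /\ forall c, exists b, moduli_multiple m c b.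
Definition agree n a c a' c' := forall i, le (su i) n -> (bit a c i <-> bit a' c' i).

Variable th : qform.
Definition qbnd := \max_(t <- qatoms th) tbnd t.

Definition valid a c m := forall e : nat -> D, (forall i, i < qbnd -> le (e i) m) ->
  (forall t, List.In t (qatoms th) -> le (teval e t) m) -> qsat (bit a c) e th.

Definition coded_models := forall m c b, common_multiple m c -> moduli_multiple m c b ->
  exists2 a, le a b & valid a c m.

(* [(a, c)] cut off at [n] is on the leftmost unbounded branch of the tree of
   valid sets, where smaller bits are to the left. *)
Definition extendible n a c := forall m, codable m ->
  exists a' c', agree n a c a' c' /\ valid a' c' m.
Definition on_path n a c := extendible n a c /\
  forall i, le (su i) n -> bit a c i ->
  forall a' c', agree i a c a' c' -> ~ bit a' c' i -> ~ extendible (su i) a' c'.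
Definition path_cut n := forall n', le n' n -> codable n' /\ (exists a c, on_path n' a c) /\
  forall a c a' c', on_path n' a c -> on_path n' a' c' -> agree n' a c a' c'.
Definition path_cut1 x := forall y, path_cut y -> path_cut (ad y x).
Definition path_cut2 x := forall y, path_cut1 y -> path_cut1 (mu y x).
Definition path_bit i := exists a c, on_path (su i) a c /\ bit a c i.

Lemma tbound_qbnd t : List.In t (qatoms th) -> tbound qbnd t.
Proof.
rewrite /qbnd; elim: (qatoms th) => //= u l IH; rewrite big_cons => -[->|/IH].
  exact: tbound_leq (leq_maxl _ _) (tbound_tbnd _).
exact: tbound_leq (leq_maxr _ _).
Qed.

End CodedSets.

Lemma qsat_ext_env (M : structure arith) (B : carrier M -> Prop) e e' th :
  (forall t, List.In t (qatoms th) -> teval e t = teval e' t) ->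
  qsat B e th <-> qsat B e' th.
Proof.
elim: th => [|t|th1 IH1 th2 IH2] //= H; first by rewrite H //; left.
rewrite IH1 ?IH2 // => t Ht; apply: H; apply/List.in_app_iff; by [right|left].
Qed.

Lemma teval_closed (M : structure arith) (P : carrier M -> Prop) e t :
  P zr -> (forall x, P x -> P (su x)) -> (forall x y, P x -> P y -> P (ad x y)) ->
  (forall x y, P x -> P y -> P (mu x y)) -> (forall i, P (e i)) -> P (teval e t).
Proof.
move=> P0 PS PD PM Pe; elim: t => [x|[] ts IH] /=; first exact: Pe.
- by congr P: P0; congr int_func; apply: funext => -[].
- congr P: (PS _ (IH ord0)); congr int_func; apply: funext => i.
  by rewrite (ord1 i).
- congr P: (PD _ _ (IH ord0) (IH ord_max)); congr int_func.
  by apply: funext => -[[|[|]] i] //=; congr (teval e (ts _)); apply: val_inj.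
- congr P: (PM _ _ (IH ord0) (IH ord_max)); congr int_func.
  by apply: funext => -[[|[|]] i] //=; congr (teval e (ts _)); apply: val_inj.
Qed.

Section Definability.
Variable th : qform.

Lemma dfn0_valid : dfn0 (fun M e => valid th (e 0) (e 2) (e 1)).
Proof.
set k := qbnd th.
have Hq th' : dfn0 (fun M e => qsat (bit (e k) (e k.+2)) e th').
  elim: th' => [|t|th1 IH1 th2 IH2] /=; last exact: dfn0_imp.
    exact: dfn0_bot.
  rewrite /bit /dv /modulus; apply: dfn0_bex; dfn0.
  apply: (tdf_shift (tdf_teval t)).
have := dfn0_balls k (tdf_var 1) (dfn0_imp
  (dfn0_list (qatoms th) (fun t => dfn0_le (tdf_teval t) (tdf_var k.+1))) (Hq th)).
apply: dfn0_ext => M e.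
have Et w t : List.In t (qatoms th) -> teval (prefix_env k w e) t = teval w t.
  by move=> /tbound_qbnd Ht; apply: teval_ext Ht _ => x lt_x; rewrite prefix_env_lt.
have Eq w B : qsat B (prefix_env k w e) th <-> qsat B w th.
  by apply: qsat_ext_env => t; apply: Et.
have E0 w : prefix_env k w e k = e 0 by rewrite -{2}[k]addn0 prefix_env_add.
have E1 w : prefix_env k w e k.+1 = e 1 by rewrite -[k.+1]addn1 prefix_env_add.
have E2 w : prefix_env k w e k.+2 = e 2 by rewrite -[k.+2]addn2 prefix_env_add.
split=> H w Hw Ht.
  have := H w Hw; rewrite E0 E1 E2 Eq; apply=> t Ht'; rewrite Et //; exact: Ht.
rewrite E0 E2 Eq; apply: H => // t Ht'; have := Ht t Ht'; by rewrite E1 Et.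
Qed.

Lemma dfn_valid : dfn (fun M e => valid th (e 0) (e 1) (e 2)).
Proof.
apply: (dfn_subst3 (P := fun M x y z => @valid M th x z y) (dfn0_dfn dfn0_valid)); tdf.
Qed.

Lemma dfn_bit : dfn (fun M e => bit (e 0) (e 1) (e 2)).
Proof. by apply: dfn0_dfn; rewrite /bit /dv /modulus; dfn0. Qed.

Lemma dfn_le : dfn (fun M e => le (e 0) (e 1)).
Proof. by apply: dfn0_dfn; dfn0. Qed.

Lemma dfn_codable : dfn (fun M e => codable (e 0)).
Proof.
rewrite /codable; apply: dfn_and.
  by apply: dfn_ex; apply: dfn0_dfn; rewrite /common_multiple /dv; dfn0.
apply: dfn_all; cbv beta; apply: dfn_ex; cbv beta; apply: dfn0_dfn.
rewrite /moduli_multiple /dv /modulus; dfn0.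
Qed.

Ltac dfn tac := repeat (cbv beta; first [ tac
  | apply: (dfn_subst1 (P := @codable) dfn_codable)
  | apply: (dfn_subst2 (P := @le) dfn_le)
  | apply: (dfn_subst3 (P := @bit) dfn_bit)
  | apply: (dfn_subst3 (P := fun M => @valid M th) dfn_valid)
  | apply: dfn_bot | apply: dfn_and | apply: dfn_iff | apply: dfn_ex
  | apply: dfn_not | apply: dfn_imp | apply: dfn_all ]); tdf.

Lemma dfn_extendible : dfn (fun M e => extendible th (e 0) (e 1) (e 2)).
Proof. by rewrite /extendible /agree; dfn fail. Qed.

Lemma dfn_on_path : dfn (fun M e => on_path th (e 0) (e 1) (e 2)).
Proof.
rewrite /on_path /agree.
by dfn ltac:(apply: (dfn_subst3 (P := fun M => @extendible M th) dfn_extendible)).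
Qed.

Ltac dfn_path := dfn ltac:(apply: (dfn_subst3 (P := fun M => @on_path M th) dfn_on_path)).

Lemma dfn_path_cut : dfn (fun M e => path_cut th (e 0)).
Proof. by rewrite /path_cut /agree; dfn_path. Qed.

Lemma dfn_path_cut2 : dfn (fun M e => path_cut2 th (e 0)).
Proof.
have dfn_path_cut1 : dfn (fun M e => path_cut1 th (e 0)).
  rewrite /path_cut1; apply: dfn_all; cbv beta; apply: dfn_imp;
  by apply: (dfn_subst1 (P := fun M => @path_cut M th) dfn_path_cut); tdf.
rewrite /path_cut2; apply: dfn_all; cbv beta; apply: dfn_imp;
by apply: (dfn_subst1 (P := fun M => @path_cut1 M th) dfn_path_cut1); tdf.
Qed.

Lemma dfn_path_bit : dfn (fun M e => path_bit th (e 0)).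
Proof. by rewrite /path_bit; dfn_path. Qed.

End Definability.

(** * The leftmost path *)

Section LeftmostPath.
Variables (M : structure arith) (th : qform).
Hypothesis laws : arith_laws M.
Hypothesis models : coded_models M th.
Local Notation D := (carrier M).
Implicit Types a b c m n x y q : D.

Let le_refl := @arith_le_refl M laws.
Let le_trans := @arith_le_trans M laws.
Let leS := @arith_leS M laws.

Lemma dv_intro x y q : x <> zr -> mu q x = y -> dv x y.
Proof.
have [->//|[u ->] _] := al_pred laws x; move=> Hq; exists q => //.
by rewrite -Hq (al_mulS laws); exists (mu q u).
Qed.

Lemma dv_mulr x y z : x <> zr -> dv x y -> dv x (mu y z).
Proof.
move=> Hx [q _ <-]; apply: (dv_intro (q := mu q z)) => //.
by rewrite -!(al_mulA laws) (al_mulC laws z).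
Qed.

Lemma dv_mull x y : x <> zr -> dv x (mu y x).
Proof. by move=> Hx; apply: (dv_intro (q := y)). Qed.

Lemma modulus_neq0 c i : @modulus M c i <> zr.
Proof. exact: al_S0. Qed.

Lemma codable0 : @codable M zr.
Proof.
split=> [|c].
  exists (su zr); split; first exact: al_S0.
  by move=> k /(arith_le0 laws).
exists (modulus c zr); split; first exact: modulus_neq0.
move=> i /(arith_le0 laws) ->; apply: (dv_intro (q := su zr)); first exact: modulus_neq0.
exact: mul1l.
Qed.

Lemma codableS m : codable m -> codable (su m).
Proof.
move=> [[c [c0 Hc]] Hb]; split=> [|d].
  exists (mu c (su m)); split; first by apply: arith_mul_neq0 => //; apply: al_S0.
  move=> k /(arith_le_succ laws) [Hk|->] k0; last exact: dv_mull.
  by apply: dv_mulr => //; apply: Hc.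
have [b [b0 {}Hb]] := Hb d; exists (mu b (modulus d (su m))).
split; first by apply: arith_mul_neq0 => //; apply: modulus_neq0.
move=> i /(arith_le_succ laws) [Hi|->]; last exact/dv_mull/modulus_neq0.
by apply: dv_mulr; [apply: modulus_neq0|apply: Hb].
Qed.

Lemma valid_le a c m n : le m n -> valid th a c n -> valid th a c m.
Proof.
move=> Hmn Hv e He Ht; apply: Hv => [i /He|t /Ht] H; exact: le_trans H Hmn.
Qed.

Lemma codable_valid m : codable m -> exists a c, valid th a c m.
Proof.
move=> [[c Hc] /(_ c) [b Hb]]; have [a _ Ha] := models Hc Hb.
by exists a, c.
Qed.

Lemma agree_sym n a c a' c' : agree n a c a' c' -> agree n a' c' a c.
Proof. by move=> H i /H ->. Qed.

Lemma agree_trans n a c a' c' a'' c'' :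
  agree n a c a' c' -> agree n a' c' a'' c'' -> agree n a c a'' c''.
Proof. by move=> H1 H2 i Hi; rewrite H1 // H2. Qed.

Lemma agree_le m n a c a' c' : le m n -> agree n a c a' c' -> agree m a c a' c'.
Proof. by move=> Hmn H i Hi; apply: H; apply: le_trans Hmn. Qed.

Lemma agreeS n a c a' c' : agree n a c a' c' -> (bit a c n <-> bit a' c' n) ->
  agree (su n) a c a' c'.
Proof. by move=> H Hn i /(arith_lt_succ laws) [/H|->]. Qed.

Lemma extendible_le m n a c : le m n -> extendible th n a c -> extendible th m a c.
Proof.
move=> Hmn Hx k Hk; have [a' [c' [H Hv]]] := Hx k Hk; exists a', c'; split=> //.
exact: agree_le H.
Qed.

Lemma on_path_le m n a c : le m n -> on_path th n a c -> on_path th m a c.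
Proof.
move=> Hmn [Hx Hl]; split; first exact: extendible_le Hx.
by move=> i Hi; apply: Hl; apply: le_trans Hmn.
Qed.

Lemma on_path0 : exists a c, on_path th zr a c.
Proof.
exists zr, zr; split=> [m /codable_valid [a [c Hv]]|i /(arith_nlt0 laws) //].
by exists a, c; split=> // i /(arith_nlt0 laws).
Qed.

Lemma on_path_unique0 a c a' c' : @agree M zr a c a' c'.
Proof. by move=> i /(arith_nlt0 laws). Qed.

Lemma on_path_uniqueS n :
  (forall a c a' c', on_path th n a c -> on_path th n a' c' -> agree n a c a' c') ->
  forall a c a' c', on_path th (su n) a c -> on_path th (su n) a' c' -> agree (su n) a c a' c'.
Proof.
move=> IH a c a' c' H1 H2.
have H := IH _ _ _ _ (on_path_le (leS n) H1) (on_path_le (leS n) H2).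
apply: agreeS => //; split=> Hb; apply: contrapT => Hn.
  exact: H1.2 n (le_refl _) Hb _ _ H Hn H2.1.
exact: H2.2 n (le_refl _) Hb _ _ (agree_sym H) Hn H1.1.
Qed.

(* One of the two one-bit extensions of an extendible set is extendible: two
   failures at [m0] and [m1] would refute extendibility at their maximum. *)
Lemma extendibleS n a c : extendible th n a c ->
  exists a' c', agree n a c a' c' /\ extendible th (su n) a' c'.
Proof.
move=> Hx; apply: contrapT => Hno.
have fails (b : Prop) : exists2 m, codable m &
    forall a' c', agree n a c a' c' -> (bit a' c' n <-> b) -> ~ valid th a' c' m.
  have [[a1 [c1 [Hag Hb]]]|Hn] := EM (exists a1 c1, agree n a c a1 c1 /\ (bit a1 c1 n <-> b)).
    have : ~ extendible th (su n) a1 c1 by move=> H; apply: Hno; exists a1, c1.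
    move=> Hne; apply: contrapT => Hm; apply: Hne => m Hcm; apply: contrapT => Hnv.
    apply: Hm; exists m => // a' c' Hag' Hb' Hv; apply: Hnv; exists a', c'; split=> //.
    by apply: agreeS; [apply: agree_trans (agree_sym Hag) Hag'|rewrite Hb Hb'].
  exists zr; first exact: codable0.
  by move=> a1 c1 Hag Hb; case: Hn; exists a1, c1.
have [m1 Hm1 H1] := fails True; have [m0 Hm0 H0] := fails False.
have [m [Hm [le1 le0]]] : exists m, codable m /\ le m1 m /\ le m0 m.
  by have [H|H] := al_total laws m1 m0; [exists m0|exists m1].
have [a' [c' [Hag Hv]]] := Hx m Hm.
have [Hb|Hb] := EM (bit a' c' n).
  by apply: (H1 a' c') => //; apply: valid_le Hv.
by apply: (H0 a' c') => //; apply: valid_le Hv.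
Qed.

Lemma on_pathS n a c : on_path th n a c -> exists a' c', on_path th (su n) a' c'.
Proof.
move=> [Hx Hl].
have Hl' a' c' : agree n a c a' c' -> forall i, le (su i) n -> bit a' c' i ->
    forall a'' c'', agree i a' c' a'' c'' -> ~ bit a'' c'' i -> ~ extendible th (su i) a'' c''.
  move=> Hag i Hi Hb a'' c'' Hag' Hb'; apply: (Hl i Hi) => //; first exact/Hag.
  by apply: agree_trans Hag'; apply: agree_le Hag; apply: le_trans Hi.
have [[a' [c' [Hag [Hb Hx']]]]|Hno] := EM (exists a' c', agree n a c a' c' /\
    (~ bit a' c' n /\ extendible th (su n) a' c')).
  exists a', c'; split=> // i /(arith_lt_succ laws) [Hi|->] //; exact: Hl'.
have [a' [c' [Hag Hx']]] := extendibleS Hx; exists a', c'; split=> //.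
move=> i /(arith_lt_succ laws) [Hi|->]; first exact: Hl'.
move=> Hb a'' c'' Hag' Hb' Hx''; apply: Hno; exists a'', c''; split=> //.
exact: agree_trans Hag'.
Qed.

Lemma path_cut_le m n : le m n -> path_cut th n -> path_cut th m.
Proof. by move=> Hmn H k Hk; apply: H; apply: le_trans Hmn. Qed.

Lemma path_cut0 : path_cut th (@zr M).
Proof.
move=> n /(arith_le0 laws) ->; split; first exact: codable0.
by split=> [|a c a' c' _ _]; [apply: on_path0|apply: on_path_unique0].
Qed.

Lemma path_cutS n : path_cut th n -> path_cut th (su n).
Proof.
move=> H m /(arith_le_succ laws) [/H //|->].
have [Hc [[a [c Ha]] Hu]] := H n (le_refl n); split; first exact: codableS.
split; first exact: on_pathS Ha.
exact: on_path_uniqueS.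
Qed.

Lemma path_cut2_closed :
  [/\ path_cut2 th (@zr M), (forall x, path_cut2 th x -> path_cut2 th (su x)),
      (forall x y, path_cut2 th x -> path_cut2 th y -> path_cut2 th (ad x y)),
      (forall x y, path_cut2 th x -> path_cut2 th y -> path_cut2 th (mu x y)) &
      forall x, path_cut2 th x -> path_cut th x].
Proof.
have [H1 H2 H3 H4 [H5 H6]] := shorten_cut laws path_cut0 path_cutS path_cut_le.
by split.
Qed.

Lemma path_cut2_bound (l : seq D) : (forall x, List.In x l -> path_cut2 th x) ->
  exists2 m, path_cut2 th m & forall x, List.In x l -> le x m.
Proof.
have [H0 _ HD _ _] := path_cut2_closed.
elim: l => [|x l IH] Hl; first by exists zr.
have [|m Hm Hlm] := IH; first by move=> y Hy; apply: Hl; right.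
exists (ad x m); first by apply: HD => //; apply: Hl; left.
move=> y [<-|/Hlm Hy]; first by exists m; rewrite (al_addC laws).
by apply: le_trans Hy _; exists x.
Qed.

Lemma path_bitE n a c x : path_cut th n -> le (su x) n -> on_path th n a c ->
  path_bit th x <-> bit a c x.
Proof.
move=> Hn Hx Ha; have Ha' := on_path_le Hx Ha; split=> [[a' [c' [Hp Hb]]]|Hb].
  have [_ [_ Hu]] := Hn _ Hx.
  exact/(Hu _ _ _ _ Ha' Hp x (le_refl _)).
by exists a, c.
Qed.

Theorem path_bit_sat e : (forall i, path_cut2 th (e i)) -> qsat (@path_bit M th) e th.
Proof.
move=> He; have [H0 HS HD HM Hcut] := path_cut2_closed.
have [|m Hm Hle] := @path_cut2_bound ([seq e i | i <- iota 0 (qbnd th)] ++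
    [seq teval e t | t <- qatoms th]).
  move=> x /List.in_app_iff [] /List.in_map_iff [y [<- _]]; first exact: He.
  exact: teval_closed.
have HSm := Hcut _ (HS _ Hm).
have [_ [[a [c Ha]] _]] := HSm _ (le_refl _).
have [Hcod _] := HSm m (leS m).
have [a' [c' [Hag Hv]]] := Ha.1 m Hcod.
have Hle_t t : List.In t (qatoms th) -> le (teval e t) m.
  by move=> Ht; apply: Hle; apply/List.in_app_iff; right; apply: List.in_map.
have := Hv e; move=> /(_ _ Hle_t) H.
apply: (qsat_ext (B := bit a' c') _).1; last first.
  apply: H => i Hi; apply: Hle; apply/List.in_app_iff; left.
  by apply: List.in_map; apply/List_In_mem; rewrite mem_iota.
move=> t /Hle_t /(arith_leSS laws) Ht.
by rewrite (path_bitE HSm Ht Ha) Hag.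
Qed.

End LeftmostPath.

Lemma std_dv (x y : nat) : 0 < x -> @dv std_nat x y <-> x %| y.
Proof.
move=> x_gt0; split=> [[q _]|/dvdnP [q ->]]; first by rewrite std_mu => <-; rewrite dvdn_mull.
by exists q => //; apply/std_le; rewrite leq_pmulr.
Qed.

Definition std_modulus c i := (i.+1 * c).+1.

Lemma std_bit a c (i : nat) : @bit std_nat a c i <-> std_modulus c i %| a.
Proof. exact: std_dv. Qed.

Lemma coprime_modulus m c i j : (forall k, 0 < k <= m -> k %| c) ->
  i < j <= m -> coprime (std_modulus c i) (std_modulus c j).
Proof.
move=> Hc /andP [lt_ij le_jm]; rewrite /coprime; set d := gcdn _ _.
have d_c : coprime d c.
  apply: coprime_dvdl (dvdn_gcdl _ _) _.
  exact: coprime_dvdr (dvdn_mull i.+1 (dvdnn c)) (coprimeSn _).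
have d_ij : d %| j - i.
  rewrite -(Gauss_dvdl _ d_c) -subSS mulnBl -subSS.
  by apply: dvdn_sub; [apply: dvdn_gcdr|apply: dvdn_gcdl].
have ij_c : j - i %| c by rewrite Hc // subn_gt0 lt_ij (leq_trans (leq_subr _ _)).
by move: d_c; rewrite /coprime => /eqP <-; apply/eqP/esym/gcdn_idPl/(dvdn_trans d_ij).
Qed.

Lemma coprime_prodl k (f : nat -> nat) g :
  (forall i, i < k -> coprime (f i) g) -> coprime (\prod_(i < k) f i) g.
Proof.
elim: k => [|k IH] H; first by rewrite big_ord0 coprime1n.
rewrite big_ord_recr /= coprimeMl H // IH // => i Hi; apply: H; exact: ltnW.
Qed.

Lemma dvdn_coprime_prod k (f : nat -> nat) b :
  (forall i j, i < j < k -> coprime (f i) (f j)) -> (forall i, i < k -> f i %| b) ->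
  \prod_(i < k) f i %| b.
Proof.
elim: k => [|k IH] Hc Hd; first by rewrite big_ord0 dvd1n.
rewrite big_ord_recr /= Gauss_dvd ?Hd ?andbT //.
  apply: IH => [i j /andP [Hi Hj]|i Hi]; [apply: Hc|apply: Hd]; last exact: ltnW.
  by rewrite Hi ltnW.
by apply: coprime_prodl => i Hi; apply: Hc; rewrite Hi leqnn.
Qed.

Lemma beta_coding m c b (X : nat -> Prop) : 0 < c -> 0 < b ->
  (forall k, 0 < k <= m -> k %| c) -> (forall i, i <= m -> std_modulus c i %| b) ->
  exists2 a, a <= b & forall i, i <= m -> (X i <-> std_modulus c i %| a).
Proof.
move=> c_gt0 b_gt0 Hc Hb; pose f i := if `[< X i >] then std_modulus c i else 1.
have cop i j : i <= m -> j <= m -> i != j -> coprime (std_modulus c i) (std_modulus c j).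
  move=> Hi Hj; rewrite neq_ltn => /orP [] H; last rewrite coprime_sym;
  by apply: (coprime_modulus Hc); rewrite H.
exists (\prod_(i < m.+1) f i).
  apply: dvdn_leq => //; apply: dvdn_coprime_prod => [i j /andP [lt_ij lt_j]|i lt_i].
    rewrite /f; case: asboolP => _; last by rewrite coprime1n.
    case: asboolP => _; last by rewrite coprimen1.
    by apply: cop => //; [rewrite -ltnS (ltn_trans lt_ij)|rewrite ltn_eqF].
  by rewrite /f; case: asboolP => _; [apply: Hb|rewrite dvd1n].
move=> i Hi; split=> [Xi|Hdvd].
  rewrite (bigD1 (Ordinal (Hi : i < m.+1))) //= {1}/f asboolT //; exact: dvdn_mulr.
apply: contrapT => nX.
have : coprime (\prod_(i < m.+1) f i) (std_modulus c i).
  apply: coprime_prodl => j Hj; rewrite /f; case: asboolP => [Xj|_]; last exact: coprime1n.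
  by apply: cop => //; apply: contra_notN nX => /eqP <-.
move/(coprime_dvdl Hdvd); rewrite /coprime gcdnn /std_modulus eqSS muln_eq0 /=.
by rewrite eqn0Ngt c_gt0.
Qed.

Lemma pi1_coded_models th (X : nat -> Prop) :
  (forall e, @qsat std_nat X e th) -> pi1_entails (fun M => coded_models M th).
Proof.
move=> HX.
apply: pi1_weaken (@pi1_dfn0 (fun M e => common_multiple (e 0) (e 1) ->
  moduli_multiple (e 0) (e 1) (e 2) ->
  exists2 a, le a (e 2) & valid th a (e 1) (e 0)) _ _) => [M H m c b|| e [c0 Hc] [b0 Hb]].
- exact: (H (env3 m c b)).
- apply: dfn0_imp; first by rewrite /common_multiple /dv; dfn0.
  apply: dfn0_imp; first by rewrite /moduli_multiple /dv /modulus; dfn0.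
  apply: (dfn0_bex (P := fun M x e => valid th x (e 1) (e 0))); [exact: tdf_var|exact: dfn0_valid].
move: c0 Hc b0 Hb; set m := e 0; set c := e 1; set b := e 2 => c0 Hc b0 Hb.
have [||k /andP [k_gt0 Hk]|i Hi|a Hab Ha] := @beta_coding m c b X.
- by rewrite lt0n; apply/eqP.
- by rewrite lt0n; apply/eqP.
- by apply/std_dv => //; apply: Hc; [apply/std_le|move=> k0; rewrite k0 in k_gt0].
- by apply/std_dv => //; apply: Hb; apply/std_le.
exists a; first exact/std_le.
move=> w _ Ht; apply: (qsat_ext _).1 (HX w) => t /Ht /std_le Hle.
by rewrite std_bit; apply: Ha.
Qed.

(* The low basis theorem, carried out on a cut. *)
Theorem definable_path th (X : nat -> Prop) : (forall e, @qsat std_nat X e th) ->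
  exists (F : seq (form arith)) (delta beta : form arith),
  [/\ forall phi, List.In phi F -> true_Pi1 phi, fbound 1 delta, fbound 1 beta &
    forall M, (forall phi, List.In phi F -> holds M phi) ->
    exists dl bt : carrier M -> Prop,
    [/\ forall e, sat e delta <-> dl (e 0), forall e, sat e beta <-> bt (e 0),
      [/\ dl zr, forall x, dl x -> dl (su x), forall x y, dl x -> dl y -> dl (ad x y) &
        forall x y, dl x -> dl y -> dl (mu x y)] &
      forall e, (forall i, dl (e i)) -> qsat bt e th]].
Proof.
move=> HX; have [F HF HM] := pi1_and pi1_arith_laws (pi1_coded_models HX).
have [[delta Hd] [beta Hb]] := (dfn_path_cut2 th, dfn_path_bit th).
have b1 phi : fbound 1 (fsubst (fun=> Var 0) phi : form arith).
  exact: fbound_fsubst (fbound_fbnd phi) _.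
exists F, (fsubst (fun=> Var 0) delta), (fsubst (fun=> Var 0) beta); split=> // M HFM.
have [laws models] := HM M HFM.
exists (@path_cut2 M th), (@path_bit M th); split=> [e|e||].
- by rewrite sat_subst Hd.
- by rewrite sat_subst Hb.
- by have [] := path_cut2_closed laws models.
- exact: path_bit_sat.
Qed.

(** * Codes of tuples *)

Lemma course_of_values_choice (X : Type) (x0 : X) (spec : (nat -> X) -> nat -> X -> Prop) :
  (forall g g' n v, (forall m, m < n -> g m = g' m) -> spec g n v -> spec g' n v) ->
  (forall g n, exists v, spec g n v) -> exists h, forall n, spec h n (h n).
Proof.
move=> Hloc Hex; have [F HF] := @choice _ _ (fun gn v => spec gn.1 gn.2 v)
  (fun gn => Hex gn.1 gn.2).
pose s := fix s n := if n is m.+1 then rcons (s m) (F (nth x0 (s m), m)) else [::].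
have size_s n : size (s n) = n by elim: n => //= n IH; rewrite size_rcons IH.
have nth_s m n : n < m -> nth x0 (s m) n = nth x0 (s n.+1) n.
  elim: m => // m IH; rewrite ltnS leq_eqVlt => /orP [/eqP -> //|lt_nm].
  by rewrite [s m.+1]/= nth_rcons size_s lt_nm IH.
exists (fun n => nth x0 (s n.+1) n) => n.
rewrite [s _]/= nth_rcons size_s ltnn eqxx.
apply: Hloc (HF (nth x0 (s n), n)) => m lt_mn /=; rewrite nth_s //.
Qed.

Section Codes.
Variable M : structure arith.
Local Notation D := (carrier M).

Definition num (n : nat) : D := iter n (@su M) zr.
Definition pair_code (x y : D) : D := ad (mu (ad x y) (ad x y)) x.
Definition seq_code (l : seq D) : D := foldr (fun x y => su (pair_code x y)) zr l.
Definition code (k n : nat) (l : seq D) : D := seq_code [:: num k, num n & l].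

End Codes.

Definition tnum (n : nat) : term arith := iter n tsucc tzero.
Definition tpair_code (x y : term arith) := tadd (tmul (tadd x y) (tadd x y)) x.
Definition tseq_code (l : seq (term arith)) :=
  foldr (fun x y => tsucc (tpair_code x y)) tzero l.
Definition tcode (k n : nat) (l : seq (term arith)) := tseq_code [:: tnum k, tnum n & l].

Lemma teval_tcode (M : structure arith) (e : nat -> carrier M) k n l :
  teval e (tcode k n l) = @code M k n [seq teval e t | t <- l].
Proof.
have Hnum i : teval e (tnum i) = num M i.
  elim: i => [|i IH]; first exact: teval_zero.
  by rewrite -[tnum _]/(tsucc (tnum i)) teval_succ IH.
rewrite /tcode /code; set l' := [:: _, _ & l].
rewrite -[[:: num M k, num M n & _]]/([:: num M k; num M n] ++ _) -!Hnum.
rewrite -[[:: _; _] ++ _]/[seq teval e t | t <- l'].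
elim: l' => [|t l' IH]; first exact: teval_zero.
rewrite -[tseq_code _]/(tsucc (tpair_code t (tseq_code l'))).
by rewrite teval_succ /tpair_code teval_add teval_mul teval_add IH.
Qed.

Lemma tbound_tcode m k n l : (forall t, List.In t l -> tbound m t) -> tbound m (tcode k n l).
Proof.
have T0 : tbound m tzero by apply/forallP => -[].
have TS t : tbound m t -> tbound m (tsucc t) by move=> H; apply/forallP => -[[|]].
have TD t u : tbound m t -> tbound m u -> tbound m (tadd t u).
  by move=> H H'; apply/forallP => -[[|[|]]].
have TM t u : tbound m t -> tbound m u -> tbound m (tmul t u).
  by move=> H H'; apply/forallP => -[[|[|]]].
have Tn i : tbound m (tnum i) by elim: i => //= i IH; apply: TS.
move=> Hl; rewrite /tcode; have: forall t, List.In t [:: tnum k, tnum n & l] -> tbound m t.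
  by move=> t [<-|[<-|/Hl]].
elim: [:: _, _ & l] => //= t l' IH H; apply: (TS).
have Ht := H t (or_introl erefl).
have Hl' : tbound m (tseq_code l') by apply: IH => u Hu; apply: H; right.
by apply: (TD); [apply: (TM); apply: (TD)|].
Qed.

Lemma num_std n : num std_nat n = n.
Proof. by elim: n => //= n ->. Qed.

Lemma pair_code_inj (x y x' y' : nat) :
  pair_code (M := std_nat) x y = pair_code (M := std_nat) x' y' -> x = x' /\ y = y'.
Proof.
rewrite /pair_code !std_simpl; set s := x + y; set s' := x' + y' => H.
have mono u v a b : u < v -> a <= u -> u * u + a < v * v + b.
  move=> lt_uv le_a; apply: leq_trans (leq_addr b _).
  apply: leq_trans (leq_mul lt_uv lt_uv).
  by rewrite mulSn mulnS addSn ltnS addnA [u * u + a]addnC leq_add2r (leq_trans le_a) ?leq_addr.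
have Ess' : s = s'.
  case: (ltngtP s s') => // lt_s; [have := mono _ _ x x' lt_s (leq_addr _ _)
    |have := mono _ _ x' x lt_s (leq_addr _ _)]; by rewrite H ltnn.
move: H; rewrite Ess' => /addnI Ex; split=> //; move: Ess'; rewrite /s /s' Ex.
exact: addnI.
Qed.

Lemma seq_code_inj : injective (@seq_code std_nat).
Proof.
elim=> [|x l IH] [|x' l'] //=; rewrite ?std_simpl => -[/pair_code_inj [-> /IH ->]] //.
Qed.

Lemma code_inj k n l k' n' l' :
  @code std_nat k n l = @code std_nat k' n' l' -> [/\ k = k', n = n' & l = l'].
Proof. by move/seq_code_inj; rewrite !num_std => -[-> -> ->]. Qed.

Lemma seq_code_lt (l : seq nat) x : x \in l -> x < seq_code (M := std_nat) l.
Proof.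
elim: l => // y l IH; rewrite inE -[_ < _]/(_ < (@pair_code std_nat y (@seq_code std_nat l)).+1) ltnS.
set s := @seq_code std_nat l in IH *.
change (x <= @pair_code std_nat y s) with (x <=  (y + s) * (y + s) + y).
have sq u : u <= u * u by case: u => // u; rewrite mulnS leq_addr.
move=> /orP [/eqP ->|/IH /ltnW Hx]; first exact: leq_addl.
apply: leq_trans (leq_addr _ _); apply: leq_trans (sq _).
exact: leq_trans Hx (leq_addl _ _).
Qed.

Lemma nth_code_lt k n (l : seq nat) i : nth 0 l i < @code std_nat k n l.
Proof.
have [lt_i|ge_i] := ltnP i (size l); last by rewrite nth_default.
by apply: seq_code_lt; rewrite !inE mem_nth ?orbT.
Qed.

Lemma code_closed (M : structure arith) (P : carrier M -> Prop) k n l :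
  P zr -> (forall x, P x -> P (su x)) -> (forall x y, P x -> P y -> P (ad x y)) ->
  (forall x y, P x -> P y -> P (mu x y)) -> (forall x, List.In x l -> P x) -> P (code k n l).
Proof.
move=> P0 PS PD PM; have P_num i : P (num M i) by elim: i => //= i; apply: PS.
move=> Hl; rewrite /code; have: forall x, List.In x [:: num M k, num M n & l] -> P x.
  by move=> x [<-|[<-|/Hl]].
elim: [:: _, _ & l] => //= x l' IH H; apply: PS.
have Hx := H x (or_introl erefl).
have Hl' : P (seq_code l') by apply: IH => u Hu; apply: H; right.
by apply: (PD) => //; apply: (PM); apply: (PD).
Qed.

(* Unfolding codes doubles their size at every level. *)
Opaque code tcode.

Definition qAnd a b := QImp (QImp a (QImp b QBot)) QBot.
Definition qIff a b := qAnd (QImp a b) (QImp b a).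
Definition qAll := foldr qAnd (QImp QBot QBot).

Section QSat.
Variables (M : structure arith) (B : carrier M -> Prop) (e : nat -> carrier M).

Lemma qsat_And a b : qsat B e (qAnd a b) <-> qsat B e a /\ qsat B e b.
Proof.
split=> /= [H|[H1 H2] H]; last exact: (H H1 H2).
by split; apply: contrapT => H'; apply: H.
Qed.

Lemma qsat_Iff a b : qsat B e (qIff a b) <-> (qsat B e a <-> qsat B e b).
Proof. by rewrite /qIff qsat_And. Qed.

Lemma qsat_All l : qsat B e (qAll l) <-> forall a, List.In a l -> qsat B e a.
Proof.
elim: l => [|a l IH]; first by split=> [_ ? []|_ []].
rewrite [qAll _]/= qsat_And IH; split=> [[H1 H2] j [<-|] //|H]; first exact: H2.
by split=> [|j jl]; apply: H; [left|right].
Qed.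

Lemma qsat_atom k n l :
  qsat B e (QAtom (tcode k n l)) <-> B (@code M k n [seq teval e t | t <- l]).
Proof. by rewrite -teval_tcode. Qed.

End QSat.

(** * A universal theory of truth *)

Section TruthClauses.
Variable T : signature.
Implicit Types (phi psi : form T).

(* The bit at [code 0 (form_code phi) l] records whether [phi] holds under the
   assignment [l]. The codes with tags 1 and 2 are the elements themselves: values
   of the function symbols, and counterexamples to universal formulas. *)
Definition eq_form : form T := Eq (Var 0) (Var 1).
Definition rel_form (R : pred_sym T) : form T := Rel R (fun i => Var i).

Fixpoint skolem_term (t : term T) : term arith :=
  match t with
  | Var x => Var x
  | App f ts => tcode 1 (pickle f) [seq skolem_term (ts i) | i <- enum 'I_(ar_func f)]
  end.

Definition holds_at phi (l : seq (term arith)) := QAtom (tcode 0 (form_code phi) l).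
Definition holds_eq (t u : term arith) := holds_at eq_form [:: t; u].
Definition vars n : seq (term arith) := [seq Var i | i <- iota 0 n].
Definition eq_args n := qAll [seq holds_eq (Var i) (Var (n + i)) | i : 'I_n <- enum 'I_n].
Definition argsl n : seq (term arith) := [seq Var (nat_of_ord i) | i <- enum 'I_n].
Definition argsr n : seq (term arith) := [seq Var (n + nat_of_ord i) | i <- enum 'I_n].

Definition equality_clauses : seq qform :=
  [:: holds_eq (Var 0) (Var 0);
      QImp (holds_eq (Var 0) (Var 1)) (holds_eq (Var 1) (Var 0));
      QImp (holds_eq (Var 0) (Var 1))
        (QImp (holds_eq (Var 1) (Var 2)) (holds_eq (Var 0) (Var 2)))] ++
  [seq QImp (eq_args (ar_func f)) (holds_eq (tcode 1 (pickle f) (argsl (ar_func f)))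
         (tcode 1 (pickle f) (argsr (ar_func f)))) | f <- enum (func T)] ++
  [seq QImp (eq_args (ar_pred R)) (QImp (holds_at (rel_form R) (argsl (ar_pred R)))
         (holds_at (rel_form R) (argsr (ar_pred R)))) | R <- enum (pred_sym T)].

Fixpoint truth_clauses n phi : seq qform :=
  match phi with
  | Bot => [:: QImp (holds_at Bot (vars n)) QBot]
  | Eq t u => [:: qIff (holds_at phi (vars n)) (holds_eq (skolem_term t) (skolem_term u))]
  | Rel R ts => [:: qIff (holds_at phi (vars n))
      (holds_at (rel_form R) [seq skolem_term (ts i) | i <- enum 'I_(ar_pred R)])]
  | Imp phi1 phi2 => qIff (holds_at phi (vars n))
      (QImp (holds_at phi1 (vars n)) (holds_at phi2 (vars n))) ::
      truth_clauses n phi1 ++ truth_clauses n phi2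
  | All phi1 =>
      [:: QImp (holds_at phi [seq Var i.+1 | i <- iota 0 n]) (holds_at phi1 (vars n.+1));
          QImp (holds_at phi1 (tcode 2 (form_code phi1) (vars n) :: vars n))
            (holds_at phi (vars n))] ++ truth_clauses n.+1 phi1
  end.

Definition model_clauses (A : seq (form T)) : seq qform :=
  equality_clauses ++ flatten [seq holds_at phi [::] :: truth_clauses 0 phi | phi <- A].

Section QSatClauses.
Variables (M : structure arith) (B : carrier M -> Prop) (e : nat -> carrier M).

Definition eqv (x y : carrier M) := B (code 0 (form_code eq_form) [:: x; y]).

Lemma qsat_Imp a b : qsat B e (QImp a b) <-> (qsat B e a -> qsat B e b).
Proof. by []. Qed.

Lemma qsat_at phi l : qsat B e (holds_at phi l) <->
  B (code 0 (form_code phi) [seq teval e t | t <- l]).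
Proof. exact: qsat_atom. Qed.

Lemma qsat_eq t u : qsat B e (holds_eq t u) <-> eqv (teval e t) (teval e u).
Proof. exact: qsat_atom. Qed.

Lemma qsat_eq_args n : qsat B e (eq_args n) <-> forall i : 'I_n, eqv (e i) (e (n + i)).
Proof.
rewrite /eq_args qsat_All; split=> [H i|H _ /List.in_map_iff [i [<- _]]].
  apply/(qsat_eq (Var i) (Var (n + i))); apply: H; apply/List.in_map_iff; exists i; split=> //.
  by apply/List_In_mem; rewrite mem_enum.
by apply/qsat_eq; apply: H.
Qed.

Lemma teval_vars n : [seq teval e t | t <- vars n] = [seq e i | i <- iota 0 n].
Proof. by rewrite /vars -map_comp. Qed.

Lemma teval_argsl n : [seq teval e t | t <- argsl n] = [seq e (nat_of_ord i) | i <- enum 'I_n].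
Proof. by rewrite /argsl -map_comp. Qed.

Lemma teval_argsr n : [seq teval e t | t <- argsr n] = [seq e (n + nat_of_ord i) | i <- enum 'I_n].
Proof. by rewrite /argsr -map_comp. Qed.

End QSatClauses.

Section StandardModel.
Variables (K : structure T) (k0 : carrier K).

Definition node_spec (g : nat -> carrier K) (n : nat) (v : carrier K) : Prop :=
  (forall f xs, n = @code std_nat 1 (pickle f) xs ->
     v = int_func (fun i : 'I_(ar_func f) => g (nth 0 xs i))) /\
  (forall phi xs, n = @code std_nat 2 (form_code phi) xs ->
     (exists a, ~ sat (scons a (fun x => g (nth 0 xs x))) phi) ->
     ~ sat (scons v (fun x => g (nth 0 xs x))) phi).

Lemma node_spec_local g g' n v :
  (forall m, m < n -> g m = g' m) -> node_spec g n v -> node_spec g' n v.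
Proof.
move=> Hg [H1 H2].
have E k j (xs : seq nat) : n = @code std_nat k j xs ->
    (fun x => g' (nth 0 xs x)) = (fun x => g (nth 0 xs x)).
  by move=> Hn; apply: funext => x; rewrite Hg // Hn; apply: nth_code_lt.
split=> [f xs Hn|phi xs Hn].
  rewrite (H1 f xs Hn); congr int_func; apply: funext => i.
  by rewrite -[RHS]/((fun x => g' (nth 0 xs x)) i) (E _ _ _ Hn).
by rewrite (E _ _ _ Hn); apply: H2.
Qed.

Lemma node_spec_ex g n : exists v, node_spec g n v.
Proof.
have [[f [xs Hn]]|Hf] := EM (exists (f : func T) xs, n = @code std_nat 1 (pickle f) xs).
  exists (int_func (fun i : 'I_(ar_func f) => g (nth 0 xs i))); split.
    move=> f' xs'; rewrite Hn => /code_inj [_ /(pcan_inj pickleK) Ef <-].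
    by case: _ / Ef.
  by move=> phi xs'; rewrite Hn => /code_inj [].
have [[phi [xs [Hn [a Ha]]]]|Hphi] := EM (exists phi xs, n = @code std_nat 2 (form_code phi) xs /\
    exists a, ~ sat (scons a (fun x => g (nth 0 xs x))) phi).
  exists a; split=> [f xs' Hn'|phi' xs']; first by case: Hf; exists f, xs'.
  by rewrite Hn => /code_inj [_ /form_code_inj <- <-].
exists k0; split=> [f xs' Hn'|phi' xs' Hn' Ha]; first by case: Hf; exists f, xs'.
by case: Hphi; exists phi', xs'.
Qed.

Variable h : nat -> carrier K.
Hypothesis hP : forall n, node_spec h n (h n).

Let henv (xs : seq nat) (x : nat) : carrier K := h (nth 0 xs x).

Definition truth_set (n : nat) : Prop :=
  exists phi xs, n = @code std_nat 0 (form_code phi) xs /\ sat (henv xs) phi.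

Lemma truth_setE phi xs : truth_set (@code std_nat 0 (form_code phi) xs) <-> sat (henv xs) phi.
Proof.
split=> [[psi [ys [/code_inj [_ /form_code_inj -> ->]]]] //|H].
by exists phi, xs.
Qed.

Lemma truth_set_eqv x y : eqv (M := std_nat) truth_set x y <-> h x = h y.
Proof. exact: truth_setE. Qed.

Lemma nth_map_enum n (g : 'I_n -> nat) (i : 'I_n) : nth 0 [seq g j | j <- enum 'I_n] i = g i.
Proof. by rewrite (nth_map i) ?size_enum_ord // nth_ord_enum. Qed.

Lemma h_func f (xs : 'I_(ar_func f) -> nat) :
  h (@code std_nat 1 (pickle f) [seq xs i | i <- enum 'I_(ar_func f)]) =
  int_func (fun i => h (xs i)).
Proof.
have [H _] := hP (@code std_nat 1 (pickle f) [seq xs i | i <- enum 'I_(ar_func f)]).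
by rewrite (H f _ erefl); congr int_func; apply: funext => i; rewrite nth_map_enum.
Qed.

Lemma h_skolem_term e t : h (teval (M := std_nat) e (skolem_term t)) = teval (fun x => h (e x)) t.
Proof.
elim: t => [x|f ts IH] //; rewrite [skolem_term _]/= teval_tcode -map_comp.
by rewrite h_func /=; congr int_func; apply: funext => i; apply: IH.
Qed.

Lemma henv_vars n (e : nat -> nat) phi : fbound n phi ->
  sat (henv [seq e i | i <- iota 0 n]) phi <-> sat (fun x => h (e x)) phi.
Proof.
move=> Hb; apply: sat_ext Hb _ => x lt_x.
by rewrite /henv (nth_map 0) ?size_iota // nth_iota.
Qed.

Lemma henv_rel R (xs : 'I_(ar_pred R) -> nat) :
  sat (henv [seq xs i | i <- enum 'I_(ar_pred R)]) (rel_form R) <->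
  int_pred (fun i => h (xs i)).
Proof.
rewrite /= /henv; suff -> : (fun i : 'I_(ar_pred R) => h (nth 0 [seq xs i | i <- enum 'I_(ar_pred R)] i)) =
  (fun i => h (xs i)) by [].
by apply: funext => i; rewrite nth_map_enum.
Qed.

Lemma truth_set_equality e th : List.In th equality_clauses -> qsat (M := std_nat) truth_set e th.
Proof.
have Eargs n : qsat (M := std_nat) truth_set e (eq_args n) -> forall i : 'I_n, h (e i) = h (e (n + i)).
  by move/qsat_eq_args => H i; apply/truth_set_eqv.
case=> [<-|[<-|[<-|]]].
- by apply/qsat_eq/truth_set_eqv.
- apply/qsat_Imp => /qsat_eq /truth_set_eqv H.
  exact/qsat_eq/truth_set_eqv/esym.
- apply/qsat_Imp => /qsat_eq /truth_set_eqv H1; apply/qsat_Imp => /qsat_eq /truth_set_eqv H2.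
  exact/qsat_eq/truth_set_eqv/(etrans H1).
move/List.in_app_iff => [] /List.in_map_iff [s [<- _]].
  apply/qsat_Imp => /Eargs H; apply/qsat_eq/truth_set_eqv.
  rewrite !teval_tcode teval_argsl teval_argsr.
  by rewrite !h_func; congr int_func; apply: funext.
apply/qsat_Imp => /Eargs H; apply/qsat_Imp => /qsat_at.
rewrite teval_argsl => /truth_setE /henv_rel Hl.
apply/qsat_at; rewrite teval_argsr; apply/truth_setE/henv_rel.
by congr int_pred: Hl; apply: funext.
Qed.

Lemma truth_set_clauses phi n e th : fbound n phi -> List.In th (truth_clauses n phi) ->
  qsat (M := std_nat) truth_set e th.
Proof.
have Eat phi' l : qsat (M := std_nat) truth_set e (holds_at phi' l) <->
    sat (henv [seq teval (M := std_nat) e t | t <- l]) phi'.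
  by rewrite qsat_at truth_setE.
have Evars n' phi' : fbound n' phi' -> qsat (M := std_nat) truth_set e (holds_at phi' (vars n')) <->
    sat (fun x => h (e x)) phi'.
  by move=> Hb; rewrite Eat teval_vars henv_vars.
elim: phi n th => [|t u|R ts|phi1 IH1 phi2 IH2|phi IH] n th Hb /=.
- by case=> [<-|//]; rewrite qsat_Imp Evars.
- case=> [<-|//]; apply/qsat_Iff; rewrite (Evars n (Eq t u) Hb) qsat_eq.
  by rewrite truth_set_eqv !h_skolem_term.
- case=> [<-|//]; apply/qsat_Iff; rewrite (Evars n (Rel R ts) Hb) Eat -map_comp.
  rewrite henv_rel /=; suff -> : (fun i => teval (fun x => h (e x)) (ts i)) =
    (fun i => h ((@teval _ std_nat e \o (fun i => skolem_term (ts i))) i)) by [].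
  by apply: funext => i; rewrite /= h_skolem_term.
- case/andP: (Hb) => Hb1 Hb2 [<-|/List.in_app_iff [/IH1|/IH2]]; [|exact|exact].
  apply/qsat_Iff; rewrite (Evars n (Imp phi1 phi2) Hb).
  by rewrite qsat_Imp !Evars.
- case=> [<-|[<-|/(IH n.+1) //]]; last exact.
    rewrite qsat_Imp Eat -map_comp Evars // => H.
    have {}H : sat (fun x => h (e x.+1)) (All phi).
      apply: (sat_ext (n := n) _ _).1 H => // x lt_x.
      by rewrite /henv (nth_map 0) ?size_iota // nth_iota.
    move/sat_All: H => /(_ (h (e 0))).
    by have -> : scons (h (e 0)) (fun x => h (e x.+1)) = (fun x => h (e x)) by apply: funext => -[].
  rewrite qsat_Imp !Eat map_cons teval_vars teval_tcode teval_vars.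
  set w := code _ _ _; set xs := [seq e i | i <- iota 0 n] => H.
  apply/sat_All => a; apply: contrapT => Ha.
  have [_ /(_ phi xs erefl)] := hP w; apply; first by exists a.
  by congr sat: H; apply: funext => -[].
Qed.

End StandardModel.
End TruthClauses.

(** * Definable models *)

Lemma In_cat (X : Type) (x : X) (s t : seq X) : List.In x (s ++ t) <-> List.In x s \/ List.In x t.
Proof. exact: List.in_app_iff. Qed.

Section ReflectedModel.
Variables (T : signature) (A : seq (form T)) (M : structure arith).
Variables dl bt : carrier M -> Prop.
Hypothesis dl0 : dl zr.
Hypothesis dlS : forall x, dl x -> dl (su x).
Hypothesis dlD : forall x y, dl x -> dl y -> dl (ad x y).
Hypothesis dlM : forall x y, dl x -> dl y -> dl (mu x y).
Hypothesis bt_clauses : forall e th, (forall i, dl (e i)) ->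
  List.In th (model_clauses A) -> qsat bt e th.

Lemma dl_code k n l : (forall x, List.In x l -> dl x) -> dl (code k n l).
Proof. exact: code_closed. Qed.

Definition func_code f (xs : 'I_(ar_func f) -> carrier M) : carrier M :=
  code 1 (@pickle (func T) f) [seq xs i | i <- enum 'I_(ar_func f)].
Definition pred_bit R (xs : 'I_(ar_pred R) -> carrier M) : Prop :=
  bt (code 0 (form_code (@rel_form T R)) [seq xs i | i <- enum 'I_(ar_pred R)]).

Lemma dl_func_code f xs : (forall i, dl (xs i)) -> dl (@func_code f xs).
Proof. by move=> H; apply: dl_code => _ /List.in_map_iff [i [<- _]]. Qed.

Definition two_args n (xs ys : 'I_n -> carrier M) : nat -> carrier M :=
  prefix_env n (ordfun xs zr) (ordfun ys zr).

Lemma two_args_l n xs ys (i : 'I_n) : two_args xs ys i = xs i.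
Proof. by rewrite /two_args prefix_env_lt // ordfun_ord. Qed.

Lemma two_args_r n xs ys (i : 'I_n) : two_args xs ys (n + i) = ys i.
Proof. by rewrite /two_args prefix_env_add ordfun_ord. Qed.

Lemma map_two_args_l n (xs ys : 'I_n -> carrier M) :
  [seq two_args xs ys (nat_of_ord i) | i <- enum 'I_n] = [seq xs i | i <- enum 'I_n].
Proof. by apply: eq_map => i; rewrite two_args_l. Qed.

Lemma map_two_args_r n (xs ys : 'I_n -> carrier M) :
  [seq two_args xs ys (n + nat_of_ord i) | i <- enum 'I_n] = [seq ys i | i <- enum 'I_n].
Proof. by apply: eq_map => i; rewrite two_args_r. Qed.

Lemma dl_two_args n (xs ys : 'I_n -> carrier M) x :
  (forall i, dl (xs i)) -> (forall i, dl (ys i)) -> dl (two_args xs ys x).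
Proof.
move=> Hx Hy; rewrite /two_args /prefix_env /ordfun.
by case: ifP => _; case: insub.
Qed.

Lemma bt_equality e th : (forall i, dl (e i)) -> List.In th (equality_clauses T) -> qsat bt e th.
Proof.
move=> He Hth; apply: bt_clauses => //; rewrite /model_clauses.
exact: (List.in_app_iff _ _ _).2 (or_introl Hth).
Qed.

Lemma In_enum (I : finType) (i : I) : List.In i (enum I).
Proof. by apply/List_In_mem; rewrite mem_enum. Qed.

Lemma reflected_structure : exists (K : structure T) (c : carrier M -> carrier K),
  [/\ forall k, exists2 x, dl x & c x = k,
      forall x y, dl x -> dl y -> (c x = c y <-> eqv T bt x y),
      forall f xs, (forall i, dl (xs i)) -> c (func_code xs) = int_func (f := f) (fun i => c (xs i))
    & forall R xs, (forall i, dl (xs i)) ->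
        (int_pred (R := R) (fun i => c (xs i)) <-> pred_bit xs)].
Proof.
apply: quotient_structure.
- by exists zr.
- move=> x Hx; have := @bt_equality (fun=> x) _ _ (or_introl erefl).
  by move/(_ (fun=> Hx))/qsat_eq.
- move=> x y Hx Hy Hxy; have He : forall i, dl (env3 x y y i) by case=> [|[]].
  have /qsat_Imp H := bt_equality He (or_intror (or_introl erefl)).
  have /H : qsat bt (env3 x y y) (holds_eq T (Var 0) (Var 1)) by apply/qsat_eq; exact: Hxy.
  by move/qsat_eq.
- move=> x y z Hx Hy Hz Hxy Hyz.
  have He : forall i, dl (env3 x y z i) by case=> [|[]].
  have /qsat_Imp H := bt_equality He (or_intror (or_intror (or_introl erefl))).
  have /H /qsat_Imp {}H : qsat bt (env3 x y z) (holds_eq T (Var 0) (Var 1)) by apply/qsat_eq; exact: Hxy.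
  have /H : qsat bt (env3 x y z) (holds_eq T (Var 1) (Var 2)) by apply/qsat_eq; exact: Hyz.
  by move/qsat_eq.
- exact: dl_func_code.
- move=> f xs ys Hx Hy Hxy; pose n := ar_func f.
  have He i : dl (two_args xs ys i) by apply: dl_two_args.
  have /(bt_equality He) : List.In (QImp (eq_args T n)
      (holds_eq T (tcode 1 (pickle f) (argsl n)) (tcode 1 (pickle f) (argsr n)))) (equality_clauses T).
    rewrite /equality_clauses; do 3!right; apply/List.in_app_iff; left.
    by apply/List.in_map_iff; exists f; split=> //; apply: In_enum.
  move/qsat_Imp => H.
  have /H /qsat_eq : qsat bt (two_args xs ys) (eq_args T n).
    by apply/qsat_eq_args => i; rewrite two_args_l two_args_r.
  rewrite !teval_tcode teval_argsl teval_argsr /func_code.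
  by rewrite map_two_args_l map_two_args_r.
- move=> R xs ys Hx Hy Hxy; pose n := ar_pred R.
  have He i : dl (two_args xs ys i) by apply: dl_two_args.
  have /(bt_equality He) : List.In (QImp (eq_args T n) (QImp (holds_at (rel_form R) (argsl n))
         (holds_at (rel_form R) (argsr n)))) (equality_clauses T).
    rewrite /equality_clauses; do 3!right; apply/List.in_app_iff; right.
    by apply/List.in_map_iff; exists R; split=> //; apply: In_enum.
  move/qsat_Imp => H.
  have /H /qsat_Imp {}H : qsat bt (two_args xs ys) (eq_args T n).
    by apply/qsat_eq_args => i; rewrite two_args_l two_args_r.
  move: H; rewrite !qsat_at teval_argsl teval_argsr => H.
  by rewrite map_two_args_l map_two_args_r in H.
Qed.

Section Truth.
Variables (K : structure T) (c : carrier M -> carrier K).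
Hypothesis csurj : forall k, exists2 x, dl x & c x = k.
Hypothesis cE : forall x y, dl x -> dl y -> (c x = c y <-> eqv T bt x y).
Hypothesis cF : forall f xs, (forall i, dl (xs i)) ->
  c (func_code xs) = int_func (f := f) (fun i => c (xs i)).
Hypothesis cP : forall R xs, (forall i, dl (xs i)) ->
  (int_pred (R := R) (fun i => c (xs i)) <-> pred_bit xs).

Lemma dl_teval e t : (forall i, dl (e i)) -> dl (teval e t).
Proof. exact: teval_closed. Qed.

Lemma teval_class e (t : term T) : (forall i, dl (e i)) ->
  teval (fun x => c (e x)) t = c (teval e (skolem_term t)).
Proof.
move=> He; elim: t => [x|f ts IH] //; rewrite [skolem_term _]/= teval_tcode -map_comp.
have := @cF f (fun i => teval e (skolem_term (ts i))) _.
rewrite /func_code /= => -> => [|i]; last exact: dl_teval.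
by congr int_func; apply: funext.
Qed.

Lemma reflected_truth (phi : form T) n e :
  (forall e' th, (forall i, dl (e' i)) -> List.In th (truth_clauses n phi) -> qsat bt e' th) ->
  (forall i, dl (e i)) ->
  sat (fun x => c (e x)) phi <-> bt (code 0 (form_code phi) [seq e i | i <- iota 0 n]).
Proof.
elim: phi n e => [|t u|R ts|phi1 IH1 phi2 IH2|phi IH] n e Hcl He.
- have /qsat_Imp := Hcl e _ He (or_introl erefl).
  by rewrite qsat_at teval_vars.
- have /qsat_Iff := Hcl e _ He (or_introl erefl).
  rewrite qsat_at teval_vars => ->; rewrite qsat_eq -cE; try exact: dl_teval.
  by rewrite /= !teval_class.
- have /qsat_Iff := Hcl e _ He (or_introl erefl).
  rewrite !qsat_at teval_vars -map_comp => ->.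
  rewrite -[bt _]/(pred_bit (fun i => teval e (skolem_term (ts i)))) -cP => [/=|i]; last exact: dl_teval.
  suff -> : (fun i => teval (fun x => c (e x)) (ts i)) = (fun i => c (teval e (skolem_term (ts i)))) by [].
  by apply: funext => i; rewrite teval_class.
- have /qsat_Iff := Hcl e _ He (or_introl erefl).
  rewrite qsat_Imp !qsat_at teval_vars => ->.
  have H1 : sat (fun x => c (e x)) phi1 <-> bt (code 0 (form_code phi1) [seq e i | i <- iota 0 n]).
    apply: IH1 => // e' th He' Hth; apply: Hcl => //=; right.
    by apply/List.in_app_iff; left.
  have H2 : sat (fun x => c (e x)) phi2 <-> bt (code 0 (form_code phi2) [seq e i | i <- iota 0 n]).
    apply: IH2 => // e' th He' Hth; apply: Hcl => //=; right.
    by apply/List.in_app_iff; right.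
  by rewrite -H1 -H2.
- have IH' a : dl a -> sat (scons (c a) (fun x => c (e x))) phi <->
      bt (code 0 (form_code phi) (a :: [seq e i | i <- iota 0 n])).
    move=> Ha; have -> : scons (c a) (fun x => c (e x)) = (fun x => c (scons a e x)).
      by apply: funext => -[].
    have -> : a :: [seq e i | i <- iota 0 n] = [seq scons a e i | i <- iota 0 n.+1].
      by rewrite [iota 0 n.+1]/= map_cons -[1]addn0 iotaDl -map_comp.
    apply: IH => [e' th He' Hth|[|i]]; [|exact: Ha|exact: He].
    by apply: Hcl => //; right; right.
  rewrite sat_All; split=> [H|H k].
    have /qsat_Imp := Hcl e _ He (or_intror (or_introl erefl)).
    rewrite !qsat_at map_cons teval_tcode teval_vars; apply; apply/IH'; last exact: H.
    by apply: dl_code => _ /List.in_map_iff [i [<- _]].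
  have [a Ha <-] := csurj k; apply/IH' => //.
  have He' i : dl (scons a e i) by case: i.
  have /qsat_Imp := Hcl _ _ He' (or_introl erefl).
  rewrite !qsat_at -map_comp teval_vars => /(_ H).
  by rewrite [iota _ _]/= map_cons -[1]addn0 iotaDl -map_comp.
Qed.

Lemma reflected_axioms phi : sentence phi -> List.In phi A -> holds K phi.
Proof.
move=> Hs HA e; apply: (@sentence_sat _ _ phi (fun x => c zr)) => //.
have Hin th : List.In th (holds_at phi [::] :: truth_clauses 0 phi) ->
    List.In th (model_clauses A).
  rewrite /model_clauses => Hth; apply/In_cat; right.
  elim: A HA => //= psi A' IH [->|/IH H]; apply/(In_cat _ (_ :: _)).
    by left.
  by right.
apply: (@reflected_truth phi 0 (fun=> zr) _ (fun=> dl0)).2 => [e' th He' Hth|].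
  by apply: bt_clauses => //; apply: Hin; right.
have := @bt_clauses (fun=> zr) _ (fun=> dl0) (Hin _ (or_introl erefl)).
by move/qsat_at.
Qed.

End Truth.
End ReflectedModel.

Definition defined_relstr (T : signature) (M : structure arith) (delta eta : form arith)
    (pi : pred_sym (graph_sig T) -> form arith) : relstr T :=
  @RelStr T (carrier M) (fun x => sat (fun=> x) delta) (fun x y => sat (scons x (fun=> y)) eta)
    (fun R xs => sat (ordfun xs zr) (pi R)).

(* The interpretability content of Gödel's completeness theorem. *)
Theorem definable_model (T : signature) (A : seq (form T)) :
  is_theory (fin_theory A) -> consistent (fin_theory A) ->
  exists (F : seq (form arith)) (delta eta : form arith) (pi : pred_sym (graph_sig T) -> form arith),
  [/\ forall phi, List.In phi F -> true_Pi1 phi,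
       fbound 1 delta, fbound 2 eta, forall R, fbound (ar_pred R) (pi R) &
    forall M, (forall phi, List.In phi F -> holds M phi) ->
    exists (K : structure T) (c : carrier M -> carrier K),
      realizes (N := defined_relstr M delta eta pi) c /\
      forall phi, List.In phi A -> holds K phi].
Proof.
move=> HA Acon; have [K0 [[k0 _] HK0]] := model_existence HA Acon.
have [h hP] := course_of_values_choice k0 (@node_spec_local T K0) (node_spec_ex k0).
have [e|F [delta [beta [HF Hd Hb HM]]]] :=
    @definable_path (qAll (model_clauses A)) (truth_set h).
  apply/qsat_All => th /In_cat [|]; first exact: (truth_set_equality hP).
  have HA' phi : List.In phi A -> fbound 0 phi by move/HA.
  elim: A HA' HK0 {HA Acon} => //= psi A' IH HA' HK0 [<-|/In_cat [Hth|Hth]].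
  - apply/qsat_at/truth_setE; apply: HK0; by left.
  - by apply: (truth_set_clauses hP) Hth; apply: HA'; left.
  - by apply: IH Hth => phi Hphi; [apply: HA'|apply: HK0]; right.
pose tm t : form arith := fsubst (fun=> t) beta.
pose ff f := tcode 1 (pickle f) [seq Var (nat_of_ord i) | i <- enum 'I_(ar_func (f : func T))].
pose pi (R : pred_sym (graph_sig T)) : form arith :=
  match R with
  | inl f => tm (tcode 0 (form_code (eq_form T)) [:: ff f; Var (ar_func f)])
  | inr R => tm (tcode 0 (form_code (rel_form R)) [seq Var (nat_of_ord i) | i <- enum 'I_(ar_pred R)])
  end.
have Htm n t : tbound n t -> fbound n (tm t) by move=> Ht; apply: fbound_fsubst Hb _.
exists F, delta, (tm (tcode 0 (form_code (eq_form T)) [:: Var 0; Var 1])), pi; split=> //.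
- by apply/Htm/tbound_tcode => t [<-|[<-|]].
- case=> [f|R]; apply/Htm/tbound_tcode => t.
    case=> [<-|[<-|//]]; last by rewrite /= ltnSn.
    by apply: tbound_tcode => _ /List.in_map_iff [i [<- _]]; apply: ltnW; rewrite /= ltnS.
  by move/List.in_map_iff => [i [<- _]] /=.
move=> M HFM; have [dl [bt [Edl Ebt [dl0 dlS dlD dlM] Hbt]]] := HM M HFM.
have Edl' x : sat (fun=> x) delta <-> dl x := Edl (fun=> x).
have Etm e t : sat e (tm t) <-> bt (teval e t) by rewrite sat_subst Ebt.
have Hcl e th : (forall i, dl (e i)) -> List.In th (model_clauses A) -> qsat bt e th.
  by move=> /Hbt /qsat_All; apply.
have [K [c [csurj cE cF cP]]] := reflected_structure dl0 dlS dlD dlM Hcl.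
exists K, c; split; last first.
  by move=> phi Hphi; apply: (reflected_axioms dl0 dlS dlD dlM Hcl csurj cE cF cP) => //; apply: HA.
split.
- by move=> k; have [x Hx <-] := csurj k; exists x => //; apply/Edl.
- by move=> a b /Edl Ha /Edl Hb'; rewrite cE // [req _ _]/= Etm teval_tcode.
- move=> f xs y Hxs /Edl Hy; have {}Hxs i : dl (xs i) by apply/Edl'/Hxs.
  rewrite -cF // cE //; last exact: dl_func_code.
  rewrite [rrel _]/= Etm teval_tcode !map_cons /ff teval_tcode -map_comp /eqv.
  set e := ordfun _ _.
  have -> : teval e (Var (ar_func f)) = y.
    by rewrite /e /= -[ar_func f]/(nat_of_ord (@ord_max (ar_func f))) ordfun_ord /gargs unlift_none.
  have -> // : [seq ((teval e) \o (fun i : 'I__ => Var i)) i | i <- enum 'I_(ar_func f)] =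
          [seq xs i | i <- enum 'I_(ar_func f)].
  apply: eq_map => i /=.
  have -> : (i : nat) = lift ord_max i by rewrite /= /bump leqNgt ltn_ord.
  by rewrite /e ordfun_ord /gargs liftK.
- move=> R xs Hxs; have {}Hxs i : dl (xs i) by apply/Edl'/Hxs.
  rewrite cP // [rrel _]/= Etm teval_tcode -map_comp /pred_bit.
  have -> // : [seq ((teval (ordfun xs zr)) \o (fun i : 'I__ => Var i)) i | i <- enum 'I_(ar_pred R)] =
          [seq xs i | i <- enum 'I_(ar_pred R)].
  by apply: eq_map => i; rewrite /= ordfun_ord.
Qed.

(** * Composition and the theorem *)

Lemma map_blockenv_iota (X : Type) (vs : seq X) (e0 : nat -> X) o k : o + k <= size vs ->
  [seq blockenv vs e0 v | v <- iota o k] = take k (drop o vs).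
Proof.
move=> Hle; rewrite -(map_nth_iota (e0 0)) ?leq_subRL ?(leq_trans (leq_addr _ _) Hle) //.
apply: (@eq_from_nth _ (e0 0)); rewrite !size_map // => i; rewrite size_iota => lt_i.
have lt_oi : o + i < size vs by apply: leq_trans Hle; rewrite ltn_add2l.
by rewrite !(nth_map 0) ?size_iota // nth_iota // (@blockenv_lt _ (e0 0)).
Qed.

Lemma take_drop_flatten (X : Type) (ss : seq (seq X)) i :
  take (size (nth [::] ss i)) (drop (sumn (shape (take i ss))) (flatten ss)) = nth [::] ss i.
Proof.
elim: ss i => [|s ss IH] [|i] //=; first by rewrite drop0 take_size_cat.
by rewrite addnC -drop_drop drop_size_cat // IH.
Qed.

Lemma sumn_take_nth (l : seq nat) i : sumn (take i l) + nth 0 l i <= sumn l.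
Proof.
elim: l i => [|x l IH] [|i] //=; first by rewrite add0n leq_addr.
by rewrite -addnA leq_add2l.
Qed.

Section Composition.
Variables (S T : signature) (tau : translation arith S).
Variables (delta eta : form arith) (pi : pred_sym (graph_sig T) -> form arith).
Hypothesis delta_bound : fbound 1 delta.
Hypothesis eta_bound : fbound 2 eta.
Hypothesis pi_bound : forall R, fbound (ar_pred R) (pi R).

Definition dom_env (p : piece tau) : nat -> piece tau * seq nat := fun=> (p, iota 0 (dim p)).
Definition eq_env (p q : piece tau) : nat -> piece tau * seq nat :=
  scons (p, iota 0 (dim p)) (fun=> (q, iota (dim p) (dim q))).
Definition pred_env n (ps : 'I_n -> piece tau) : nat -> piece tau * seq nat := fun x =>
  if insub x is Some i then
    (ps i, iota (sumn (take x [seq dim (ps j) | j <- enum 'I_n])) (dim (ps i)))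
  else env0 tau 0.

Lemma sized_dom_env p : sized (dom_env p).
Proof. by move=> x; rewrite /= size_iota. Qed.

Lemma sized_eq_env p q : sized (eq_env p q).
Proof. by move=> [|x]; rewrite /= size_iota. Qed.

Lemma sized_pred_env n ps : sized (@pred_env n ps).
Proof. by move=> x; rewrite /pred_env; case: insub => [i|]; rewrite /= ?size_iota ?size_nseq. Qed.

Definition comp_dom p : form S := And (tr_dom p) (tr_rel (dom_env p) (unravel delta)).
Definition comp_eq p q : form S := tr_rel (eq_env p q) (unravel eta).
Definition comp_pred (R : pred_sym (graph_sig T)) (ps : {ffun 'I_(ar_pred R) -> piece tau}) : form S :=
  tr_rel (pred_env ps) (unravel (pi R)).

Lemma comp_dom_bound p : fbound (dim p) (comp_dom p).
Proof.
rewrite fbound_And tr_dom_bound.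
apply: (fbound_tr_rel (@sized_dom_env p) (fbound_unravel delta_bound)) => x _.
by apply/allP => v; rewrite mem_iota.
Qed.

Lemma comp_eq_bound p q : fbound (dim p + dim q) (comp_eq p q).
Proof.
apply: (fbound_tr_rel (@sized_eq_env p q) (fbound_unravel eta_bound)) => -[|x] _ /=;
apply/allP => v; rewrite mem_iota /=; last by case/andP.
by move/leq_trans; apply; rewrite leq_addr.
Qed.

Lemma comp_pred_bound (R : pred_sym (graph_sig T)) (ps : {ffun 'I_(ar_pred R) -> piece tau}) :
  fbound (\sum_(i < ar_pred R) dim (ps i)) (comp_pred ps).
Proof.
apply: (fbound_tr_rel (@sized_pred_env _ ps) (fbound_unravel (pi_bound R))) => x lt_x.
rewrite -[x]/(nat_of_ord (Ordinal lt_x)); move: (Ordinal lt_x) => i {x lt_x}.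
rewrite /pred_env valK /=; apply/allP => v; rewrite mem_iota => /andP [_ /leq_trans]; apply.
have -> : \sum_(i < ar_pred R) dim (ps i) = sumn [seq dim (ps j) | j <- enum 'I_(ar_pred R)].
  by rewrite sumnE big_map big_enum.
apply: leq_trans (sumn_take_nth _ i); rewrite leq_add2l.
by rewrite (nth_map i) ?size_enum_ord // nth_ord_enum.
Qed.

Definition comp : translation T S :=
  @Translation T S (piece tau) (piece0 tau) (@dim _ _ tau) comp_dom comp_eq comp_pred
    comp_dom_bound comp_eq_bound comp_pred_bound.

Variables (M : structure S) (e0 : nat -> carrier M).
Local Notation N := (inner tau e0).
Local Notation Nc := (inner comp e0).

Lemma eval_dom_env (a : rcar N) : size a.2 = dim a.1 ->
  eval_env e0 (blockenv a.2 e0) (dom_env a.1) = fun=> a.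
Proof.
case: a => p v /= sz_v; apply: funext => x; rewrite /eval_env /=; congr (_, _).
by rewrite map_blockenv_iota ?sz_v // drop0 -sz_v take_size.
Qed.

Lemma eval_eq_env (a b : rcar N) : size a.2 = dim a.1 -> size b.2 = dim b.1 ->
  eval_env e0 (blockenv (a.2 ++ b.2) e0) (eq_env a.1 b.1) = scons a (fun=> b).
Proof.
case: a b => [p v] [q w] /= sz_v sz_w; apply: funext => -[|x]; rewrite /eval_env /=; congr (_, _).
  by rewrite map_blockenv_iota ?size_cat ?sz_v ?leq_addr // drop0 -sz_v take_size_cat.
by rewrite map_blockenv_iota ?size_cat ?sz_v ?sz_w // -sz_v drop_size_cat // -sz_w take_size.
Qed.

Lemma eval_pred_env n (xs : 'I_n -> rcar N) (ps : 'I_n -> piece tau) (i : 'I_n) :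
  (forall i, size (xs i).2 = dim (xs i).1) -> (forall i, ps i = (xs i).1) ->
  eval_env e0 (blockenv (flatten [seq (xs i).2 | i <- enum 'I_n]) e0) (pred_env ps) i = xs i.
Proof.
move=> Hxs Hps; rewrite /eval_env /pred_env valK /=; set ss := [seq (xs j).2 | j <- enum 'I_n].
have Ess : [seq dim (ps j) | j <- enum 'I_n] = shape ss.
  by rewrite /ss /shape -map_comp; apply: eq_map => j; rewrite /= Hxs Hps.
have Ei : nth [::] ss i = (xs i).2 by rewrite (nth_map i) ?size_enum_ord // nth_ord_enum.
have Hi : nth 0 (shape ss) i = dim (ps i).
  by rewrite -Ess (nth_map i) ?size_enum_ord // nth_ord_enum.
rewrite map_blockenv_iota; last by rewrite Ess size_flatten -Hi sumn_take_nth.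
rewrite Hps [RHS]surjective_pairing; congr (_, _).
by rewrite Ess /shape -map_take -Hxs -Ei take_drop_flatten.
Qed.

Variables (Mar : structure arith) (c1 : rcar N -> carrier Mar).
Hypothesis c1P : realizes c1.

Lemma comp_rdom (a : rcar N) : @rdom _ Nc a <-> rdom a /\ sat (fun=> c1 a) delta.
Proof.
rewrite -[@rdom _ Nc a]/(size a.2 = dim a.1 /\ sat (blockenv a.2 e0) (comp_dom a.1)).
rewrite /comp_dom sat_And; split=> [[sz_a [Ha]]|[[sz_a Ha] Hd]].
  rewrite (sat_tr_rel e0); last exact: sized_dom_env.
  by rewrite eval_dom_env // (rsat_unravel c1P).
split=> //; split=> //; apply/(sat_tr_rel e0); first exact: sized_dom_env.
by rewrite eval_dom_env //; apply/(rsat_unravel c1P).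
Qed.

Lemma comp_req (a b : rcar N) : rdom a -> rdom b ->
  @req _ Nc a b <-> sat (scons (c1 a) (fun=> c1 b)) eta.
Proof.
move=> Da Db; have [sz_a _] := Da; have [sz_b _] := Db.
rewrite [req _ _]/= (sat_tr_rel e0); last exact: sized_eq_env.
rewrite eval_eq_env // (rsat_unravel c1P) => [|[]] //.
by have -> : (fun x => c1 (scons a (fun=> b) x)) = scons (c1 a) (fun=> c1 b) by apply: funext => -[].
Qed.

Lemma comp_rrel (R : pred_sym (graph_sig T)) (xs : 'I_(ar_pred R) -> rcar N) :
  (forall i, rdom (xs i)) ->
  @rrel _ Nc R xs <-> sat (ordfun (fun i => c1 (xs i)) zr) (pi R).
Proof.
move=> Dxs; have [a0 Da0 _] := rz_surj c1P zr.
rewrite [rrel _]/= (sat_tr_rel e0); last exact: sized_pred_env.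
rewrite (rsat_ext (er' := ordfun xs a0) (fbound_unravel (pi_bound R))); last first.
  move=> x lt_x; rewrite -[x]/(nat_of_ord (Ordinal lt_x)) ordfun_ord eval_pred_env //.
    by move=> i; have [] := Dxs i.
  by move=> i; rewrite ffunE.
rewrite (rsat_unravel c1P) => [|x]; last by rewrite /ordfun; case: insub.
apply: sat_ext (pi_bound R) _ => x lt_x.
by rewrite -[x]/(nat_of_ord (Ordinal lt_x)) !ordfun_ord.
Qed.

Lemma comp_realizes (K : structure T) (c2 : carrier Mar -> carrier K) :
  realizes (N := defined_relstr Mar delta eta pi) c2 ->
  realizes (N := Nc) (fun a => c2 (c1 a)).
Proof.
move=> c2P; split.
- move=> k; have [m Dm <-] := rz_surj c2P k; have [a Da Ea] := rz_surj c1P m.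
  by exists a; [apply/comp_rdom; rewrite Ea|rewrite Ea].
- move=> a b /comp_rdom [Da Ha] /comp_rdom [Db Hb]; rewrite comp_req //.
  exact: (rz_eq c2P Ha Hb).
- move=> f xs y Dxs /comp_rdom [Dy Hy].
  have {}Dxs i := (comp_rdom (xs i)).1 (Dxs i).
  rewrite -(rz_func c2P (xs := fun i => c1 (xs i)) (y := c1 y)) //; last by move=> i; have [] := Dxs i.
  rewrite comp_rrel; last by move=> i; rewrite /gargs; case: unlift => // j; have [] := Dxs j.
  rewrite [rrel _]/=; suff -> : (fun i => c1 (gargs xs y i)) =
    @gargs _ (defined_relstr Mar delta eta pi) f (fun i => c1 (xs i)) (c1 y) by [].
  by apply: funext => i; rewrite /gargs; case: unlift.
- move=> R xs Dxs; have {}Dxs i := (comp_rdom (xs i)).1 (Dxs i).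
  rewrite -(rz_pred c2P (xs := fun i => c1 (xs i))); last by move=> i; have [] := Dxs i.
  by rewrite comp_rrel // => i; have [] := Dxs i.
Qed.

End Composition.

Lemma realizes_translate (S T : signature) (tau : translation T S) (M : structure S)
    (e : nat -> carrier M) (K : structure T) (c : rcar (inner tau e) -> carrier K) (phi : form T) :
  realizes c -> sentence phi -> holds K phi -> sat e (translate tau (unravel phi)).
Proof.
move=> cP Hs Hphi; apply/(sat_translate _ e).
have [a0 Da0 _] := rz_surj cP (c (eval_env e e (env0 tau) 0)).
apply: (rsat_ext (er := fun=> a0) (fbound_unravel Hs) _).1 => //.
by apply/(rsat_unravel cP) => //; apply: Hphi.
Qed.

Lemma translate_realizes (S T : signature) (tau : translation T S) (M : structure S)
    (e : nat -> carrier M) (F : seq (form T)) : is_theory (fin_theory F) ->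
  sat e (translate tau (And (identity_ax T) (unravel (conj_axioms F)))) ->
  exists (K : structure T) (c : rcar (inner tau e) -> carrier K),
    realizes c /\ forall phi, List.In phi F -> holds K phi.
Proof.
move=> HF; rewrite (sat_translate _ e) rsat_And => -[/rsat_identity laws HFs].
have [K [c cP]] := identity_laws_realizes laws; exists K, c; split=> //.
have [a0 Da0 _] := rz_surj cP (c (eval_env e e (env0 tau) 0)).
have Hb : fbound 0 (conj_axioms F) by apply: fbound_bigAnd => phi; apply: HF.
move: HFs; rewrite (rsat_ext (er' := fun=> a0) (fbound_unravel Hb)) //.
rewrite (rsat_unravel cP) // /conj_axioms sat_bigAnd => H phi Hphi e'.
exact: sentence_sat (HF _ Hphi) (H phi Hphi).
Qed.

Lemma locally_tolerates_polyglot (S : signature) (U : theory S) : is_theory U ->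
  locally_tolerates U Q_plus_true_Pi1 -> polyglot U.
Proof.
move=> HU Htol T A HA Acon.
have [F [delta [eta [pi [HF Hd He Hp HM]]]]] := definable_model HA Acon.
have HFs : is_theory (fin_theory F) by move=> phi /HF [[]].
have [phi /HF H|tau Hcon] := Htol F HFs; first by apply: proves_ax; right.
set B := translate _ _ in Hcon; exists B; split=> //.
have HB : sentence B.
  apply: sentence_translate; rewrite fbound_And fbound_identity_ax.
  by apply: fbound_unravel; apply: fbound_bigAnd => phi; apply: HFs.
split=> //; have HUB : is_theory (add_axiom U B) by move=> phi [/HU|->].
pose sigma := comp tau Hd He Hp; exists sigma.
have models (M : structure S) (e : nat -> carrier M) :
    (forall psi, add_axiom U B psi -> holds M psi) ->
    exists (K : structure T) (c : rcar (inner sigma e) -> carrier K),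
      realizes c /\ forall phi, List.In phi A -> holds K phi.
  move=> HMB; have [Mar [c1 [c1P HMar]]] := translate_realizes HFs (HMB B (or_intror erefl) e).
  have [K [c2 [c2P HK]]] := HM Mar HMar.
  by exists K, (fun a => c2 (c1 a)); split=> //; apply: comp_realizes.
split.
  apply: completeness => // [|M HMB e]; first exact/sentence_translate/fbound_identity_ax.
  have [K [c [cP _]]] := models M e HMB.
  apply/(sat_translate _ e)/(realizes_identity cP).
  by exists (c (eval_env e e (env0 sigma) 0)).
move=> phi Hphi HAphi; apply: completeness => // [|M HMB e].
  exact/sentence_translate/fbound_unravel.
have [K [c [cP HK]]] := models M e HMB.
exact: realizes_translate cP Hphi (proves_holds HK HAphi).
Qed.

Lemma std_nat_Q phi : Robinson_Q phi -> holds std_nat phi.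
Proof.
case=> [<-|[<-|[<-|[<-|[<-|[<-|[<-|[]]]]]]]] e.
- by move=> x.
- by rewrite /= => x y [].
- move=> x; apply/sat_Or; case: x => [|x]; [by left|right; apply/sat_Ex; by exists x].
- by move=> x; apply: addn0.
- by rewrite /= => x y; apply: addnS.
- by move=> x; apply: muln0.
- by rewrite /= => x y; exact: etrans (mulnS _ _) (addnC _ _).
Qed.

Lemma polyglot_locally_tolerates (S : signature) (U : theory S) :
  polyglot U -> locally_tolerates U Q_plus_true_Pi1.
Proof.
move=> Hpoly A HA Asub.
have HN phi : List.In phi A -> holds std_nat phi.
  by move/Asub; apply: proves_holds => psi [/std_nat_Q|[]].
have Acon : consistent (fin_theory A).
  by move/(proves_holds HN) => /(_ (fun=> 0)).
have [B [[HB [tau [Hid Htau]]] Bcon]] := Hpoly _ A HA Acon.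
exists tau => /proves_impI Hneg; apply: Bcon; apply: proves_impE.
  by apply: proves_mono Hneg => psi; left.
apply: (proves2 (fun G => @nd_AndI _ G _ _) Hid); apply: Htau.
  by apply: fbound_bigAnd => phi; apply: HA.
by apply: proves_bigAnd => phi Hphi; apply: proves_ax.
Qed.

Theorem theorem2p7 (S : signature) (U : theory S) (hU : is_theory U) :
  polyglot U <-> locally_tolerates U Q_plus_true_Pi1.
Proof.
split; first exact: polyglot_locally_tolerates.
exact: locally_tolerates_polyglot.
Qed.
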